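(* Let $m,n\in\mathbb{N}$. Let $\varphi=(\varphi_1,\dots,\varphi_n):\mathbb{N}\to\mathbb{R}^n$ be an $n$-tuple of non-increasing positive functions with $\lim_{q\to\infty}\varphi_j(q)=0$ for $1\le j\le n$, and let $\Phi=(\Phi_1,\dots,\Phi_m):\mathbb{N}\to\mathbb{R}^m$ be an $m$-tuple of non-decreasing positive functions with $\lim_{q\to\infty}\Phi_k(q)=\infty$ for $1\le k\le m$. Suppose there are constants $N_0,M\in\mathbb{N}$, $M\ge2$, and $c_1,c_2>1$ such that for every integer $j\ge N_0$ $$c_1\Phi_k(M^j)\le\Phi_k(M^{j+1})\le c_2\Phi_k(M^j)\qquad(1\le k\le m).$$ Then $$\mu^{\mathbb{H}}_{m\times n}\left(W^{\mathbb{H}}_{n,m}(\varphi,\Phi)\right)=\begin{cases}0&\text{if }\sum_{q=1}^\infty\frac1q\left(\prod_{j=1}^n\varphi_j(q)\prod_{k=1}^m\Phi_k(q)\right)^4<\infty,\\ \mu^{\mathbb{H}}_{m\times n}(I_{\mathbb{H}}^{m\times n})&\text{if }\sum_{q=1}^\infty\frac1q\left(\prod_{j=1}^n\varphi_j(q)\prod_{k=1}^m\Phi_k(q)\right)^4=\infty.\end{cases}$$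
   Context: $\mathbb{H}$ is the skew field of real quaternions $\xi=a+bi+cj+dk$ ($i^2=j^2=-1$, $k=ij=-ji$), with norm $|\xi|=\sqrt{a^2+b^2+c^2+d^2}$, identified with $\mathbb{R}^4$ as a real vector space. The Hurwitz integers are $\mathbb{Z}_{\mathbb{H}}=\{\frac a2+\frac b2i+\frac c2j+\frac d2k:a,b,c,d\in\mathbb{Z},\ a\equiv b\equiv c\equiv d\pmod 2\}$. $\llbracket\xi\rrbracket$ denotes the distance (with respect to $|\cdot|$) from $\xi$ to the nearest Hurwitz integer. $I_{\mathbb{H}}=\{\xi\in\mathbb{H}:|\xi|\le|\xi-\zeta|\text{ for all }\zeta\in\mathbb{Z}_{\mathbb{H}}\}$, and $I_{\mathbb{H}}^{m\times n}$ is the set of $m\times n$ matrices with entries in $I_{\mathbb{H}}$; $A_j$ is the $j$-th column of $A$. $W^{\mathbb{H}}_{n,m}(\varphi,\Phi)\subseteq I_{\mathbb{H}}^{m\times n}$ is the set of matrices $A$ such that for infinitely many integers $u\ge1$ the system $\llbracket\mathbf qA_j\rrbracket<\varphi_j(u)$ ($1\le j\le n$), $|q_k|\le\Phi_k(u)$ ($1\le k\le m$) has a non-zero solution $\mathbf q=(q_1,\dots,q_m)\in\mathbb{Z}_{\mathbb{H}}^{1\times m}$ (so $\mathbf qA_j=\sum_k q_kA_{k,j}$, with $q_k$ multiplying on the left). $\mu^{\mathbb{H}}_{m\times n}$ is Lebesgue measure on $\mathbb{H}^{m\times n}\cong\mathbb{R}^{4mn}$. *)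

(* Defs.v *)
From HB Require Import structures.
From mathcomp Require Import all_boot all_order all_algebra.
From mathcomp Require Import ring.
From mathcomp Require Import all_classical all_reals all_analysis.

Set Implicit Arguments.
Unset Strict Implicit.
Unset Printing Implicit Defensive.
Import Order.TTheory GRing.Theory Num.Theory.
Import numFieldNormedType.Exports.
Local Open Scope classical_set_scope.
Local Open Scope ring_scope.

Record quat (R : Type) := Quat { qre : R; qi : R; qj : R; qk : R }.

Definition quat_to_prod (R : Type) (x : quat R) : R * R * R * R :=
  (qre x, qi x, qj x, qk x).

Definition quat_of_prod (R : Type) (p : R * R * R * R) : quat R :=
  Quat p.1.1.1 p.1.1.2 p.1.2 p.2.

Lemma quat_to_prodK (R : Type) : cancel (@quat_to_prod R) (@quat_of_prod R).
Proof. by case. Qed.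

HB.instance Definition _ (R : choiceType) :=
  Choice.copy (quat R) (can_type (@quat_to_prodK R)).

Section QuatRing.
Variable R : comNzRingType.
Implicit Types x y z : quat R.

Definition zeroq : quat R := Quat 0 0 0 0.
Definition oneq : quat R := Quat 1 0 0 0.
Definition oppq x : quat R := Quat (- qre x) (- qi x) (- qj x) (- qk x).
Definition addq x y : quat R :=
  Quat (qre x + qre y) (qi x + qi y) (qj x + qj y) (qk x + qk y).

(* The Hamilton product: i^2 = j^2 = -1 and k = ij = -ji. *)
Definition mulq x y : quat R :=
  Quat (qre x * qre y - qi x * qi y - qj x * qj y - qk x * qk y)
       (qre x * qi y + qi x * qre y + qj x * qk y - qk x * qj y)
       (qre x * qj y - qi x * qk y + qj x * qre y + qk x * qi y)
       (qre x * qk y + qi x * qj y - qj x * qi y + qk x * qre y).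

Fact addqA : associative addq.
Proof. by move=> x y z; congr Quat; exact: addrA. Qed.

Fact addqC : commutative addq.
Proof. by move=> x y; congr Quat; exact: addrC. Qed.

Fact add0q : left_id zeroq addq.
Proof. by case=> *; congr Quat; exact: add0r. Qed.

Fact addNq : left_inverse zeroq oppq addq.
Proof. by move=> x; congr Quat; exact: addNr. Qed.

HB.instance Definition _ :=
  GRing.isZmodule.Build (quat R) addqA addqC add0q addNq.

Fact mulqA : associative mulq.
Proof. by move=> x y z; congr Quat => /=; ring. Qed.

Fact mul1q : left_id oneq mulq.
Proof. by case=> *; congr Quat => /=; ring. Qed.

Fact mulq1 : right_id oneq mulq.
Proof. by case=> *; congr Quat => /=; ring. Qed.

Fact mulqDl : left_distributive mulq addq.
Proof. by move=> x y z; congr Quat => /=; ring. Qed.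

Fact mulqDr : right_distributive mulq addq.
Proof. by move=> x y z; congr Quat => /=; ring. Qed.

Fact oneq_neq0 : oneq != 0.
Proof. by apply/eqP => -[/eqP]; rewrite oner_eq0. Qed.

HB.instance Definition _ :=
  GRing.Zmodule_isNzRing.Build (quat R) mulqA mul1q mulq1 mulqDl mulqDr
    oneq_neq0.

End QuatRing.

Section Hurwitz.
Variable R : realType.
Implicit Types x y : quat R.

Definition qnorm x : R :=
  Num.sqrt (qre x ^+ 2 + qi x ^+ 2 + qj x ^+ 2 + qk x ^+ 2).

Definition Hurwitz : set (quat R) :=
  [set x | exists a b c d : int,
     [/\ (a = b %[mod 2])%Z, (b = c %[mod 2])%Z, (c = d %[mod 2])%Z &
         x = Quat (a%:~R / 2) (b%:~R / 2) (c%:~R / 2) (d%:~R / 2)]].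

Definition Hurwitz_dist x : R := inf [set qnorm (x - z) | z in Hurwitz].

Definition Hurwitz_cell : set (quat R) :=
  [set x | forall z, Hurwitz z -> qnorm x <= qnorm (x - z)].

Definition Hurwitz_cell_mx (m n : nat) : set 'M[quat R]_(m, n) :=
  [set A | forall k j, Hurwitz_cell (A k j)].

(* Index sets are 0-based: column [j : 'I_n] stands for the (j+1)-st one.
   The entry [(q *m A) 0 j] is [\sum_k q 0 k * A k j], so that the
   coefficients multiply on the left. *)
Definition approximable_mx (m n : nat)
    (phi : 'I_n -> nat -> R) (Phi : 'I_m -> nat -> R) : set 'M[quat R]_(m, n) :=
  [set A | Hurwitz_cell_mx A /\
    infinite_set [set u : nat | (1 <= u)%N /\
      exists q : 'rV[quat R]_m,
        [/\ q != 0,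
            forall k, Hurwitz (q 0 k),
            forall j, Hurwitz_dist ((q *m A) 0 j) < phi j u &
            forall k, qnorm (q 0 k) <= Phi k u]]].

End Hurwitz.

Section LebesgueTuple.
Variable R : realType.
Local Notation rT := (measurableTypeR R).
Local Open Scope ereal_scope.

Definition tuple_consp (d : nat) (p : rT * d.-tuple rT) : d.+1.-tuple rT :=
  [tuple of p.1 :: p.2].

Lemma measurable_tuple_consp (d : nat) :
  measurable_fun [set: rT * d.-tuple rT] (@tuple_consp d).
Proof. exact: measurable_cons. Qed.

Section ConsMeasure.
Variables (d : nat) (mu : {sigma_finite_measure set (d.-tuple rT) -> \bar R}).

Definition lebesgue_cons : set (d.+1.-tuple rT) -> \bar R :=
  pushforward (lebesgue_measure \x mu) (@tuple_consp d).

Let lebesgue_cons0 : lebesgue_cons set0 = 0.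
Proof. by rewrite /lebesgue_cons /pushforward preimage_set0 measure0. Qed.

Let lebesgue_cons_ge0 A : 0 <= lebesgue_cons A.
Proof. by rewrite /lebesgue_cons /pushforward; exact: measure_ge0. Qed.

Let lebesgue_cons_sigma_additive : semi_sigma_additive lebesgue_cons.
Proof.
move=> F mF tF mUF; rewrite /lebesgue_cons /pushforward preimage_bigcup.
apply: measure_semi_sigma_additive.
- move=> n; rewrite -[X in measurable X]setTI.
  exact: measurable_tuple_consp.
- apply/trivIsetP => /= i j _ _ ij; rewrite -preimage_setI.
  by move/trivIsetP : tF => /(_ _ _ _ _ ij) ->//; rewrite preimage_set0.
- rewrite -preimage_bigcup -[X in measurable X]setTI.
  exact: measurable_tuple_consp.
Qed.

HB.instance Definition _ := isMeasure.Build _ _ _ lebesgue_cons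
  lebesgue_cons0 lebesgue_cons_ge0 lebesgue_cons_sigma_additive.

Lemma lebesgue_cons_box (A : set rT) (B : set (d.-tuple rT)) :
  measurable A -> measurable B ->
  lebesgue_cons [set t | A (thead t) /\ B [tuple of behead t]] =
    lebesgue_measure A * mu B.
Proof.
move=> mA mB; rewrite -product_measure1E// /lebesgue_cons /pushforward.
have beheadE (x : rT) (t : d.-tuple rT) :
    [tuple of behead (tuple_consp (x, t))] = t by exact/val_inj.
congr (_ _); apply/seteqP; split => -[x t] /=;
  by rewrite -/(tuple_consp (x, t)) theadE beheadE.
Qed.

Let lebesgue_cons_sigma_finite : sigma_finite setT lebesgue_cons.
Proof.
have /sigma_finiteP[F [UF ndF Foo]] :=
  sigma_finiteT (@lebesgue_measure R).
have /sigma_finiteP[G [UG ndG Goo]] := sigma_finiteT mu.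
exists (fun k => [set t | F k (thead t) /\ G k [tuple of behead t]]).
  apply/esym; rewrite -subTset => t _.
  have [i _ Fi] : (\bigcup_i F i) (thead t) by rewrite -UF.
  have [j _ Gj] : (\bigcup_i G i) [tuple of behead t] by rewrite -UG.
  exists (maxn i j) => //; split.
  - by move: Fi; apply/subsetPset/ndF; rewrite leq_maxl.
  - by move: Gj; apply/subsetPset/ndG; rewrite leq_maxr.
move=> k; have [mF Fk] := Foo k; have [mG Gk] := Goo k; split; last first.
  by rewrite lebesgue_cons_box// lte_mul_pinfty// ge0_fin_numE.
rewrite [X in measurable X](_ : _ =
  (fun t : d.+1.-tuple rT => tnth t ord0) @^-1` F k `&`
  (fun t : d.+1.-tuple rT => [tuple of behead t]) @^-1` G k)//.
apply: measurableI; rewrite -[X in measurable X]setTI.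
- exact: measurable_tnth.
- exact: measurable_behead.
Qed.

HB.instance Definition _ := Measure_isSigmaFinite.Build _ _ _
  lebesgue_cons lebesgue_cons_sigma_finite.

End ConsMeasure.

Section Point.

Let dirac_nil : set (0.-tuple rT) -> \bar R := \d_[tuple].

HB.instance Definition _ := Measure.on dirac_nil.

Let dirac_nil_sigma_finite : sigma_finite setT dirac_nil.
Proof.
exists (fun=> setT); first by rewrite bigcup_const//; exists 0%N.
by move=> _; split => //; rewrite /dirac_nil diracT ltry.
Qed.

HB.instance Definition _ := Measure_isSigmaFinite.Build _ _ _
  dirac_nil dirac_nil_sigma_finite.

Definition lebesgue_nil : {sigma_finite_measure set (0.-tuple rT) -> \bar R} :=
  dirac_nil.

End Point.

(* Lebesgue measure on the Borel sets of R^d, as an iterated product of the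
   Lebesgue measure of the line starting from the unit mass on R^0. *)
Fixpoint lebesgue_tuple (d : nat) :
    {sigma_finite_measure set (d.-tuple rT) -> \bar R} :=
  match d with
  | 0 => lebesgue_nil
  | d'.+1 => lebesgue_cons (lebesgue_tuple d')
  end.

Lemma lebesgue_tuple_box (d : nat) (A : 'I_d -> set rT) :
  (forall i, measurable (A i)) ->
  lebesgue_tuple d [set t | forall i, A i (tnth t i)] =
    \prod_(i < d) lebesgue_measure (A i).
Proof.
elim: d A => [A _|d IHd A mA].
  rewrite big_ord0 (_ : [set t | _] = setT).
    exact: (@diracT _ _ R ([tuple] : 0.-tuple rT)).
  by apply/seteqP; split => // t _ [].
rewrite big_ord_recl -IHd; last by move=> i; exact: mA.
rewrite -(@lebesgue_cons_box _ (lebesgue_tuple d))//; last first.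
  rewrite (_ : [set t | _] = \bigcap_i
    ((fun t : d.-tuple rT => tnth t i) @^-1` A (lift ord0 i))).
    apply: fin_bigcap_measurable => // i _.
    by rewrite -[X in measurable X]setTI; exact: measurable_tnth.
  by apply/seteqP; split => t /= At i => [_|]; exact: At.
have tnth_lift (t : d.+1.-tuple rT) i :
    tnth t (lift ord0 i) = tnth [tuple of behead t] i.
  by rewrite {1}(tuple_eta t) tnthS.
congr (lebesgue_cons _ _); apply/seteqP; split => t /=.
- move=> At; split; first exact: (At ord0).
  by move=> i; rewrite -tnth_lift; exact: At.
- move=> [A0 At] i; case: (unliftP ord0 i) => [j ->|->//].
  by rewrite tnth_lift; exact: At.
Qed.

(* The identification of R^(4mn) with the m x n quaternionic matrices: each
   quaternion contributes its four real coordinates. *)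
Definition quat_mx_of_tuple (m n : nat) (t : (m * n * 4).-tuple R) :
    'M[quat R]_(m, n) :=
  \matrix_(k, j)
    let coord c := tnth t (mxvec_index (mxvec_index k j) c) in
    Quat (coord (inord 0%N)) (coord (inord 1%N)) (coord (inord 2%N))
         (coord (inord 3%N)).

Definition quat_mx_measure (m n : nat) (A : set 'M[quat R]_(m, n)) : \bar R :=
  lebesgue_tuple (m * n * 4) (@quat_mx_of_tuple m n @^-1` A).

End LebesgueTuple.

(* Main.v *)
Require Import Defs.
From mathcomp Require Import all_boot all_order all_algebra.
From mathcomp Require Import ring lra zify.
From mathcomp Require Import all_classical all_reals all_analysis.
From mathcomp Require Import measurable_realfun.
Import Order.TTheory GRing.Theory Num.Theory.
Import numFieldNormedType.Exports.
Local Open Scope classical_set_scope.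
Local Open Scope ring_scope.

Set Implicit Arguments.
Unset Strict Implicit.
Unset Printing Implicit Defensive.

(** Convergence is Borel-Cantelli. For a vector [q <> 0] of Hurwitz integers, the
    matrices [A] of the unit cube with [|| q A_j || < eps_j] for all [j] have
    measure [O(prod_j eps_j ^ 4)] ([near_lattice_measure]), and there are [O(prod_k X_k ^ 4)] vectors with
    [|q_k| <= X_k], so one system costs [O((prod eps prod X) ^ 4)]
    ([solvable_measure]). By monotonicity all systems with
    [M ^ i <= u < M ^ (i+1)] follow from a single one of comparable cost, and
    the growth of [Phi] turns the series into the sum of these costs along [M ^ i]
    ([volume_bounded], [volume_unbounded]).

    Divergence has three steps.

    - Local from global. If [A = (a + B) / N] with [a] integral, then [N q] does
      for [A] what [q] does for [B]. Hence a lower bound for the measure of the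
      limsup set inside the unit cube that does not depend on [phi] and [Phi],
      applied to [Phi / N], bounds its proportion in every cube of side [1 / N]
      from below. The complement, being almost a union of small cubes, is
      then null ([grid_density], [infinitely_solvable_full]). The cell of
      the Hurwitz order enters only through being bounded and through invariance
      under integral translations.

    - Ubiquity. By Dirichlet's pigeonhole ([dirichlet]), every [A] has a solution [q]
      of [|q_k| <= Phi_k], [|| q A_j || < delta_j] as soon as
      [prod delta prod Phi] is a suitable constant. By the union bound, the
      solutions with [|q_1|] much smaller than [Phi_1] are rare
      ([good_set_measure]). So most points of row [1] of [A], the other rows being
      fixed, are at distance [O(delta_j / Phi_1)] from a resonant point
      [q_1^-1 (z - sum_(k > 1) q_k A_k)]. Working with one row makes the resonant
      sets points, whatever the number of rows, and Fubini puts the rows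
      together.

    - Second moment. On each fibre keep one resonant point in every occupied cell
      of a grid with sides [delta_j / Phi_1], and around it a box with sides of
      order [phi_j / Phi_1]. The union of these boxes has measure of order
      [(prod phi prod Phi) ^ 4], the general term of the divergent sum, and unions
      at different levels are independent up to a constant and a geometrically
      decaying correlation ([target_lower], [target_upper],
      [quasi_independent_limsup], [ubiquity]). The decay needs each
      [delta_j] to be non-increasing; such [delta_j >= phi_j] exist by
      [exists_noninc_majorant] when [prod phi prod Phi] is eventually bounded by
      the Dirichlet constant, and otherwise Dirichlet's theorem solves the
      original system for every [A]. *)

(** * Lebesgue measure on tuples *)

(** The image of a measure is a measure only along a proof that the map is
    measurable; this form hides the proof from later statements. *)
Lemma pushforward_measureP d1 d2 (T1 : measurableType d1)
    (T2 : measurableType d2) (R : realType) (m : {measure set T1 -> \bar R})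
    (f : T1 -> T2) : measurable_fun setT f ->
  exists nu : {measure set T2 -> \bar R}, forall A, nu A = m (f @^-1` A).
Proof. by move=> mf; unshelve eexists (pushforward m f). Qed.

Section TupleMeasure.
Variable R : realType.
Local Notation rT := (measurableTypeR R).

Definition box d (A : 'I_d -> set R) : set (d.-tuple rT) :=
  [set t | forall i, A i (tnth t i)].

Lemma measurable_coord d (A : set R) (i : 'I_d) :
  measurable (A : set rT) -> measurable [set t : d.-tuple rT | A (tnth t i)].
Proof.
by move=> mA; rewrite -[X in measurable X]setTI; exact: measurable_tnth.
Qed.

Lemma box_bigcap d (A : 'I_d -> set R) :
  box A = \bigcap_(i in [set: 'I_d]) [set t : d.-tuple rT | A i (tnth t i)].
Proof. by apply/seteqP; split => t /= At i => [_|]; exact: At. Qed.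

Lemma measurable_box d (A : 'I_d -> set R) :
  (forall i, measurable (A i : set rT)) -> measurable (box A).
Proof.
move=> mA; rewrite box_bigcap; apply: fin_bigcap_measurable => // i _.
exact: measurable_coord.
Qed.

Lemma lebesgue_box d (A : 'I_d -> set R) :
  (forall i, measurable (A i : set rT)) ->
  lebesgue_tuple R d (box A) = (\prod_(i < d) lebesgue_measure (A i : set rT))%E.
Proof. exact: lebesgue_tuple_box. Qed.

Definition ocbox d (a b : 'I_d -> R) := box (fun i => `]a i, b i]%classic).

Definition ocboxes d : set (set (d.-tuple rT)) :=
  [set B | exists a b, B = ocbox a b].

Lemma ocboxes_setI d : setI_closed (@ocboxes d).
Proof.
move=> _ _ [a [b ->]] [a' [b' ->]].
exists (fun i => Num.max (a i) (a' i)), (fun i => Num.min (b i) (b' i)).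
apply/seteqP; split => [t [/= h1 h2] i|t /= h].
  move: (h1 i) (h2 i); rewrite /= !in_itv/=.
  move=> /andP[p1 p2] /andP[p3 p4]. by rewrite gt_max le_min p1 p2 p3 p4.
split => i /=; move: (h i); rewrite /= !in_itv/= gt_max le_min;
  by move=> /andP[/andP[p1 p2] /andP[p3 p4]]; apply/andP.
Qed.

Lemma ocboxes_measurable d : @ocboxes d `<=` measurable.
Proof. by move=> _ [a [b ->]]; apply: measurable_box => i. Qed.

Definition ocbox_nat d (k : nat) : set (d.-tuple rT) :=
  ocbox (fun=> - k%:R) (fun=> k%:R).

Lemma ocbox_nat_cover d : \bigcup_k (@ocbox_nat d k) = setT.
Proof.
rewrite -subTset => t _.
exists (\max_(i < d) Num.bound (`|tnth t i|)) => // i /=.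
have h : `|tnth t i| < (\max_(i < d) Num.bound (`|tnth t i|))%:R.
  apply: (lt_le_trans (archi_boundP _)) => //.
  by rewrite ler_nat (leq_bigmax i).
by rewrite in_itv/=; move: h; rewrite ltr_norml => /andP[-> /ltW].
Qed.

(** The coordinate preimage of a half-open interval is a countable union of
    boxes, so the boxes generate the Borel sets. *)
Lemma measurable_ocboxes d : (measurable : set (set (d.-tuple rT))) `<=`
  <<s (@ocboxes d) >>.
Proof.
apply: smallest_sub; first exact: smallest_sigma_algebra.
rewrite -bigcup_seq => A [i _] [B mB <-{A}].
pose GT := g_sigma_algebraType (@ocboxes d).
suff : measurable_fun setT (fun t : GT => tnth (t : d.-tuple rT) i : rT).
  by move=> /(_ measurableT B mB).
apply: (@measurability _ _ GT rT setT _ (@ocitv R)) => //.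
move=> _ [_ [[a b] _ <-] <-] /=; rewrite setTI.
rewrite [X in measurable X](_ : _ = \bigcup_k (@ocbox_nat d k `&`
    ocbox (fun j => if j == i then a else - k%:R)
          (fun j => if j == i then b else k%:R))).
  apply: bigcupT_measurable => k; apply: sub_sigma_algebra.
  by apply: ocboxes_setI; [exists (fun=> - k%:R), (fun=> k%:R) | exists
    (fun j => if j == i then a else - k%:R), (fun j => if j == i then b else k%:R)].
apply/seteqP; split => t /=.
  move=> tab; have : [set: d.-tuple rT] t by [].
  rewrite -ocbox_nat_cover => -[k _ tk]; exists k => //; split => // j /=.
  by case: eqVneq => [->//|_]; exact: tk.
by move=> [k _ [_ /(_ i)]] /=; rewrite eqxx.
Qed.

Lemma lebesgue_ocbox_fin d (a b : 'I_d -> R) :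
  (lebesgue_tuple R d (ocbox a b) < +oo)%E.
Proof.
rewrite lebesgue_box//.
set p := (X in (X < _)%E); suff : (0 <= p /\ p < +oo)%E by case.
rewrite {}/p; apply: (big_ind (fun x : \bar R => 0 <= x /\ x < +oo)%E).
- by split => //; exact: ltry.
- move=> x y [x0 xoo] [y0 yoo]; split; first exact: mule_ge0.
  by rewrite lte_mul_pinfty// ge0_fin_numE.
- move=> i _; split; first exact: measure_ge0.
  by rewrite lebesgue_measure_itv/=; case: ifP => // _; rewrite -EFinB ltry.
Qed.

Lemma lebesgue_tuple_unique d (nu : {measure set (d.-tuple rT) -> \bar R}) :
    (forall a b, lebesgue_tuple R d (ocbox a b) = nu (ocbox a b)) ->
  forall E, measurable E -> lebesgue_tuple R d E = nu E.
Proof.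
move=> h E mE; apply: (@g_sigma_algebra_measure_unique _ R _ (@ocboxes d)
  (@ocboxes_measurable d) (@ocbox_nat d)) => //.
- by move=> k; exists (fun=> - k%:R), (fun=> k%:R).
- exact: ocbox_nat_cover.
- exact: ocboxes_setI.
- by move=> _ [a [b ->]]; exact: h.
- by move=> k; exact: lebesgue_ocbox_fin.
- exact: measurable_ocboxes.
Qed.

Definition affine_tuple d (N : nat) (a : 'I_d -> R) (t : d.-tuple rT)
    : d.-tuple rT :=
  [tuple (a i + tnth t i) / N%:R | i < d].

Lemma measurable_affine_tuple d N (a : 'I_d -> R) :
  measurable_fun setT (@affine_tuple d N a).
Proof.
apply/measurable_fun_tnthP => i.
rewrite (_ : _ \o _ = (fun x : rT => (a i + x) / N%:R) \o (fun t => tnth t i)).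
  apply: measurableT_comp; last exact: measurable_tnth.
  by apply: measurable_funM => //; exact: measurable_funD.
by apply/funext => t /=; rewrite tnth_mktuple.
Qed.

Lemma lebesgue_affine_tuple d N (a : 'I_d -> R) (E : set (d.-tuple rT)) :
  (0 < N)%N -> measurable E ->
  lebesgue_tuple R d (@affine_tuple d N a @^-1` E) =
    ((N%:R ^+ d)%:E * lebesgue_tuple R d E)%E.
Proof.
move=> N0 mE; have Np : 0 < N%:R :> R by rewrite ltr0n.
have Nd0 : 0 < N%:R ^+ d :> R by rewrite exprn_gt0.
have Nd0' : 0 <= (N%:R ^+ d)^-1 :> R by rewrite invr_ge0 ltW.
have [nu nuE] := pushforward_measureP (lebesgue_tuple R d)
  (@measurable_affine_tuple d N a).
rewrite -nuE (@lebesgue_tuple_unique d (mscale (NngNum Nd0') nu))//.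
  by rewrite /mscale/= muleA -EFinM mulfV ?mul1e// gt_eqF.
move=> b c; rewrite /= /mscale nuE /=.
rewrite [X in (_ * lebesgue_tuple R d X)%E](_ : _ = ocbox
    (fun i => N%:R * b i - a i) (fun i => N%:R * c i - a i)); last first.
  apply/seteqP; split => t /= h i; move: (h i);
    rewrite /affine_tuple/= ?tnth_mktuple !in_itv/= ltr_pdivlMr// ler_pdivrMr//
      ltrBlDl lerBrDl ![_ * N%:R]mulrC //.
rewrite !lebesgue_box//.
under [X in _ = (_ * X)%E]eq_bigr => i _.
  rewrite (_ : lebesgue_measure _ = (N%:R%:E * lebesgue_measure `]b i, c i])%E).
    over.
  rewrite !lebesgue_measure_itv/= !lte_fin ltrBlDr subrK ltr_pM2l//.
  case: ifP => _; last by rewrite mule0.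
  by rewrite -!EFinB -EFinM; congr EFin; ring.
rewrite big_split/= prodEFin big_const_ord iter_mulr_1/=.
by rewrite muleA -EFinM mulVf ?mul1e// gt_eqF.
Qed.

End TupleMeasure.

(** * Fubini over a set of coordinates *)

Section Fubini.
Variable R : realType.
Local Notation rT := (measurableTypeR R).

Definition ucube d : set (d.-tuple rT) := box (fun=> `[(0 : R), 1[%classic).
Arguments ucube d : clear implicits.

Lemma measurable_ucube d : measurable (ucube d).
Proof. by apply: measurable_box => i. Qed.

Lemma lebesgue_ucube d : lebesgue_tuple R d (ucube d) = 1%E.
Proof.
rewrite lebesgue_box//; under eq_bigr do rewrite lebesgue_measure_itv/= lte_fin.
by rewrite ltr01 -EFinB subr0 prodEFin prodr_const expr1n.
Qed.

Lemma ucube_fin d (E : set (d.-tuple rT)) : measurable E -> E `<=` ucube d ->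
  (lebesgue_tuple R d E < +oo)%E.
Proof.
move=> mE Eu; apply: (@le_lt_trans _ _ 1%E); last exact: ltry.
by rewrite -(lebesgue_ucube d) le_measure ?inE//; exact: measurable_ucube.
Qed.

Variables (d d1 d2 : nat) (h : 'I_d1 + 'I_d2 -> 'I_d) (h' : 'I_d -> 'I_d1 + 'I_d2).
Hypotheses (hK : cancel h h') (h'K : cancel h' h).

(** The left summand of the splitting [h] numbers the coordinates along the fibre,
    the right summand those of the base. *)
Definition unsplit_tuple (p : d2.-tuple rT * d1.-tuple rT) : d.-tuple rT :=
  [tuple match h' i with inl a => tnth p.2 a | inr b => tnth p.1 b end | i < d].

Lemma tnth_unsplit_tuple_fibre p a : tnth (unsplit_tuple p) (h (inl a)) = tnth p.2 a.
Proof. by rewrite tnth_mktuple hK. Qed.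

Lemma tnth_unsplit_tuple_base p b : tnth (unsplit_tuple p) (h (inr b)) = tnth p.1 b.
Proof. by rewrite tnth_mktuple hK. Qed.

Lemma measurable_unsplit_tuple : measurable_fun setT unsplit_tuple.
Proof.
apply/measurable_fun_tnthP => i; case E : (h' i) => [a|b].
  rewrite (_ : _ \o _ = (fun t => tnth t a) \o snd).
    by apply: measurableT_comp => //; exact: measurable_tnth.
  by apply/funext => p /=; rewrite tnth_mktuple E.
rewrite (_ : _ \o _ = (fun t => tnth t b) \o fst).
  by apply: measurableT_comp => //; exact: measurable_tnth.
by apply/funext => p /=; rewrite tnth_mktuple E.
Qed.

Lemma unsplit_tuple_box (A : 'I_d -> set R) :
  unsplit_tuple @^-1` (box A) = box (A \o h \o inr) `*` box (A \o h \o inl).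
Proof.
apply/seteqP; split => [[y x] At|[y x] [/= Ay Ax] i].
  split => i /=; first by have := At (h (inr i)); rewrite tnth_unsplit_tuple_base.
  by have := At (h (inl i)); rewrite tnth_unsplit_tuple_fibre.
rewrite -(h'K i); case: (h' i) => [a|b]; rewrite ?tnth_unsplit_tuple_base ?tnth_unsplit_tuple_fibre.
  exact: (Ax a).
exact: (Ay b).
Qed.

Lemma lebesgue_unsplit_tuple E : measurable E -> lebesgue_tuple R d E =
  (lebesgue_tuple R d2 \x lebesgue_tuple R d1)%E (unsplit_tuple @^-1` E).
Proof.
have [nu nuE] := pushforward_measureP
  (lebesgue_tuple R d2 \x lebesgue_tuple R d1)%E measurable_unsplit_tuple.
move=> mE; rewrite -[RHS]nuE; apply: lebesgue_tuple_unique => // a b.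
rewrite nuE /ocbox unsplit_tuple_box [RHS]product_measure1E; last 2 first.
- by apply: measurable_box => i /=.
- by apply: measurable_box => i /=.
rewrite !lebesgue_box//=.
rewrite (reindex h) ?big_sumType /=; last by exists h'.
by rewrite muleC lebesgue_box// => i /=.
Qed.

Definition fibre (E : set (d.-tuple rT)) (y : d2.-tuple rT) : set (d1.-tuple rT) :=
  [set x | E (unsplit_tuple (y, x))].

Lemma xsection_fibre E y : xsection (unsplit_tuple @^-1` E) y = fibre E y.
Proof. by apply/seteqP; split => x; rewrite /xsection/= ?inE. Qed.

Lemma measurable_fibre E y : measurable E -> measurable (fibre E y).
Proof.
move=> mE; rewrite -xsection_fibre; apply: measurable_xsection.
by rewrite -[X in measurable X]setTI; exact: measurable_unsplit_tuple.
Qed.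

Lemma measurable_fun_fibre E : measurable E ->
  measurable_fun setT (fun y => lebesgue_tuple R d1 (fibre E y)).
Proof.
move=> mE; under eq_fun do rewrite -xsection_fibre.
apply: measurable_fun_xsection.
by rewrite -[X in measurable X]setTI; exact: measurable_unsplit_tuple.
Qed.

Lemma lebesgue_fibre E : measurable E -> lebesgue_tuple R d E =
  (\int[lebesgue_tuple R d2]_y lebesgue_tuple R d1 (fibre E y))%E.
Proof.
by move=> mE; rewrite lebesgue_unsplit_tuple//; apply: eq_integral => y _ /=;
  rewrite xsection_fibre.
Qed.

Lemma lebesgue_fibre_compare (c : R) E F : 0 <= c -> measurable E -> measurable F ->
  (forall y, c%:E * lebesgue_tuple R d1 (fibre E y) <=
     lebesgue_tuple R d1 (fibre F y))%E ->
  (c%:E * lebesgue_tuple R d E <= lebesgue_tuple R d F)%E.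
Proof.
move=> c0 mE mF EF; rewrite !lebesgue_fibre//.
rewrite -ge0_integralZl//; last exact: (measurable_fun_fibre mE).
apply: ge0_le_integral => //.
- by move=> y _; rewrite mule_ge0.
- by apply: measurable_funeM; exact: (measurable_fun_fibre mE).
- exact: (measurable_fun_fibre (E := _)).
Qed.

Lemma lebesgue_fibre_le (c : R) E : 0 <= c -> measurable E -> E `<=` ucube d ->
  (forall y, lebesgue_tuple R d1 (fibre E y) <= c%:E)%E ->
  (lebesgue_tuple R d E <= c%:E)%E.
Proof.
move=> c0 mE Eu Ec; rewrite lebesgue_fibre//.
rewrite -[leRHS]mule1 -(lebesgue_ucube d2) -integral_cst//; last exact: measurable_ucube.
rewrite [leRHS]integral_mkcond; apply: ge0_le_integral => //.
- exact: (measurable_fun_fibre (E := _)).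
- apply/(measurable_restrictT _ (@measurable_ucube d2)).
  exact: measurable_cst.
move=> y _; rewrite patchE; case: ifPn => [//|/negP].
rewrite inE => yu; rewrite [X in lebesgue_tuple R d1 X](_ : _ = set0) ?measure0//.
rewrite -subset0 => x /Eu xu; apply: yu => b /=.
by have := xu (h (inr b)); rewrite tnth_unsplit_tuple_base.
Qed.

End Fubini.
Arguments ucube {R} d.

(** * Approximation by cubes of a grid *)

Section GridDensity.
Variable R : realType.
Local Notation rT := (measurableTypeR R).

Definition grid_index d (N : nat) (t : d.-tuple rT) : 'I_d -> int :=
  fun i => Num.floor (N%:R * tnth t i).

Definition grid_cube d (N : nat) (a : 'I_d -> int) : set (d.-tuple rT) :=
  [set t | grid_index N t = a].

Lemma grid_cubeE d N (a : 'I_d -> int) : (0 < N)%N ->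
  grid_cube N a =
    box (fun i => `[(a i)%:~R / N%:R, (a i + 1)%:~R / N%:R[%classic).
Proof.
move=> N0; have Np : 0 < N%:R :> R by rewrite ltr0n.
have E i (x : R) : (Num.floor (N%:R * x) = a i) <->
    `[(a i)%:~R / N%:R, (a i + 1)%:~R / N%:R[%classic x.
  rewrite /= in_itv/= ler_pdivrMr// ltr_pdivlMr// ![x * _]mulrC.
  by rewrite -floor_eq; split=> [->|/eqP].
apply/seteqP; split => t.
  by move=> ta i; apply: (E i _).1; rewrite -[in RHS](ta : _ = a).
by move=> ta; apply/funext => i; apply: (E i _).2; exact: ta.
Qed.

Lemma measurable_grid_cube d N (a : 'I_d -> int) : (0 < N)%N ->
  measurable (grid_cube N a).
Proof. by move=> N0; rewrite grid_cubeE//; apply: measurable_box => i. Qed.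

Lemma grid_index_mul d N N' (t : d.-tuple rT) : (0 < N')%N ->
  grid_index N t = (fun i => (grid_index (N * N') t i %/ N'%:Z)%Z).
Proof.
move=> N0; have Np : 0 < N'%:R :> R by rewrite ltr0n.
apply/funext => i; rewrite /grid_index; apply: floor_def.
have [] := andP (floor_itv ((N * N')%:R * tnth t i : R)).
set f := Num.floor _ => h1 h2.
have fE := divz_eq f N'%:Z; have := modz_ge0 f (d := N'%:Z) _.
have := ltz_mod f (d := N'%:Z) _; rewrite /=.
move=> /(_ ltac:(lia)) m1 /(_ ltac:(lia)) m0.
set q := (f %/ _)%Z in fE *; set r := (f %% _)%Z in fE m0 m1.
have e : (N * N')%:R * tnth t i = (N%:R * tnth t i) * N'%:R :> R.
  by rewrite natrM; ring.
rewrite e in h1 h2.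
apply/andP; split.
  rewrite -(ler_pM2r Np) (le_trans _ h1)// fE -[N'%:R]/(N'%:Z%:~R) -intrM ler_int.
  lia.
rewrite -(ltr_pM2r Np) (lt_le_trans h2)// fE -[N'%:R]/(N'%:Z%:~R) -intrM ler_int.
nia.
Qed.

(** With an exceptional set in place of a symmetric difference, stability under
    complements and unions is propositional. *)
Definition grid_approximable d (V : set (d.-tuple rT)) := forall e : R, 0 < e ->
  exists E N (P : set ('I_d -> int)), [/\ measurable E, (0 < N)%N,
    (lebesgue_tuple R d E <= e%:E)%E &
    forall t, ucube d t -> ~ E t -> (V t <-> P (grid_index N t))].

Lemma grid_approximableC d (V : set (d.-tuple rT)) :
  grid_approximable V -> grid_approximable (~` V).
Proof.
move=> aV e /aV[E [N [P [mE N0 Ee VP]]]]; exists E, N, (~` P); split => // t tu tE.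
by have := VP t tu tE; rewrite /=; tauto.
Qed.

Lemma grid_approximableU d (V W : set (d.-tuple rT)) :
  grid_approximable V -> grid_approximable W -> grid_approximable (V `|` W).
Proof.
move=> aV aW e e0; have e20 : 0 < e / 2 by rewrite divr_gt0.
have [E [N [P [mE N0 Ee VP]]]] := aV _ e20.
have [E' [N' [P' [mE' N'0 Ee' WP]]]] := aW _ e20.
exists (E `|` E'), (N * N')%N, [set c | P (fun i => (c i %/ N'%:Z)%Z) \/
  P' (fun i => (c i %/ N%:Z)%Z)]; split.
- exact: measurableU.
- by rewrite muln_gt0 N0.
- rewrite (le_trans (measureU2 _ mE mE'))// (le_trans (leeD Ee Ee'))//.
  by rewrite -EFinD lee_fin -splitr.
move=> t tu /not_orP[tE tE'] /=; rewrite -grid_index_mul// mulnC -grid_index_mul//.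
by have := VP t tu tE; have := WP t tu tE'; tauto.
Qed.

Lemma grid_approximable_bigcup d (V : nat -> set (d.-tuple rT)) :
  (forall k, measurable (V k)) ->
  (forall k, grid_approximable (V k)) -> grid_approximable (\bigcup_k V k).
Proof.
move=> mV aV e e0; have e20 : 0 < e / 2 by rewrite divr_gt0.
pose U n := \big[setU/set0]_(k < n) V k.
have aU n : grid_approximable (U n).
  rewrite /U; elim: n => [|n ih]; last by rewrite big_ord_recr; exact: grid_approximableU.
  rewrite big_ord0 => e' e'0; exists set0, 1%N, set0; split => //.
  by rewrite measure0 lee_fin ltW.
have mU n : measurable (U n) by exact: bigsetU_measurable.
pose F n := ucube d `&` ((\bigcup_k V k) `\` U n).
have mF n : measurable (F n).
  apply: measurableI; first exact: measurable_ucube.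
  by apply: measurableD => //; exact: bigcupT_measurable.
have F0 : \bigcap_n F n = set0.
  rewrite -subset0 => t tF; have [_ [[k _ Vk] _]] := tF 0%N I.
  have [_ [_ []]] := tF k.+1 I.
  by rewrite /U big_ord_recr; right.
have : (lebesgue_tuple R d \o F) n @[n --> \oo] --> lebesgue_tuple R d (\bigcap_n F n).
  apply: nonincreasing_cvg_mu => //.
  - by apply: ucube_fin => // t [].
  - by rewrite F0.
  - move=> n n' nn'; apply/subsetPset => t [tu [tV tU]]; split => //; split => //.
    by apply: contra_not tU; rewrite /U; exact: subset_bigsetU.
rewrite F0 measure0 => /fine_cvgP[_ /cvgrPdist_le /(_ _ e20)[n _ /(_ n (leqnn n))]].
rewrite /= sub0r normrN => Fn.
have {}Fn : (lebesgue_tuple R d (F n) <= (e / 2)%:E)%E.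
  rewrite -[leLHS]fineK; first by rewrite lee_fin (le_trans (ler_norm _)).
  by rewrite ge0_fin_numE//; apply: ucube_fin => // t [].
have [E [N [P [mE N0 Ee VP]]]] := aU n _ e20.
exists (E `|` F n), N, P; split => //; first exact: measurableU.
  rewrite (le_trans (measureU2 _ mE (mF n)))// (le_trans (leeD Ee Fn))//.
  by rewrite -EFinD lee_fin -splitr.
move=> t tu /not_orP[tE tF]; rewrite -VP//; split => [tV|].
  by apply: contrapT => tU; apply: tF.
by rewrite /U -bigcup_mkord => -[k _ Vk]; exists k.
Qed.

Lemma grid_approximable_halfspace d (i : 'I_d) (a : R) :
  grid_approximable [set t : d.-tuple rT | a < tnth t i].
Proof.
move=> e e0; pose N := (Num.bound e^-1).+1.
have N0 : 0 < N%:R :> R by rewrite ltr0n.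
have Ne : N%:R^-1 <= e.
  rewrite -[leRHS]invrK lef_pV2 ?posrE ?invr_gt0//.
  have /archi_boundP/ltW/le_trans : 0 <= e^-1 by rewrite invr_ge0 ltW.
  by apply; rewrite ler_nat.
exists (box (fun j => if j == i then `]a, a + N%:R^-1] else `[0, 1[)%classic), N,
  [set c | a * N%:R < (c i)%:~R]; split => //.
- by apply: measurable_box => j; case: ifP.
- rewrite lebesgue_box; last by move=> j; case: ifP.
  rewrite (bigD1 i)//= eqxx big1 => [|j ji]; last first.
    by rewrite (negbTE ji) lebesgue_measure_itv/= lte_fin ltr01 -EFinB subr0.
  rewrite mule1 lebesgue_measure_itv/= lte_fin ltrDl invr_gt0 N0.
  by rewrite -EFinB addrAC subrr add0r lee_fin.
move=> t tu tE /=; rewrite /grid_index; split => [ati|]; last first.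
  move=> /lt_le_trans/(_ (floor_le _)).
  by rewrite mulrC ltr_pM2l.
apply: contrapT => /negP; rewrite -leNgt => h; apply: tE => j /=.
case: eqVneq => [->|_]; last exact: tu.
rewrite /= in_itv/= ati/= -(ler_pM2l N0) mulrDr mulfV ?gt_eqF//.
have /andP[_ /ltW/le_trans] := floor_itv (N%:R * tnth t i); apply.
by rewrite intrD lerD2r [leRHS]mulrC.
Qed.

Lemma measurable_grid_approximable d (V : set (d.-tuple rT)) :
  measurable V -> grid_approximable V.
Proof.
pose M := [set V : set (d.-tuple rT) | measurable V /\ grid_approximable V].
have Msig : sigma_algebra setT M.
  split.
  - split=> // e e0; exists set0, 1%N, set0; split => //.
    by rewrite measure0 lee_fin ltW.
  - move=> A [mA aA]; rewrite setTD; split; first exact: measurableC.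
    exact: grid_approximableC.
  - move=> F MF; split; first by apply: bigcupT_measurable => k; have [] := MF k.
    by apply: grid_approximable_bigcup => k; have [] := MF k.
suff : (measurable : set (set (d.-tuple rT))) `<=` M by move=> /[apply] -[].
apply: smallest_sub => //; rewrite -bigcup_seq => A [i _] [B mB <-{A}].
rewrite setTI; move: B mB.
have : sigma_algebra setT [set B : set R | M ((fun t : d.-tuple rT => tnth t i) @^-1` B)].
  split => /=.
  - by rewrite preimage_set0; case: Msig.
  - by move=> A; rewrite setTD preimage_setC; case: Msig => _ h _ /h; rewrite setTD.
  - by move=> F MF; rewrite preimage_bigcup; case: Msig => _ _; apply.
move=> /smallest_sub Bsig; rewrite RGenOInfty.measurableE; apply: Bsig.
move=> _ [a ->]; split; last first.
  rewrite (_ : _ @^-1` _ = [set t : d.-tuple rT | a < tnth t i]).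
    exact: grid_approximable_halfspace.
  by apply/seteqP; split => t /=; rewrite in_itv/= andbT.
rewrite -[X in measurable X]setTI; apply: measurable_tnth => //.
Qed.

(** Up to small measure, the complement of [W] is a union of cubes of one grid.
    As [W] fills these cubes to proportion [c] and yet nearly misses them, their
    total measure is small. *)
Lemma grid_density d (W : set (d.-tuple rT)) (c : R) : 0 < c -> measurable W ->
  (forall N (a : 'I_d -> nat), (0 < N)%N ->
    (c%:E * lebesgue_tuple R d (grid_cube N (fun i => (a i)%:Z)) <=
     lebesgue_tuple R d (W `&` grid_cube N (fun i => (a i)%:Z)))%E) ->
  lebesgue_tuple R d (ucube d `\` W) = 0%E.
Proof.
move=> c0 mW cW; have mV : measurable (ucube d `\` W).
  by apply: measurableD => //; exact: measurable_ucube.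
have Vfin : lebesgue_tuple R d (ucube d `\` W) \is a fin_num.
  by rewrite ge0_fin_numE//; apply: ucube_fin => // t [].
apply/eqP; rewrite eq_le measure_ge0 andbT.
suff : forall e : R, 0 < e -> (lebesgue_tuple R d (ucube d `\` W) <= e%:E)%E.
  by move=> h; apply/lee_addgt0Pr => e e0; rewrite add0e; exact: h.
move=> e e0; pose e' := e / (1 + c^-1).
have k0 : 0 < 1 + c^-1 by rewrite addr_gt0// invr_gt0.
have e'0 : 0 < e' by rewrite divr_gt0.
have [E [N [P [mE N0 Ee VP]]]] := measurable_grid_approximable (measurableC mW) e'0.
pose D := [set a : {ffun 'I_d -> 'I_N} | P (fun i => (a i : nat)%:Z)].
pose C (a : {ffun 'I_d -> 'I_N}) := grid_cube N (fun i => (a i : nat)%:Z).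
have mC a : measurable (C a) by exact: measurable_grid_cube.
have finD : finite_set D by exact: finite_finset.
pose G := \bigcup_(a in D) C a.
have mG : measurable G by exact: fin_bigcup_measurable.
have tC : trivIset D C.
  apply/trivIsetP => a b _ _ /eqP ab; rewrite -subset0 => t [/= ta tb].
  apply: ab; apply/ffunP => i; apply/val_inj.
  by move: (congr1 (fun f => f i) ta); rewrite /= (congr1 (fun f => f i) tb) => -[].
have Cu a : C a `<=` ucube d.
  rewrite /C grid_cubeE// => t ta i; move: (ta i); rewrite /= !in_itv/=.
  have Np : 0 < N%:R :> R by rewrite ltr0n.
  move=> /andP[h1 h2]; rewrite (le_trans _ h1) ?divr_ge0//=.
  rewrite (lt_le_trans h2)// ler_pdivrMr// mul1r -[N%:R]/(N%:Z%:~R) ler_int.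
  by have := ltn_ord (a i); clear; lia.
have cG : (c%:E * lebesgue_tuple R d G <= lebesgue_tuple R d (W `&` G))%E.
  rewrite /G setI_bigcupr !measure_fin_bigcup//.
  - rewrite ge0_mule_fsumr//; apply: lee_fsum => // a _; exact: cW.
  - by apply: trivIset_setIl.
  - by move=> a _; exact: measurableI.
have WG : (lebesgue_tuple R d (W `&` G) <= e'%:E)%E.
  apply: le_trans Ee; apply: le_measure; rewrite ?inE//; first exact: measurableI.
  move=> t [tW [a Pa ta]]; apply: contrapT => tE.
  have [_ h] := VP t (Cu _ _ ta) tE; apply: h => //.
  by rewrite (ta : grid_index _ _ = _).
have Gle : (lebesgue_tuple R d G <= (c^-1 * e')%:E)%E.
  rewrite -[leLHS]mul1e -(mulVf (lt0r_neq0 c0)) EFinM -muleA EFinM.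
  by rewrite lee_pmul2l ?lte_fin ?invr_gt0//; exact: le_trans WG.
have VG : ucube d `\` W `<=` E `|` G.
  move=> t [tu tW]; apply: contrapT => /not_orP[tE]; apply.
  have [/(_ tW) Pt _] := VP t tu tE.
  have lt i : (`|grid_index N t i| < N)%N.
    have := tu i; rewrite /= in_itv/= => /andP[t0 t1].
    have : 0 <= grid_index N t i by rewrite floor_ge0 mulr_ge0.
    have : grid_index N t i < N%:Z.
      by rewrite floor_lt_int -[ltRHS]mulr1 ltr_pM2l// ltr0n.
    by move=> g1 g0; clear -g1 g0; lia.
  have e1 : (fun i => (([ffun i => Ordinal (lt i)] : {ffun 'I_d -> 'I_N}) i : nat)%:Z)
      = grid_index N t.
    apply/funext => i; rewrite ffunE/= gez0_abs// floor_ge0 mulr_ge0//.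
    by have := tu i; rewrite /= in_itv/= => /andP[].
  exists [ffun i => Ordinal (lt i)]; first by rewrite /D /= e1.
  by rewrite /C /= /grid_cube /= e1.
apply: (@le_trans _ _ (lebesgue_tuple R d (E `|` G))).
  by apply: le_measure; rewrite ?inE//; exact: measurableU.
rewrite (le_trans (measureU2 _ mE mG))// (le_trans (leeD Ee Gle))//.
rewrite -EFinD lee_fin -{1}[e']mul1r -mulrDl /e' mulrC divfK//.
by rewrite gt_eqF.
Qed.

End GridDensity.

(** * Second moments *)

Section SecondMoment.
Context d (T : measurableType d) (R : realType).
Variable mu : {measure set T -> \bar R}.
Implicit Types (E : nat -> set T) (r : seq nat).

(** From [2 l X <= 1 + (l X)^2] on the support of the counting function
    [X] of the events, and [X = 0] off their union. *)
Lemma union_second_moment E r (S Q l : R) : 0 <= l ->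
  (forall t, measurable (E t)) ->
  (S%:E <= \sum_(t <- r) mu (E t))%E ->
  (\sum_(s <- r) \sum_(t <- r) mu (E s `&` E t) <= Q%:E)%E ->
  (mu (\bigcup_t E t) < +oo)%E ->
  ((2 * l * S - l ^+ 2 * Q)%:E <= mu (\bigcup_(t in [set t | t \in r]) E t))%E.
Proof.
move=> l0 mE hS hQ fin.
set U := \bigcup_(t in _) E t.
have mU : measurable U by exact: bigcup_measurable.
have h : (\int[mu]_x \sum_(t <- r) ((2 * l) * \1_(E t) x)%:E <=
    \int[mu]_x ((\1_U x)%:E + \sum_(s <- r) \sum_(t <- r)
      ((l ^+ 2) * \1_(E s `&` E t) x)%:E))%E.
  apply: ge0_le_integral => //.
  - by move=> x _; apply: sume_ge0 => t _; rewrite lee_fin mulr_ge0// mulr_ge0.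
  - apply: emeasurable_sum => t; apply/measurable_EFinP.
    by apply: measurable_funM => //; exact: measurable_indic.
  - apply: emeasurable_funD; first by apply/measurable_EFinP; exact: measurable_indic.
    apply: emeasurable_sum => s; apply: emeasurable_sum => t; apply/measurable_EFinP.
    by apply: measurable_funM => //; apply: measurable_indic; exact: measurableI.
  move=> x _; rewrite sumEFin; under [in leRHS]eq_bigr do rewrite sumEFin.
  rewrite sumEFin -EFinD lee_fin.
  set X : R := \sum_(t <- r) \1_(E t) x.
  have -> : \sum_(t <- r) 2 * l * \1_(E t) x = 2 * l * X :> R by rewrite -mulr_sumr.
  have -> : \sum_(s <- r) \sum_(t <- r) l ^+ 2 * \1_(E s `&` E t) x =
      (l * X) ^+ 2 :> R.
    rewrite exprMn [X ^+ 2]expr2 {1}/X mulr_suml mulr_sumr; apply: eq_bigr => s _.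
    rewrite /X !mulr_sumr; apply: eq_bigr => t _.
    by rewrite indicI.
  have [xU|xU] := pselect (U x).
    rewrite indicE mem_set//= mulr1n -subr_ge0.
    by rewrite (_ : _ - _ = (l * X - 1) ^+ 2) ?sqr_ge0//; ring.
  have -> : X = 0.
    rewrite /X big_seq big1// => t tr; rewrite indicE memNset// => xt.
    by apply: xU; exists t.
  by rewrite !mulr0 expr0n/= addr0.
move: h; rewrite ge0_integral_sum//; first last.
- by move=> t x _; rewrite lee_fin mulr_ge0// mulr_ge0.
- move=> t; apply/measurable_EFinP.
  by apply: measurable_funM => //; exact: measurable_indic.
rewrite ge0_integralD//; first last.
- apply: emeasurable_sum => s; apply: emeasurable_sum => t; apply/measurable_EFinP.
  by apply: measurable_funM => //; apply: measurable_indic; exact: measurableI.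
- by move=> x _; apply: sume_ge0 => t _; apply: sume_ge0 => s _;
    rewrite lee_fin mulr_ge0// exprn_ge0.
- by apply/measurable_EFinP; exact: measurable_indic.
rewrite integral_indic// setIT ge0_integral_sum//; first last.
- by move=> t x _; apply: sume_ge0 => s _; rewrite lee_fin mulr_ge0// exprn_ge0.
- move=> s; apply: emeasurable_sum => t; apply/measurable_EFinP.
  by apply: measurable_funM => //; apply: measurable_indic; exact: measurableI.
have int1 k A : 0 <= k -> measurable A ->
    (\int[mu]_x (k * \1_A x)%:E = k%:E * mu A)%E.
  move=> k0 mA; under eq_integral do rewrite EFinM.
  rewrite ge0_integralZl ?lee_fin//; last by apply/measurable_EFinP; exact: measurable_indic.
  by rewrite integral_indic// setIT.
have l20 : 0 <= 2 * l by rewrite mulr_ge0.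
have ll0 : 0 <= l ^+ 2 by rewrite exprn_ge0.
under eq_bigr do rewrite int1//.
under [in leRHS]eq_bigr => s _.
  rewrite ge0_integral_sum//; first last.
  - by move=> t x _; rewrite lee_fin mulr_ge0.
  - move=> t; apply/measurable_EFinP.
    by apply: measurable_funM => //; apply: measurable_indic; exact: measurableI.
  under eq_bigr => t _ do (rewrite int1//; last exact: measurableI).
  rewrite -ge0_sume_distrr//.
  over.
rewrite -ge0_sume_distrr// -ge0_sume_distrr; last first.
  by move=> s _; exact: sume_ge0.
move=> h.
have Ufin : mu U \is a fin_num.
  rewrite ge0_fin_numE//; apply: le_lt_trans fin; apply: le_measure; rewrite ?inE//.
    exact: bigcupT_measurable.
  by apply: bigcup_sub => t _; exact: bigcup_sup.
rewrite EFinB leeBlDr// EFinM.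
apply: (le_trans (lee_wpmul2l _ hS)); first by rewrite lee_fin.
apply: (le_trans h); rewrite leeD2l// (EFinM (l ^+ 2) Q).
by rewrite lee_wpmul2l// lee_fin.
Qed.

Lemma lim_sup_set_ge E (c : R) : (forall t, measurable (E t)) ->
  (mu (\bigcup_t E t) < +oo)%E ->
  (forall a, (c%:E <= mu (\bigcup_(t in [set t | (a <= t)%N]) E t))%E) ->
  (c%:E <= mu (lim_sup_set E))%E.
Proof.
move=> mE fin h.
have cv := lim_sup_set_cvg mu E mE.
have {}cv := cv _; rewrite -(cvg_lim _ (cv _))//; last first.
  by rewrite [X in mu X](_ : _ = \bigcup_t E t)//; apply/seteqP; split => x [t _ ?]; exists t.
apply: lime_ge; first by apply/cvg_ex; eexists; apply: cv;
  rewrite [X in mu X](_ : _ = \bigcup_t E t)//; apply/seteqP; split => x [t _ ?]; exists t.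
by apply: nearW => a; exact: h.
Qed.

Lemma geometric_window (th : R) a t : 0 <= th < 1 ->
  \sum_(a <= s < t.+1) th ^+ (t - s) <= (1 - th)^-1.
Proof.
move=> /andP[th0 th1]; have [at_|ta] := leqP a t.+1; last first.
  by rewrite big_geq ?invr_ge0 ?subr_ge0 ?ltW// ltnW.
rewrite big_nat_rev/=.
rewrite -{1}[a]add0n -[t.+1](subnK at_) big_addn addnK.
under eq_big_nat => s /andP[_ st].
  rewrite (_ : (t - _)%N = s); last by lia.
  over.
rewrite big_mkord -[leRHS]mul1r ler_pdivlMr ?subr_gt0//.
have := subrX1 th (t.+1 - a); have := exprn_ge0 (t.+1 - a) th0; lra.
Qed.

(** The expected number of events with index in [[a, b)] is at least [c * W],
    where [W] is the sum of the weights, and its second moment is at most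
    [2 * C * (W / (1 - th) + W ^ 2)], which is at most [4 * C * W ^ 2] once [W]
    is large: the bound does not depend on [th]. *)
Lemma quasi_independent_limsup E (w : nat -> R) (t0 : nat) (c C th : R) :
  0 < c -> 0 < C -> 0 <= th < 1 ->
  (forall t, measurable (E t)) -> (mu (\bigcup_t E t) < +oo)%E ->
  (forall t, 0 <= w t) ->
  (forall t, (t0 <= t)%N -> ((c * w t)%:E <= mu (E t))%E) ->
  (forall s t, (t0 <= s)%N -> (s <= t)%N ->
    (mu (E s `&` E t) <= (C * w t * (th ^+ (t - s) + w s))%:E)%E) ->
  (forall B, exists T, B <= \sum_(0 <= t < T) w t) ->
  ((c ^+ 2 / (4 * C))%:E <= mu (lim_sup_set E))%E.
Proof.
move=> c0 C0 th01 mE fin w0 lb ub div.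
apply: lim_sup_set_ge => // a0.
pose a := maxn a0 t0.
have [b hb] := div ((1 - th)^-1 + \sum_(0 <= t < a) w t).
have th1 : 0 < 1 - th by rewrite subr_gt0; case/andP: th01.
set W := \sum_(a <= t < b) w t.
have hW : (1 - th)^-1 <= W.
  have [ab|ba] := leqP a b.
    by move: hb; rewrite (big_cat_nat (n := a) (p := b) (m := 0))//= -/W; lra.
  exfalso; move: hb; rewrite (big_cat_nat (n := b) (p := a) (m := 0))// ?(ltnW ba)//=.
  have : 0 <= \sum_(b <= t < a) w t by exact: sumr_ge0.
  have : 0 < (1 - th)^-1 by rewrite invr_gt0.
  lra.
have W0 : 0 < W by apply: lt_le_trans hW; rewrite invr_gt0.
pose r := index_iota a b.
have rP t : t \in r -> (t0 <= t)%N.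
  by rewrite mem_index_iota => /andP[+ _]; apply: leq_trans; rewrite leq_maxr.
have sub : \bigcup_(t in [set t | t \in r]) E t `<=`
    \bigcup_(t in [set t | (a0 <= t)%N]) E t.
  move=> x [t /= tr xt]; exists t => //=; move: tr; rewrite mem_index_iota.
  by move=> /andP[+ _]; apply: leq_trans; rewrite leq_maxl.
apply: (@le_trans _ _ (mu (\bigcup_(t in [set t | t \in r]) E t))); last first.
  by apply: le_measure; rewrite ?inE//; exact: bigcup_measurable.
pose S := c * W; pose Q := 4 * C * W ^+ 2.
apply: le_trans (@union_second_moment E r S Q (c / (4 * C * W)) _ mE _ _ fin).
- rewrite lee_fin /S /Q le_eqVlt; apply/orP; left; apply/eqP; field.
  by rewrite !gt_eqF.
- by rewrite divr_ge0 ?ltW// !mulr_gt0.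
- rewrite /S /W mulr_sumr -sumEFin [leLHS]big_seq [leRHS]big_seq.
  by apply: lee_sum => t /rP; exact: lb.
(* symmetrise the pairs and bound the diagonal band by the geometric sum *)
pose f s t := C * w t * (th ^+ (t - s) + w s).
have th0 : 0 <= th by case/andP: th01.
have f0 s t : 0 <= f s t by rewrite !mulr_ge0 ?addr_ge0 ?exprn_ge0// ltW.
have pair s t : s \in r -> t \in r -> (mu (E s `&` E t) <=
    ((if (s <= t)%N then f s t else 0) + (if (t <= s)%N then f t s else 0))%:E)%E.
  move=> /rP sr /rP tr; case: (ltngtP s t) => st.
  - by rewrite addr0 ub// ltnW.
  - by rewrite add0r setIC ub// ltnW.
  - by rewrite (le_trans (ub _ _ sr (eq_leq st)))// lee_fin lerDl.
apply: (@le_trans _ _ (\sum_(s <- r) \sum_(t <- r)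
   ((if (s <= t)%N then f s t else 0) + (if (t <= s)%N then f t s else 0))%:E)%E).
  rewrite [leLHS]big_seq [leRHS]big_seq; apply: lee_sum => s sr.
  rewrite [leLHS]big_seq [leRHS]big_seq; apply: lee_sum => t tr.
  exact: pair.
under eq_bigr do rewrite sumEFin; rewrite sumEFin lee_fin.
under eq_bigr do rewrite big_split; rewrite big_split/=.
rewrite [X in _ + X]exchange_big/= -mulr2n.
have -> : Q = (2 * C * W ^+ 2) *+ 2 by rewrite /Q -mulr_natl; ring.
rewrite lerMn2r/=; rewrite exchange_big/=.
apply: (@le_trans _ _ (\sum_(t <- r) C * w t * ((1 - th)^-1 + W))).
  rewrite !big_seq; apply: ler_sum => t tr.
  rewrite -big_mkcond/= /f -mulr_sumr ler_wpM2l//; first by rewrite mulr_ge0// ltW.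
  rewrite big_split/= lerD//.
    apply: (le_trans _ (@geometric_window th a t th01)).
    move: tr; rewrite mem_index_iota => /andP[_ tb].
    rewrite [leRHS](big_nat_widen _ _ b)// le_eqVlt; apply/orP; left; apply/eqP.
  rewrite big_mkcond/=; apply: ler_sum => s _; case: ifP => //.
rewrite -mulr_suml -mulr_sumr -/W.
have -> : 2 * C * W ^+ 2 = C * W * (W + W) by ring.
by apply: ler_wpM2l; rewrite ?lerD2r// mulr_ge0 ?ltW.
Qed.

End SecondMoment.

(** * One point in each occupied cell *)

Section FiniteUnions.
Context d (T : measurableType d) (R : realType).
Variable mu : {measure set T -> \bar R}.

Lemma finite_union_le (I : finType) (S : {set I}) (F : I -> set T) (A : set T)
    (b : R) : (forall i, measurable (F i)) -> measurable A ->
  A `<=` \bigcup_(i in [set i | i \in S]) F i ->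
  (forall i, i \in S -> (mu (F i) <= b%:E)%E) ->
  (mu A <= (#|S|%:R * b)%:E)%E.
Proof.
move=> mF mA AF Fb.
have -> : #|S|%:R * b = \sum_(i in S) b by rewrite sumr_const mulr_natl.
rewrite -big_enum/=; have {}AF : A `<=` \bigcup_(i in [set` enum S]) F i.
  by move=> x /AF[i iS xi]; exists i => //=; rewrite mem_enum.
have {}Fb i : i \in enum S -> (mu (F i) <= b%:E)%E by rewrite mem_enum; exact: Fb.
apply: (@le_trans _ _ (mu (\bigcup_(i in [set` enum S]) F i))).
  by apply: le_measure; rewrite ?inE//; exact: fin_bigcup_measurable.
elim: (enum S) Fb {AF} => [_|i s ih Fb].
  by rewrite bigcup_seq !big_nil measure0.
rewrite bigcup_seq !big_cons EFinD -bigcup_seq.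
apply: (le_trans (measureU2 _ _ _)) => //; first exact: fin_bigcup_measurable.
apply: leeD; first by apply: Fb; rewrite mem_head.
by apply: ih => j js; apply: Fb; rewrite in_cons js orbT.
Qed.

Lemma finite_disjoint_union_ge (I : finType) (S : {set I}) (F : I -> set T)
    (A : set T) (b : R) : (forall i, measurable (F i)) -> measurable A ->
  trivIset setT F ->
  (forall i, i \in S -> F i `<=` A) ->
  (forall i, i \in S -> (b%:E <= mu (F i))%E) ->
  ((#|S|%:R * b)%:E <= mu A)%E.
Proof.
move=> mF mA tF FA Fb.
have -> : #|S|%:R * b = \sum_(i in S) b by rewrite sumr_const mulr_natl.
have FA' : \bigcup_(i in [set` enum S]) F i `<=` A.
  by apply: bigcup_sub => i /=; rewrite mem_enum; exact: FA.
apply: (@le_trans _ _ (mu (\bigcup_(i in [set` enum S]) F i))); last first.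
  by apply: le_measure; rewrite ?inE//; exact: fin_bigcup_measurable.
rewrite measure_fin_bigcup//; last exact: sub_trivIset tF.
rewrite -fsbig_seq ?enum_uniq//.
rewrite -big_enum/= -sumEFin big_seq [leRHS]big_seq; apply: lee_sum => i.
by rewrite mem_enum; exact: Fb.
Qed.

End FiniteUnions.

Lemma card_dffun_ord (I : finType) (N : I -> nat) :
  #|{: {dffun forall i : I, 'I_(N i)}}| = (\prod_i N i)%N.
Proof.
rewrite card_dep_ffun foldrE big_image/=.
by apply: eq_bigr => i _; rewrite card_ord.
Qed.

Section Slots.
Variable R : realType.
Local Notation rT := (measurableTypeR R).

(** Cut off at the cell of [p], so that slots of different cells are disjoint. *)
Definition slot (K : nat) (r p : R) : set R :=
  [set u | Num.floor (K%:R * u) = Num.floor (K%:R * p) /\ `|u - p| < r].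

Lemma measurable_floor_eq (K : nat) (a : int) : (0 < K)%N ->
  measurable ([set u : R | Num.floor (K%:R * u) = a] : set rT).
Proof.
move=> K0; rewrite [X in measurable X](_ : _ = `[a%:~R / K%:R, (a + 1)%:~R / K%:R[%classic)//.
have Kp : 0 < K%:R :> R by rewrite ltr0n.
apply/seteqP; split => u /=; rewrite in_itv/= ler_pdivrMr// ltr_pdivlMr// ![u * _]mulrC.
  by move=> <-; exact: floor_itv.
by move=> h; apply/floor_def.
Qed.

Lemma measurable_slot K r p : (0 < K)%N -> measurable (slot K r p : set rT).
Proof.
move=> K0; rewrite [X in measurable X](_ : _ =
  [set u | Num.floor (K%:R * u) = Num.floor (K%:R * p)] `&` `]p - r, p + r[%classic).
  by apply: measurableI => //; exact: measurable_floor_eq.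
by apply/seteqP; split => u /= [ku h]; split => //; move: h;
  rewrite in_itv/= ltr_norml => /andP[? ?]; apply/andP; split; lra.
Qed.

Lemma slot_measure_le K r p : (0 < K)%N -> 0 < r ->
  (lebesgue_measure (slot K r p : set rT) <= (2 * r)%:E)%E.
Proof.
move=> K0 r0; apply: (@le_trans _ _ (lebesgue_measure (`]p - r, p + r[%classic : set rT))).
  apply: le_measure; rewrite ?inE//; first exact: measurable_slot.
  by move=> u [_]; rewrite /= in_itv/= ltr_norml => /andP[? ?]; apply/andP; split; lra.
rewrite lebesgue_measure_itv/= lte_fin; case: ifP => _; rewrite -?EFinB lee_fin; lra.
Qed.

(** A cell has length at least [2 r], so one of the two halves of the interval
    of radius [r] about [p] lies in the cell of [p]. *)
Lemma slot_measure_ge K r p : (0 < K)%N -> 0 < r -> r * K%:R <= 1 / 2 ->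
  (r%:E <= lebesgue_measure (slot K r p : set rT))%E.
Proof.
move=> K0 r0 rK; have Kp : 0 < K%:R :> R by rewrite ltr0n.
have /andP[a1 a2] := floor_itv (K%:R * p).
set a := Num.floor (K%:R * p) in a1 a2; rewrite intrD in a2.
have [h|h] := ltP (K%:R * (p + r)) (a%:~R + 1).
  apply: (@le_trans _ _ (lebesgue_measure (`[p, p + r[%classic : set rT))).
    rewrite lebesgue_measure_itv/= lte_fin ltrDl r0 -EFinB lee_fin; lra.
  apply: le_measure; rewrite ?inE//; first exact: measurable_slot.
  move=> u; rewrite /= in_itv/= => /andP[u1 u2]; split; last first.
    by rewrite ger0_norm ?subr_ge0// ltrBlDl.
  apply: floor_def; rewrite intrD; apply/andP; split.
    by apply: (le_trans a1); rewrite ler_pM2l.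
  by apply: le_lt_trans h; rewrite ler_pM2l// ltW.
apply: (@le_trans _ _ (lebesgue_measure (`]p - r, p]%classic : set rT))).
  by rewrite lebesgue_measure_itv/= lte_fin ltrBlDl ltrDr r0 -EFinB lee_fin; lra.
apply: le_measure; rewrite ?inE//; first exact: measurable_slot.
move=> u; rewrite /= in_itv/= => /andP[u1 u2]; split; last first.
  by rewrite ler0_norm ?subr_le0// opprB; lra.
apply: floor_def; rewrite intrD; apply/andP; split; last first.
  by apply: le_lt_trans a2; rewrite ler_pM2l.
have : K%:R * (p - r) <= K%:R * u by rewrite ler_pM2l// ltW.
move: h rK; rewrite !mulrDr mulrN [r * _]mulrC; lra.
Qed.

Lemma card_ord_interval (K : nat) (y l : R) : 0 <= l ->
  #|finset (fun i : 'I_K => y < i%:R < y + l)|%:R <= l + 1.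
Proof.
move=> l0; set S := finset _.
have [->|[i0 i0S]] := set_0Vmem S; first by rewrite cards0 addr_ge0.
case: (arg_minnP (fun i : 'I_K => i : nat) i0S) => i iS imin.
have /andP[t1 t2] := trunc_itv l0.
have : (#|S| <= (Num.trunc l).+1)%N.
  rewrite cardE -(size_map (@nat_of_ord K)) -(size_iota i (Num.trunc l).+1).
  apply: uniq_leq_size; first by rewrite map_inj_uniq ?enum_uniq//; exact: val_inj.
  move=> _ /mapP[j + ->]; rewrite mem_enum => jS.
  rewrite mem_iota imin//=.
  have {}iS : i \in S by [].
  move: iS jS; rewrite /S !finset.in_set => /andP[i1 i2] /andP[j1 j2].
  rewrite -(@ltr_nat R) natrD; lra.
rewrite -(@ler_nat R) => /le_trans; apply.
by rewrite -natr1 lerD2r.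
Qed.

End Slots.

Section Targets.
Variables (R : realType) (d : nat).
Local Notation rT := (measurableTypeR R).
Implicit Types (K : 'I_d -> nat) (r : 'I_d -> R) (P : nat -> 'I_d -> R).

Definition cell K (x : 'I_d -> R) : 'I_d -> int :=
  fun j => Num.floor ((K j)%:R * x j).

Definition in_unit (x : 'I_d -> R) := forall j, 0 <= x j < 1.

(** Keeps the first point in each occupied cell of the unit cube, a choice that is
    measurable in the points. *)
Definition selected K P N := in_unit (P N) /\
  forall N', (N' < N)%N -> cell K (P N') <> cell K (P N).

Definition target K r P : set (d.-tuple rT) :=
  \bigcup_(N in selected K P) box (fun j => slot (K j) (r j) (P N j)).

Local Notation cells K := {dffun forall j : 'I_d, 'I_(K j)}.

Definition cellz K (a : cells K) : 'I_d -> int := fun j => (a j : nat)%:Z.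

Lemma cell_in_unit K x : (forall j, 0 < K j)%N -> in_unit x ->
  exists a : cells K, cellz a = cell K x.
Proof.
move=> K0 xu.
have lt j : (`|cell K x j| < K j)%N.
  have /andP[x0 x1] := xu j; have Kp : 0 < (K j)%:R :> R by rewrite ltr0n.
  have : 0 <= cell K x j by rewrite floor_ge0 mulr_ge0.
  have : cell K x j < (K j)%:Z.
    by rewrite floor_lt_int -[ltRHS]mulr1 ltr_pM2l.
  lia.
exists [ffun j => Ordinal (lt j)]; apply/funext => j; rewrite /cellz ffunE/=.
by rewrite gez0_abs// floor_ge0 mulr_ge0//; case/andP: (xu j).
Qed.

Lemma cellz_inj K : injective (@cellz K).
Proof.
move=> a b ab; apply/ffunP => j; apply/val_inj.
by have := congr1 (fun f => f j) ab; rewrite /cellz => -[].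
Qed.

Lemma in_unit_cell K x (a : cells K) : cell K x = cellz a -> in_unit x.
Proof.
move=> xa j; have Kp : 0 < (K j)%:R :> R by rewrite ltr0n (leq_ltn_trans _ (ltn_ord (a j))).
have : cell K x j = (a j : nat)%:Z by rewrite xa.
rewrite /cell => /eqP; rewrite floor_eq => /andP[x0 x1].
have {}x0 : 0 <= (K j)%:R * x j by apply: le_trans x0; rewrite ler0n.
have {}x1 : (K j)%:R * x j < (K j)%:R.
  by apply: (lt_le_trans x1); rewrite -[leRHS]/((K j)%:Z%:~R) ler_int; have := ltn_ord (a j); lia.
by move: x0 x1; rewrite pmulr_rge0// -[X in _ < X -> _]mulr1 ltr_pM2l// => -> ->.
Qed.

Definition occupied K P : {set cells K} :=
  finset (fun a => `[< exists N, cell K (P N) = cellz a >]).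

Definition representative K P (a : cells K) : nat :=
  xget 0%N [set N | selected K P N /\ cell K (P N) = cellz a].

Lemma representativeP K P (a : cells K) : a \in occupied K P ->
  selected K P (representative P a) /\ cell K (P (representative P a)) = cellz a.
Proof.
rewrite finset.in_set => /asboolP[N0 N0a].
have ex : exists N, `[< cell K (P N) = cellz a >] by exists N0; apply/asboolP.
case: (ex_minnP ex) => N /asboolP Na Nmin.
apply: (@xgetPex _ 0%N [set N | selected K P N /\ cell K (P N) = cellz a]).
exists N; split => //; split; first exact: (in_unit_cell Na).
move=> N' N'N N'a; have : (N <= N')%N by apply: Nmin; apply/asboolP; rewrite N'a.
by rewrite leqNgt N'N.
Qed.

Lemma selected_uniq K P N N' : selected K P N -> selected K P N' ->
  cell K (P N) = cell K (P N') -> N = N'.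
Proof.
move=> [_ h] [_ h'] e; case: (ltngtP N N') => // lt; first by have := h' _ lt.
by have := h _ lt; rewrite e.
Qed.

Definition target_piece K r P (a : cells K) : set (d.-tuple rT) :=
  if a \in occupied K P
  then box (fun j => slot (K j) (r j) (P (representative P a) j)) else set0.

Section Positive.
Variable K : 'I_d -> nat.
Hypothesis K0 : forall j, (0 < K j)%N.

Lemma measurable_target_piece r P a : measurable (@target_piece K r P a).
Proof.
rewrite /target_piece; case: ifP => // _; apply: measurable_box => j.
exact: measurable_slot.
Qed.

Lemma target_pieces r P : target K r P = \bigcup_a (@target_piece K r P a).
Proof.
apply/seteqP; split => [x [N Nsel xN]|x [a _]]; last first.
  rewrite /target_piece; case: ifPn => // /representativeP[asel _] xa.
  by exists (representative P a).
have [a aN] := cell_in_unit K0 Nsel.1.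
have aocc : a \in occupied K P by rewrite finset.in_set; apply/asboolP; exists N.
exists a => //; rewrite /target_piece aocc.
have [asel ea] := representativeP aocc.
by rewrite (@selected_uniq K P (representative P a) N)// ea.
Qed.

Lemma measurable_target r P : measurable (target K r P).
Proof.
rewrite target_pieces; apply: fin_bigcup_measurable; first exact: finite_finset.
by move=> a _; exact: measurable_target_piece.
Qed.

Lemma target_piece_cell r P a x : @target_piece K r P a x ->
  cell K (tnth x) = cellz a.
Proof.
rewrite /target_piece; case: ifPn => // /representativeP[_ ea] xa.
by apply/funext => j; rewrite -ea /cell; have [] := xa j.
Qed.

Lemma trivIset_target_piece r P : trivIset setT (@target_piece K r P).
Proof.
apply/trivIsetP => a b _ _ /eqP ab; rewrite -subset0 => x [xa xb]; apply: ab.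
by apply: cellz_inj; rewrite -(target_piece_cell xa) (target_piece_cell xb).
Qed.

Lemma box_measure_le (A : 'I_d -> set R) (b : 'I_d -> R) :
  (forall j, measurable (A j : set rT)) ->
  (forall j, (lebesgue_measure (A j : set rT) <= (b j)%:E)%E) ->
  (lebesgue_tuple R d (box A) <= (\prod_j b j)%:E)%E.
Proof.
move=> mA Ab; rewrite lebesgue_box// -prodEFin.
set x := (X in (X <= _)%E); set y := (X in (_ <= X)%E).
suff : (0 <= x /\ x <= y)%E by case.
rewrite {}/x {}/y; elim/big_ind2: _ => //.
by move=> x1 x2 y1 y2 [? ?] [? ?]; split; [exact: mule_ge0|exact: lee_pmul].
Qed.

Lemma box_measure_ge (A : 'I_d -> set R) (b : 'I_d -> R) :
  (forall j, 0 <= b j) ->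
  (forall j, measurable (A j : set rT)) ->
  (forall j, ((b j)%:E <= lebesgue_measure (A j : set rT))%E) ->
  ((\prod_j b j)%:E <= lebesgue_tuple R d (box A))%E.
Proof.
move=> b0 mA Ab; rewrite lebesgue_box// -prodEFin.
set x := (X in (X <= _)%E); set y := (X in (_ <= X)%E).
suff : (0 <= x /\ x <= y)%E by case.
rewrite {}/x {}/y; elim/big_ind2: _ => //.
  by move=> x1 x2 y1 y2 [? ?] [? ?]; split; [exact: mule_ge0|exact: lee_pmul].
by move=> j _; split => //; rewrite lee_fin.
Qed.

(** The points near which [G] lies occupy at least
    [lambda G * prod_j (K_j / (2 (L + 1)))] cells, and each occupied cell
    contributes volume [prod_j r_j]. *)
Lemma target_lower r P (L : R) (G : set (d.-tuple rT)) : 0 <= L -> (forall j, 0 < r j) ->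
  (forall j, r j * (K j)%:R <= 1 / 2) -> measurable G ->
  (forall x, G x -> exists N, in_unit (P N) /\
     forall j, `|tnth x j - P N j| <= L / (K j)%:R) ->
  ((\prod_j (r j * (K j)%:R / (2 * (L + 1))))%:E * lebesgue_tuple R d G <=
    lebesgue_tuple R d (target K r P))%E.
Proof.
move=> L0 r0 rK mG GP.
have Kp j : 0 < (K j)%:R :> R by rewrite ltr0n.
have L1 : 0 < L + 1 by rewrite ltr_wpDl.
pose B (a : cells K) := box (fun j =>
  `[P (representative P a) j - (L + 1) / (K j)%:R,
    P (representative P a) j + (L + 1) / (K j)%:R]%classic).
have h1 : (lebesgue_tuple R d G <=
    (#|occupied K P|%:R * \prod_j (2 * (L + 1) / (K j)%:R))%:E)%E.
  apply: (@finite_union_le _ _ R (lebesgue_tuple R d) _ (occupied K P) B) => //.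
  - by move=> a; apply: measurable_box => j.
  - move=> x /GP[N [Nu xN]]; have [a aN] := cell_in_unit K0 Nu.
    have aocc : a \in occupied K P by rewrite finset.in_set; apply/asboolP; exists N.
    exists a => //= j; have [_ ea] := representativeP aocc.
    rewrite /= in_itv/= -ler_distlC distrC.
    set p := P (representative P a) j.
    have pN : `|P N j - p| <= 1 / (K j)%:R.
      have e : Num.floor ((K j)%:R * p) = Num.floor ((K j)%:R * P N j).
        by rewrite -[LHS]/(cell K (P (representative P a)) j) ea aN.
      have /andP[a1 a2] := floor_itv ((K j)%:R * p).
      have /andP[b1 b2] := floor_itv ((K j)%:R * P N j).
      rewrite e intrD in a1 a2; rewrite intrD in b2.
      rewrite ler_pdivlMr// -[X in _ * X](gtr0_norm (Kp j)) -normrM.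
      by rewrite ler_norml mulrBl ![_ * (K j)%:R]mulrC; apply/andP; split; lra.
    rewrite mulrDl (_ : tnth x j - p = (tnth x j - P N j) + (P N j - p)); last by ring.
    by rewrite (le_trans (ler_normD _ _))// lerD.
  - move=> a _; apply: box_measure_le => // j.
    rewrite lebesgue_measure_itv/= lte_fin; case: ifP => _; rewrite -?EFinB lee_fin.
      by rewrite le_eqVlt; apply/orP; left; apply/eqP; rewrite -mulrA; ring.
    by rewrite divr_ge0 ?mulr_ge0 ?ltW.
have h2 : ((#|occupied K P|%:R * \prod_j r j)%:E <=
    lebesgue_tuple R d (target K r P))%E.
  apply: (@finite_disjoint_union_ge _ _ R (lebesgue_tuple R d) _ (occupied K P)
    (@target_piece K r P)).
  - exact: measurable_target_piece.
  - exact: measurable_target.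
  - exact: trivIset_target_piece.
  - by move=> a _ x xa; rewrite target_pieces; exists a.
  - move=> a aocc; rewrite /target_piece aocc; apply: box_measure_ge.
    + by move=> j; exact: ltW.
    + by move=> j; exact: measurable_slot.
    + by move=> j; exact: slot_measure_ge.
have p0 : 0 <= \prod_j (r j * (K j)%:R / (2 * (L + 1))).
  by apply: prodr_ge0 => j _; rewrite divr_ge0 ?mulr_ge0// ltW.
apply: (le_trans (lee_wpmul2l _ h1)); first by rewrite lee_fin.
apply: le_trans h2; rewrite -EFinM lee_fin mulrCA -big_split/=.
rewrite le_eqVlt; apply/orP; left; apply/eqP; congr (_ * _); apply: eq_bigr => j _.
by field; rewrite !gt_eqF.
Qed.

Lemma target_piece_measure_le r P a : (forall j, 0 < r j) ->
  (lebesgue_tuple R d (@target_piece K r P a) <= (\prod_j (2 * r j))%:E)%E.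
Proof.
move=> r0; rewrite /target_piece; case: ifP => _; last first.
  by rewrite measure0 lee_fin prodr_ge0// => j _; rewrite mulr_ge0// ltW.
apply: box_measure_le => j; first exact: measurable_slot.
exact: slot_measure_le.
Qed.
End Positive.

(** A piece of the first target is a box with sides at most [2 r_j], which meets
    at most [prod_j (2 r_j K'_j + 2)] cells of the second grid. *)
Lemma target_upper K K' r r' P P' :
  (forall j, 0 < K j)%N -> (forall j, 0 < K' j)%N ->
  (forall j, 0 < r j) -> (forall j, 0 < r' j) ->
  (lebesgue_tuple R d (target K r P `&` target K' r' P') <=
   (\prod_j ((K j)%:R * ((2 * r j * (K' j)%:R + 2) * (2 * r' j))))%:E)%E.
Proof.
move=> K0 K'0 r0 r'0.
have b0 : 0 <= \prod_j ((2 * r j * (K' j)%:R + 2) * (2 * r' j)).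
  by apply: prodr_ge0 => j _; rewrite mulr_ge0 ?addr_ge0 ?mulr_ge0// ltW.
have mT := measurable_target K0 r P; have mT' := measurable_target K'0 r' P'.
have -> : \prod_j ((K j)%:R * ((2 * r j * (K' j)%:R + 2) * (2 * r' j))) =
    #|[set: cells K]%SET|%:R * \prod_j ((2 * r j * (K' j)%:R + 2) * (2 * r' j)).
  by rewrite cardsT card_dffun_ord natr_prod big_split.
apply: (@finite_union_le _ _ R (lebesgue_tuple R d) _ [set: cells K]%SET
   (fun a => @target_piece K r P a `&` target K' r' P')).
- by move=> a; apply: measurableI => //; exact: measurable_target_piece.
- exact: measurableI.
- move=> x [+ xT']; rewrite target_pieces// => -[a _ xa].
  by exists a => //=; rewrite finset.in_setT.
move=> a _; have [aocc|anocc] := boolP (a \in occupied K P); last first.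
  by rewrite /target_piece (negbTE anocc) set0I measure0 lee_fin.
pose p := P (representative P a).
pose nb j : pred 'I_(K' j) := [pred i : 'I_(K' j) |
  (K' j)%:R * (p j - r j) - 1 < i%:R <
  (K' j)%:R * (p j - r j) - 1 + (2 * r j * (K' j)%:R + 1)].
pose near_a : {set cells K'} := finset (fun b : cells K' => b \in family nb).
apply: (@le_trans _ _ (#|near_a|%:R * \prod_j (2 * r' j))%:E).
  apply: (@finite_union_le _ _ R (lebesgue_tuple R d) _ near_a
    (fun b => @target_piece K' r' P' b)).
  - by move=> b; exact: measurable_target_piece.
  - by apply: measurableI => //; exact: measurable_target_piece.
  - move=> x [xa]; rewrite target_pieces// => -[b _ xb]; exists b => //=.
    rewrite /near_a finset.in_set; apply/familyP => j; rewrite inE.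
    have e : Num.floor ((K' j)%:R * tnth x j) = (b j : nat)%:Z.
      by rewrite -[LHS]/(cell K' (tnth x) j) (target_piece_cell xb).
    have /andP[] := floor_itv ((K' j)%:R * tnth x j).
    rewrite e intrD => c1 c2.
    move: xa; rewrite /target_piece aocc => /(_ j)[_]; rewrite -/(p j) ltr_norml.
    have Kp : 0 < (K' j)%:R :> R by rewrite ltr0n.
    rewrite -(ltr_pM2l Kp) => /andP[d1].
    rewrite -(ltr_pM2l Kp) => d2.
    rewrite -[_%:~R]/((b j : nat)%:R) in c1 c2.
    by apply/andP; split; move: c1 c2 d1 d2; rewrite ?mulrBr ?mulrN; lra.
  - by move=> b _; exact: target_piece_measure_le.
rewrite lee_fin [leRHS]big_split/=; apply: ler_wpM2r.
  by apply: prodr_ge0 => j _; rewrite mulr_ge0// ltW.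
rewrite cardsE card_family foldrE big_image/= natr_prod.
apply: ler_prod => j _; rewrite ler0n/=.
have l0 : 0 <= 2 * r j * (K' j)%:R + 1 by rewrite addr_ge0// !mulr_ge0// ltW.
have := @card_ord_interval R (K' j) ((K' j)%:R * (p j - r j) - 1) _ l0.
by rewrite cardsE => /le_trans; apply; rewrite -addrA.
Qed.

End Targets.

(** * Ubiquity *)

Section MeasurableRelations.
Context d (T : measurableType d) (R : realType).
Implicit Types f g : T -> R.

Lemma measurable_set_lt f g : measurable_fun setT f -> measurable_fun setT g ->
  measurable [set x | f x < g x].
Proof.
move=> mf mg; have := measurable_fun_ltr mf mg measurableT (Y := [set true]) I.
by rewrite setTI; congr measurable; apply/seteqP; split => x.
Qed.

Lemma measurable_set_le f g : measurable_fun setT f -> measurable_fun setT g ->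
  measurable [set x | f x <= g x].
Proof.
move=> mf mg; have := measurable_fun_ler mf mg measurableT (Y := [set true]) I.
by rewrite setTI; congr measurable; apply/seteqP; split => x.
Qed.

Lemma measurable_set_floor_eq f g : measurable_fun setT f -> measurable_fun setT g ->
  measurable [set x | Num.floor (f x) = Num.floor (g x)].
Proof.
move=> mf mg; have mfl k : measurable_fun setT k ->
    forall a : int, measurable [set x : T | Num.floor (k x : R) = a].
  move=> mk a; rewrite [X in measurable X](_ : _ =
    [set x | a%:~R <= k x] `&` [set x | k x < (a + 1)%:~R]).
    by apply: measurableI; [apply: measurable_set_le|apply: measurable_set_lt].
  apply/seteqP; split => x /=; first by move=> <-; apply/andP; exact: floor_itv.
  by move=> [h1 h2]; apply: floor_def; rewrite h1.
rewrite [X in measurable X](_ : _ = \bigcup_(a : int)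
  ([set x | Num.floor (f x) = a] `&` [set x | Num.floor (g x) = a])).
  by apply: countable_bigcupT_measurable => // a; apply: measurableI; exact: mfl.
apply/seteqP; split => x /=; first by move=> e; exists (Num.floor (g x)).
by move=> [a _ [-> ->]].
Qed.

End MeasurableRelations.

Section Ubiquity.
Variable R : realType.
Local Notation rT := (measurableTypeR R).

Lemma prod_add_le d (v : 'I_d -> R) (C z : R) : 0 <= C -> 0 <= z <= 1 ->
  (forall j, 0 <= v j <= 1) ->
  \prod_j (v j + C * z) <= (1 + 2 * C) ^+ d * (z + \prod_j v j).
Proof.
move=> C0 /andP[z0 z1] v01; pose X := 1 + 2 * C.
have X1 n : 1 <= X ^+ n by rewrite exprn_ege1// /X lerDl mulr_ge0.
suff : 0 <= \prod_j v j <= 1 /\ 0 <= \prod_j (v j + C * z) <=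
    \prod_j v j + X ^+ d * z.
  move=> [/andP[P0 P1] /andP[_ /le_trans]]; apply.
  by rewrite mulrDr addrC lerD2l ler_peMl.
elim: d v v01 => [|d ih] v v01.
  by rewrite !big_ord0 expr0 mul1r ler01 lexx lerDl z0.
rewrite !big_ord_recr/=; have /andP[w0 w1] := v01 ord_max.
have [/andP[P0 P1] /andP[Q0 Q1]] := ih (fun j => v (widen_ord (leqnSn d) j))
  (fun j => v01 (widen_ord (leqnSn d) j)).
set P := \prod_(i < d) v _ in P0 P1 Q1 *; set Q := \prod_(i < d) (_ + _) in Q0 Q1 *.
set w := v ord_max in w0 w1 *.
have Cz : 0 <= C * z by rewrite mulr_ge0.
split; first by rewrite mulr_ge0//= -[leRHS]mulr1 ler_pM.
rewrite mulr_ge0 ?addr_ge0//=.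
have h1 : Q * (w + C * z) <= (P + X ^+ d * z) * (w + C * z).
  by rewrite ler_wpM2r// addr_ge0.
apply: (le_trans h1); rewrite exprSr.
have Xd := X1 d; set Y := X ^+ d in Xd *.
have -> : (P + Y * z) * (w + C * z) = P * w + z * (P * C + Y * (w + C * z)) by ring.
rewrite lerD2l [Y * _ * z]mulrC ler_wpM2l//.
have h2 : P * C <= Y * C by rewrite ler_wpM2r// (le_trans P1).
have h3 : Y * (w + C * z) <= Y * (1 + C).
  rewrite ler_wpM2l ?(le_trans _ Xd)// lerD// -[leRHS]mulr1 ler_wpM2l//.
by rewrite (le_trans (lerD h2 h3))// le_eqVlt; apply/orP; left; apply/eqP; rewrite /X; ring.
Qed.

Variables (d d1 d2 : nat) (h : 'I_d1 + 'I_d2 -> 'I_d) (h' : 'I_d -> 'I_d1 + 'I_d2).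
Hypotheses (hK : cancel h h') (h'K : cancel h' h).
Variables (K : nat -> 'I_d1 -> nat) (r : nat -> 'I_d1 -> R).
Variable p : nat -> nat -> d.-tuple rT -> 'I_d1 -> R.
Hypothesis mp : forall t N j, measurable_fun setT (fun A => p t N A j).
Hypothesis p_base : forall t N y x x',
  p t N (unsplit_tuple h' (y, x)) = p t N (unsplit_tuple h' (y, x')).

Definition fibre_target t : set (d.-tuple rT) := ucube d `&`
  \bigcup_N ([set A | selected (K t) (fun N => p t N A) N] `&`
    [set A | forall j, slot (K t j) (r t j) (p t N A j) (tnth A (h (inl j)))]).

Lemma measurable_fibre_target t : measurable (fibre_target t).
Proof.
apply: measurableI; first exact: measurable_ucube.
have mforall n (F : 'I_n -> set (d.-tuple rT)) : (forall j, measurable (F j)) ->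
    measurable [set A | forall j, F j A].
  move=> mF; rewrite [X in measurable X](_ : _ = \bigcap_(j in [set: 'I_n]) F j).
    by apply: fin_bigcap_measurable.
  by apply/seteqP; split => A /= FA j => [_|]; exact: FA.
have mK (f : d.-tuple rT -> R) k : measurable_fun setT f ->
    measurable_fun setT (fun A => k * f A) by move=> mf; exact: measurable_funM.
have mt i : measurable_fun setT (fun A : d.-tuple rT => tnth A i : R).
  exact: measurable_tnth.
apply: bigcupT_measurable => N; apply: measurableI.
  rewrite [X in measurable X](_ : _ = [set A | forall j, (fun j A => 0 <= p t N A j < 1) j A] `&`
    \bigcap_N' [set A | (N' < N)%N -> cell (K t) (p t N' A) <> cell (K t) (p t N A)]).
    apply: measurableI; first apply: mforall => j.
      rewrite [X in measurable X](_ : _ = [set A | 0 <= p t N A j] `&` [set A | p t N A j < 1]).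
        by apply: measurableI; [apply: measurable_set_le|apply: measurable_set_lt].
      by apply/seteqP; split => A /= /andP.
    apply: bigcapT_measurable => N'; have [lt|ge] := ltnP N' N; last first.
      by rewrite [X in measurable X](_ : _ = setT)//; apply/seteqP; split => A.
    rewrite [X in measurable X](_ : _ = ~` [set A | forall j,
       (fun j A => Num.floor ((K t j)%:R * p t N' A j) = Num.floor ((K t j)%:R * p t N A j)) j A]).
      by apply: measurableC; apply: mforall => j; apply: measurable_set_floor_eq; exact: mK.
    apply/seteqP; split => A /=; first by move=> /(_ isT) ne e; apply: ne; apply/funext.
    by move=> ne _ e; apply: ne => j; exact: (congr1 (fun f => f j) e).
  apply/seteqP; split => A /=; first by move=> [? ne]; split => // N' _ lt; exact: ne.
  by move=> [? ne]; split => // N' lt; exact: ne.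
apply: (mforall _ (fun j => [set A | slot (K t j) (r t j) (p t N A j) (tnth A (h (inl j)))])) => j.
apply: measurableI; first by apply: measurable_set_floor_eq; exact: mK.
apply: measurable_set_lt => //; apply: measurableT_comp; first exact: normr_measurable.
exact: measurable_funB.
Qed.

Let P t y : nat -> 'I_d1 -> R :=
  fun N => p t N (unsplit_tuple h' (y, [tuple (0 : R) | _ < d1])).

Lemma fibre_fibre_target_sub t y :
  fibre h' (fibre_target t) y `<=` target (K t) (r t) (P t y).
Proof.
move=> x [_ [N _ [Nsel xN]]]; exists N.
  move: Nsel; rewrite /=; congr selected; apply/funext => N'; exact: p_base.
move=> j; have := xN j; rewrite tnth_unsplit_tuple_fibre//=.
by rewrite (p_base _ _ _ x [tuple (0 : R) | _ < d1]).
Qed.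

Lemma sub_fibre_fibre_target t y : (forall j, 0 < K t j)%N -> ucube d2 y ->
  target (K t) (r t) (P t y) `<=` fibre h' (fibre_target t) y.
Proof.
move=> K0 yu x [N Nsel xN]; split; last first.
  exists N => //; split.
    by move: Nsel; rewrite /=; congr selected; apply/funext => N'; exact: p_base.
  move=> j; have := xN j; rewrite tnth_unsplit_tuple_fibre//=.
  by rewrite (p_base _ _ _ x [tuple (0 : R) | _ < d1]).
move=> i; rewrite -(h'K i); case: (h' i) => [a|b]; last first.
  by rewrite tnth_unsplit_tuple_base//; exact: yu.
rewrite tnth_unsplit_tuple_fibre//=.
have [c cN] := cell_in_unit K0 Nsel.1.
have : in_unit (tnth x).
  apply: (@in_unit_cell R d1 (K t) _ c); rewrite cN; apply/funext => j.
  by rewrite /cell; have [] := xN j.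
by move=> /(_ a); rewrite in_itv.
Qed.

(** On every fibre, [fibre_target t] consists of one box with sides of order [r t]
    in each occupied cell of the grid [K t]. By [target_lower] it has measure of
    order [w t = prod_j (r t j * K t j)], because the points come close to most of
    the cube. By [target_upper] its intersection with [fibre_target s], [s <= t],
    has measure [O(w t * prod_j (r s j * K s j + K s j / K t j))], and the last
    product is [O(w s + th ^ (t - s))]. *)
Theorem ubiquity (G : nat -> set (d.-tuple rT)) (L C c0 th : R) :
  0 <= L -> 0 <= C -> 0 < c0 -> 0 <= th < 1 ->
  (forall t j, 0 < K t j)%N -> (forall t j, 0 < r t j) ->
  (forall t j, r t j * (K t j)%:R <= 1 / 2) ->
  (forall s t j, (s <= t)%N -> (K s j)%:R <= C * th ^+ (t - s) * (K t j)%:R) ->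
  (forall t, measurable (G t)) -> (forall t, G t `<=` ucube d) ->
  (forall t, (c0%:E <= lebesgue_tuple R d (G t))%E) ->
  (forall t A, G t A -> exists N, in_unit (p t N A) /\
     forall j, `|tnth A (h (inl j)) - p t N A j| <= L / (K t j)%:R) ->
  (forall B, exists T, B <= \sum_(0 <= t < T) \prod_j (r t j * (K t j)%:R)) ->
  (((c0 / (2 * (L + 1)) ^+ d1) ^+ 2 / (4 * (4 ^+ d1 * (1 + 2 * C) ^+ d1)))%:E <=
    lebesgue_tuple R d (lim_sup_set fibre_target))%E.
Proof.
move=> L0 C0 c00 th01 K0 r0 rK Kst mG Gu Gc0 Gp div.
have L1 : 0 < 2 * (L + 1) by rewrite mulr_gt0// ltr_wpDl.
have Kp t j : 0 < (K t j)%:R :> R by rewrite ltr0n.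
have mE := measurable_fibre_target.
have Eu t : fibre_target t `<=` ucube d by move=> A [].
pose w t := \prod_j (r t j * (K t j)%:R).
have w0 t : 0 <= w t by apply: prodr_ge0 => j _; rewrite mulr_ge0 ?ltW.
have C1 : 0 < 1 + 2 * C by rewrite ltr_wpDr// mulr_ge0.
apply: (@quasi_independent_limsup _ _ _ (lebesgue_tuple R d) fibre_target w 0%N
  (c0 / (2 * (L + 1)) ^+ d1) (4 ^+ d1 * (1 + 2 * C) ^+ d1) th) => //.
- by rewrite divr_gt0// exprn_gt0.
- by rewrite mulr_gt0// exprn_gt0.
- apply: ucube_fin; first exact: bigcupT_measurable.
  by apply: bigcup_sub => t _; exact: Eu.
- move=> t _; apply: (@le_trans _ _ ((\prod_j (r t j * (K t j)%:R / (2 * (L + 1))))%:E *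
      lebesgue_tuple R d (G t))%E).
    have -> : \prod_j (r t j * (K t j)%:R / (2 * (L + 1))) = w t / (2 * (L + 1)) ^+ d1.
      by rewrite big_split/= prodr_const card_ord exprVn.
    rewrite (_ : c0 / _ * _ = w t / (2 * (L + 1)) ^+ d1 * c0); last by ring.
    by rewrite EFinM lee_wpmul2l// lee_fin divr_ge0// exprn_ge0// ltW.
  apply: (@lebesgue_fibre_compare R d d1 d2 h h' hK h'K) => //.
    by apply: prodr_ge0 => j _; rewrite divr_ge0 ?(ltW L1)// mulr_ge0 ?ltW.
  move=> y; have [yu|yu] := pselect (ucube d2 y); last first.
    rewrite [X in (_ * lebesgue_tuple R d1 X)%E](_ : _ = set0) ?measure0 ?mule0//.
    rewrite -subset0 => x /Gu xu; apply: yu => b.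
    by have := xu (h (inr b)); rewrite tnth_unsplit_tuple_base.
  apply: (@le_trans _ _ (lebesgue_tuple R d1 (target (K t) (r t) (P t y)))).
    apply: target_lower => //; first exact: measurable_fibre.
    move=> x /Gp[N [Nu xN]]; exists N; rewrite /P -(p_base _ _ y x); split => // j.
    by have := xN j; rewrite tnth_unsplit_tuple_fibre.
  apply: le_measure; rewrite ?inE; first exact: measurable_target.
    exact: measurable_fibre.
  exact: sub_fibre_fibre_target.
- move=> s t _ st.
  have B0 : 0 <= 4 ^+ d1 * (1 + 2 * C) ^+ d1 * w t * (th ^+ (t - s) + w s).
    rewrite !mulr_ge0 ?addr_ge0 ?exprn_ge0//; first exact: ltW.
    by case/andP: th01.
  apply: (@lebesgue_fibre_le R d d1 d2 h h' hK h'K) => //.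
  + exact: measurableI.
  + by move=> A [/Eu].
  move=> y; apply: (@le_trans _ _ (lebesgue_tuple R d1
      (target (K s) (r s) (P s y) `&` target (K t) (r t) (P t y)))).
    apply: le_measure; rewrite ?inE.
    - by apply: measurable_fibre => //; exact: measurableI.
    - by apply: measurableI; exact: measurable_target.
    - by move=> x [xs xt]; split; apply: fibre_fibre_target_sub.
  apply: (le_trans (target_upper _ _ _ _ _ _)) => //; rewrite lee_fin.
  apply: (@le_trans _ _ (\prod_j (4 * ((r t j * (K t j)%:R) *
      (r s j * (K s j)%:R + C * th ^+ (t - s)))))).
    apply: ler_prod => j _; have rt := r0 t j; have rs := r0 s j.
    apply/andP; split.
      by rewrite mulr_ge0// mulr_ge0 ?addr_ge0 ?mulr_ge0// ltW.
    have -> : 4 * (r t j * (K t j)%:R * (r s j * (K s j)%:R + C * th ^+ (t - s))) =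
       (4 * r t j) * (r s j * (K s j)%:R * (K t j)%:R + C * th ^+ (t - s) * (K t j)%:R) by ring.
    have -> : (K s j)%:R * ((2 * r s j * (K t j)%:R + 2) * (2 * r t j)) =
      (4 * r t j) * (r s j * (K s j)%:R * (K t j)%:R + (K s j)%:R) by ring.
    apply: ler_wpM2l; first by rewrite mulr_ge0// ltW.
    by rewrite lerD2l Kst.
  rewrite big_split [X in _ * X <= _]big_split/= prodr_const card_ord -/(w t) -!mulrA.
  apply: ler_wpM2l; first by rewrite exprn_ge0.
  rewrite [leRHS]mulrCA; apply: ler_wpM2l => //.
  have th0 : 0 <= th by case/andP: th01.
  apply: prod_add_le => //.
    by rewrite exprn_ge0// exprn_ile1// ltW//; case/andP: th01.
  move=> j; rewrite mulr_ge0 ?ltW//=.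
  by have := rK s j; lra.
Qed.

End Ubiquity.

(** * Quaternions and Hurwitz integers *)

Section Quaternions.
Variable R : realType.
Implicit Types x y z : quat R.

Definition qcoord x (c : 'I_4) : R := nth 0 [:: qre x; qi x; qj x; qk x] c.

Definition quat_of_coord (f : 'I_4 -> R) : quat R :=
  Quat (f (inord 0)) (f (inord 1)) (f (inord 2)) (f (inord 3)).

Lemma ord4P (P : 'I_4 -> Prop) :
  P (inord 0) -> P (inord 1) -> P (inord 2) -> P (inord 3) -> forall c, P c.
Proof.
move=> p0 p1 p2 p3 [[|[|[|[|//]]]] lt].
- by rewrite (_ : Ordinal lt = inord 0)//; apply/val_inj; rewrite /= inordK.
- by rewrite (_ : Ordinal lt = inord 1)//; apply/val_inj; rewrite /= inordK.
- by rewrite (_ : Ordinal lt = inord 2)//; apply/val_inj; rewrite /= inordK.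
- by rewrite (_ : Ordinal lt = inord 3)//; apply/val_inj; rewrite /= inordK.
Qed.

Lemma qcoordE x : [/\ qcoord x (inord 0) = qre x, qcoord x (inord 1) = qi x,
  qcoord x (inord 2) = qj x & qcoord x (inord 3) = qk x].
Proof. by rewrite /qcoord !inordK. Qed.

Lemma quat_of_coordK f c : qcoord (quat_of_coord f) c = f c.
Proof. by elim/ord4P: c; rewrite /qcoord inordK. Qed.

Lemma qcoord_inj x y : (forall c, qcoord x c = qcoord y c) -> x = y.
Proof.
case: x => a b c d; case: y => a' b' c' d' xy.
have := xy (inord 3); have := xy (inord 2); have := xy (inord 1); have := xy (inord 0).
by rewrite /qcoord !inordK//= => -> -> -> ->.
Qed.

Lemma qcoordD x y c : qcoord (x + y) c = qcoord x c + qcoord y c.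
Proof. by elim/ord4P: c; rewrite /qcoord !inordK. Qed.

Lemma qcoordN x c : qcoord (- x) c = - qcoord x c.
Proof. by elim/ord4P: c; rewrite /qcoord !inordK. Qed.

Lemma qcoordB x y c : qcoord (x - y) c = qcoord x c - qcoord y c.
Proof. by rewrite qcoordD qcoordN. Qed.

Lemma qcoord0 c : qcoord 0 c = 0.
Proof. by elim/ord4P: c; rewrite /qcoord !inordK. Qed.

Lemma qcoordMn x k c : qcoord (x *+ k) c = qcoord x c *+ k.
Proof. by elim: k => [|k ih]; rewrite ?mulr0n ?qcoord0// !mulrS qcoordD ih. Qed.

Definition qnorm2 x : R := qre x ^+ 2 + qi x ^+ 2 + qj x ^+ 2 + qk x ^+ 2.

Lemma qnorm2_ge0 x : 0 <= qnorm2 x.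
Proof. by rewrite !addr_ge0 ?sqr_ge0. Qed.

Lemma qnorm_ge0 x : 0 <= qnorm x.
Proof. exact: sqrtr_ge0. Qed.

Lemma qnormM x y : qnorm (x * y) = qnorm x * qnorm y.
Proof.
rewrite /qnorm -sqrtrM; last exact: qnorm2_ge0.
by congr Num.sqrt; case: x => a b c d; case: y => e f g h /=; ring.
Qed.

Lemma qnorm0_eq0 x : qnorm x = 0 -> x = 0.
Proof.
move=> /eqP; rewrite sqrtr_eq0 => le0.
have : qnorm2 x == 0 by rewrite eq_le le0 qnorm2_ge0.
rewrite /qnorm2 !paddr_eq0 ?addr_ge0 ?sqr_ge0// !sqrf_eq0.
by case: x {le0} => a b c d /= /andP[/andP[/andP[/eqP-> /eqP->] /eqP->] /eqP->].
Qed.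

Lemma qnorm_gt0 x : x != 0 -> 0 < qnorm x.
Proof.
move=> x0; rewrite lt_neqAle qnorm_ge0 andbT eq_sym.
by apply: contra x0 => /eqP/qnorm0_eq0->.
Qed.

Lemma qcoord_le_qnorm x c : `|qcoord x c| <= qnorm x.
Proof.
have h (a b e g : R) : `|a| <= Num.sqrt (a ^+ 2 + b + e + g) \/ ~ 0 <= b + e + g.
  have [bcd|] := boolP (0 <= b + e + g); [left|by right].
  by rewrite -sqrtr_sqr; apply: ler_wsqrtr; rewrite -!addrA lerDl addrA.
have [x0 x1 x2 x3] := qcoordE x.
have s0 (a : R) : 0 <= a ^+ 2 := sqr_ge0 a.
rewrite /qnorm; elim/ord4P: c; rewrite ?(x0, x1, x2, x3).
- case: (h (qre x) (qi x ^+ 2) (qj x ^+ 2) (qk x ^+ 2)) => [//|[]].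
  by rewrite !addr_ge0.
- case: (h (qi x) (qre x ^+ 2) (qj x ^+ 2) (qk x ^+ 2)) => [|[]].
    by congr (is_true (_ <= Num.sqrt _)); ring.
  by rewrite !addr_ge0.
- case: (h (qj x) (qre x ^+ 2) (qi x ^+ 2) (qk x ^+ 2)) => [|[]].
    by congr (is_true (_ <= Num.sqrt _)); ring.
  by rewrite !addr_ge0.
- case: (h (qk x) (qre x ^+ 2) (qi x ^+ 2) (qj x ^+ 2)) => [|[]].
    by congr (is_true (_ <= Num.sqrt _)); ring.
  by rewrite !addr_ge0.
Qed.

Lemma qnorm2_coord x : qnorm2 x = \sum_c qcoord x c ^+ 2.
Proof.
by rewrite !big_ord_recl big_ord0 addr0 /qcoord /= !addrA.
Qed.

Lemma qnorm_le x r : 0 <= r -> (forall c, `|qcoord x c| <= r) -> qnorm x <= 2 * r.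
Proof.
move=> r0 xr; rewrite -[leRHS]ger0_norm ?mulr_ge0// -sqrtr_sqr.
rewrite /qnorm -/(qnorm2 x) ler_wsqrtr// qnorm2_coord.
have -> : (2 * r) ^+ 2 = \sum_(c < 4) r ^+ 2.
  by rewrite sumr_const card_ord; ring.
by apply: ler_sum => c _; rewrite -[leLHS]real_normK ?num_real// ler_sqr ?nnegrE.
Qed.

Lemma qnorm_lt x r : (forall c, `|qcoord x c| < r) -> qnorm x < 2 * r.
Proof.
move=> xr; have r0 : 0 < r by apply: le_lt_trans (xr ord0).
rewrite -[ltRHS]ger0_norm ?mulr_ge0 1?ltW// -sqrtr_sqr.
rewrite /qnorm -/(qnorm2 x) ltr_sqrt ?exprn_gt0 ?mulr_gt0// qnorm2_coord.
have -> : (2 * r) ^+ 2 = \sum_(c < 4) r ^+ 2.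
  by rewrite sumr_const card_ord; ring.
have sq c : qcoord x c ^+ 2 < r ^+ 2.
  by rewrite -[ltLHS]real_normK ?num_real// ltr_sqr ?nnegrE// ltW.
by apply: ltr_sum => //; apply/hasP; exists ord0; rewrite ?mem_index_enum.
Qed.

Definition qinv x : quat R := Quat (qre x / qnorm2 x) (- qi x / qnorm2 x)
  (- qj x / qnorm2 x) (- qk x / qnorm2 x).

Lemma mulq_inv x : x != 0 -> x * qinv x = 1.
Proof.
move=> x0; have N0 : qnorm2 x != 0.
  by have := qnorm_gt0 x0; rewrite /qnorm sqrtr_gt0 => /lt0r_neq0.
case: x N0 {x0} => a b c d; rewrite /qnorm2/= => N0; congr Quat; rewrite /qinv /qnorm2/=. all: by field; exact: N0.
Qed.

End Quaternions.

Section HurwitzIntegers.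
Variable R : realType.
Implicit Types x y z : quat R.

Definition half_quat (v : int * int * int * int) : quat R :=
  Quat (v.1.1.1%:~R / 2) (v.1.1.2%:~R / 2) (v.1.2%:~R / 2) (v.2%:~R / 2).

Lemma Hurwitz_half x : Hurwitz x -> exists v, x = half_quat v.
Proof. by move=> [a [b [c [d [_ _ _ ->]]]]]; exists (a, b, c, d). Qed.

Lemma Hurwitz_coord x c : Hurwitz x -> exists a : int, qcoord x c = a%:~R / 2.
Proof.
move=> /Hurwitz_half[[[[a0 a1] a2] a3] ->].
by elim/ord4P: c; rewrite /qcoord inordK//=; eexists.
Qed.

Lemma HurwitzD x y : Hurwitz x -> Hurwitz y -> Hurwitz (x + y).
Proof.
move=> [a [b [c [d [ab bc cd ->]]]]] [a' [b' [c' [d' [ab' bc' cd' ->]]]]].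
exists (a + a'), (b + b'), (c + c'), (d + d'); split.
- by lia.
- by lia.
- by lia.
- by congr Quat; rewrite intrD mulrDl.
Qed.

Lemma Hurwitz0 : @Hurwitz R 0.
Proof. by exists 0, 0, 0, 0; split => //; congr Quat; rewrite mul0r. Qed.

Lemma Hurwitz_sum (I : Type) (r : seq I) (P : pred I) (F : I -> quat R) :
  (forall i, P i -> Hurwitz (F i)) -> Hurwitz (\sum_(i <- r | P i) F i).
Proof. by move=> hF; elim/big_ind: _ => //; [exact: Hurwitz0|exact: HurwitzD]. Qed.

Lemma Hurwitz_int (f : 'I_4 -> int) : Hurwitz (quat_of_coord (fun c => (f c)%:~R : R)).
Proof.
exists (2 * f (inord 0)), (2 * f (inord 1)), (2 * f (inord 2)), (2 * f (inord 3)).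
split; [by lia|by lia|by lia|].
by congr Quat; rewrite intrM mulrAC mulfV ?mul1r.
Qed.

Lemma HurwitzMn x k : Hurwitz x -> Hurwitz (x *+ k).
Proof.
move=> hx; elim: k => [|k ih]; first by rewrite mulr0n; exact: Hurwitz0.
by rewrite mulrS; exact: HurwitzD.
Qed.

(** Integral quaternions suffice as right factors: they are the entries of the
    matrices by which the unit cube is translated. *)
Lemma HurwitzM_int x (f : 'I_4 -> int) : Hurwitz x ->
  Hurwitz (x * quat_of_coord (fun c => (f c)%:~R)).
Proof.
move=> [a [b [c [d [ab bc cd ->]]]]].
set e := f (inord 0); set g := f (inord 1); set k := f (inord 2); set l := f (inord 3).
exists (a * e - b * g - c * k - d * l), (a * g + b * e + c * l - d * k),
  (a * k - b * l + c * e + d * g), (a * l + b * k - c * g + d * e).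
have [u bE] : exists u, b = a + 2 * u by exists ((b - a) %/ 2)%Z; lia.
have [v cE] : exists v, c = a + 2 * v by exists ((c - a) %/ 2)%Z; lia.
have [w dE] : exists w, d = a + 2 * w by exists ((d - a) %/ 2)%Z; lia.
have par (s1 s2 s : int) : s1 = s2 + 2 * s -> (s1 = s2 %[mod 2])%Z by move=> ->; lia.
split.
- by apply: (par _ _ (- a * g - a * l + v * (- k - l) + w * (k - l) - u * (e + g)));
    rewrite bE cE dE; ring.
- by apply: (par _ _ (a * l - a * k + u * (e + l) + v * (l - e) - w * (k + g)));
    rewrite bE cE dE; ring.
- by apply: (par _ _ (a * g - a * l - u * (l + k) + v * (e + g) + w * (g - e)));
    rewrite bE cE dE; ring.
by congr Quat => /=; rewrite -/e -/g -/k -/l !(intrD, intrM, mulrNz); field.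
Qed.

Lemma Hurwitz_qnorm_ge x : Hurwitz x -> x != 0 -> 1 / 2 <= qnorm x.
Proof.
move=> hx x0; have [c xc] : exists c, qcoord x c != 0.
  apply: contrapT => h; move/negP: x0; apply; apply/eqP/qcoord_inj => c.
  by rewrite qcoord0; apply/eqP/negPn/negP => xc; apply: h; exists c.
apply: le_trans (qcoord_le_qnorm x c).
have [a ea] := Hurwitz_coord c hx; rewrite ea in xc *.
rewrite normrM [`|2^-1|]ger0_norm ?invr_ge0// ler_wpM2r ?invr_ge0//.
rewrite -intr_norm (_ : 1 = 1%:~R)// ler_int.
have : a != 0 by apply: contra xc => /eqP ->; rewrite mul0r.
lia.
Qed.

Lemma Hurwitz_dist_lt x (e : R) :
  Hurwitz_dist x < e <-> exists2 z, Hurwitz z & qnorm (x - z) < e.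
Proof.
have lb : has_lbound [set qnorm (x - z) | z in @Hurwitz R].
  by exists 0 => _ [z _ <-]; exact: qnorm_ge0.
have ne : [set qnorm (x - z) | z in @Hurwitz R] !=set0.
  by exists (qnorm (x - 0)), 0 => //; exact: Hurwitz0.
split => [h|[z hz]]; last first.
  by apply: le_lt_trans; apply: ge_inf => //; exists z.
have [_ [z hz <-] lt] := inf_lt ne h.
by exists z.
Qed.

End HurwitzIntegers.

(** * Matrices as tuples of real coordinates *)

Section Coordinates.
Variable R : realType.
Local Notation rT := (measurableTypeR R).

Definition qindex m n (k : 'I_m) (j : 'I_n) (c : 'I_4) : 'I_(m * n * 4) :=
  mxvec_index (mxvec_index k j) c.

Definition mxvec_unindex m n (a : 'I_(m * n)) : 'I_m * 'I_n :=
  enum_val (cast_ord (esym (mxvec_cast m n)) a).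

Lemma mxvec_indexK m n (k : 'I_m) (j : 'I_n) : mxvec_unindex (mxvec_index k j) = (k, j).
Proof. by rewrite /mxvec_unindex /mxvec_index cast_ordK enum_rankK. Qed.

Lemma mxvec_unindexK m n (a : 'I_(m * n)) :
  mxvec_index (mxvec_unindex a).1 (mxvec_unindex a).2 = a.
Proof. by case/mxvec_indexP: a => k j; rewrite mxvec_indexK. Qed.

Lemma qcoord_mx m n (t : (m * n * 4).-tuple rT) k j c :
  qcoord (quat_mx_of_tuple t k j) c = tnth t (qindex k j c).
Proof. by rewrite mxE; exact: (quat_of_coordK (fun c => tnth t (qindex k j c))). Qed.

Lemma prod_mxvec n (g : 'I_n -> R) :
  \prod_(a < n * 4) g (mxvec_unindex a).1 = \prod_j g j ^+ 4.
Proof.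
rewrite (reindex (fun p : 'I_n * 'I_4 => mxvec_index p.1 p.2)) /=; last first.
  exists (@mxvec_unindex n 4) => [[j c] _|a _]; first by rewrite /= mxvec_indexK.
  by rewrite mxvec_unindexK.
under eq_bigr => p _ do rewrite mxvec_indexK/=.
rewrite -(pair_bigA _ (fun j c => g j))/=; apply: eq_bigr => j _.
by rewrite prodr_const card_ord.
Qed.

(** The indices outside the range of an injection are the base coordinates. *)
Lemma split_coordinates d d1 (f : 'I_d1 -> 'I_d) : injective f ->
  exists d2 (h : 'I_d1 + 'I_d2 -> 'I_d) h', [/\ cancel h h', cancel h' h &
    forall a, h (inl a) = f a].
Proof.
move=> finj; pose C := [pred i | i \notin codom f].
pose h (s : 'I_d1 + 'I_#|C|) := match s with inl a => f a | inr b => enum_val b end.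
have hinj : injective h.
  move=> [a|b] [a'|b'] /=.
  - by move=> /finj ->.
  - by move=> e; have := enum_valP b'; rewrite -e inE codom_f.
  - by move=> e; have := enum_valP b; rewrite e inE codom_f.
  - by move=> /enum_val_inj ->.
have hsurj i : exists s, h s == i.
  have [/codomP[a ->]|iC] := boolP (i \in codom f); first by exists (inl a).
  by exists (inr (enum_rank_in (iC : i \in C) i)); rewrite /= enum_rankK_in.
exists #|C|, h, (fun i => xchoose (hsurj i)); split => //.
  by move=> s; apply: hinj; exact/eqP/(xchooseP (hsurj (h s))).
by move=> i; exact/eqP/(xchooseP (hsurj i)).
Qed.

Section QMeasurable.
Context d (T : measurableType d).

Definition qmeasurable (F : T -> quat R) :=
  forall c, measurable_fun setT (fun t => qcoord (F t) c : R).

Lemma qmeasurable_cst x : qmeasurable (fun=> x).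
Proof. by move=> c; exact: measurable_cst. Qed.

Lemma qmeasurableD F G : qmeasurable F -> qmeasurable G ->
  qmeasurable (fun t => F t + G t).
Proof.
by move=> mF mG c; under eq_fun do rewrite qcoordD; exact: measurable_funD.
Qed.

Lemma qmeasurableB F G : qmeasurable F -> qmeasurable G ->
  qmeasurable (fun t => F t - G t).
Proof.
by move=> mF mG c; under eq_fun do rewrite qcoordB; exact: measurable_funB.
Qed.

Lemma qmeasurableM x F : qmeasurable F -> qmeasurable (fun t => x * F t).
Proof.
move=> mF.
have m0 : measurable_fun setT (fun t => qre (F t)).
  by have := mF (inord 0); rewrite /qcoord inordK.
have m1 : measurable_fun setT (fun t => qi (F t)).
  by have := mF (inord 1); rewrite /qcoord inordK.
have m2 : measurable_fun setT (fun t => qj (F t)).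
  by have := mF (inord 2); rewrite /qcoord inordK.
have m3 : measurable_fun setT (fun t => qk (F t)).
  by have := mF (inord 3); rewrite /qcoord inordK.
have mk a (g : T -> R) : measurable_fun setT g -> measurable_fun setT (fun t => a * g t).
  by move=> mg; exact: measurable_funM.
elim/ord4P; rewrite /qcoord inordK//=;
  repeat (apply: measurable_funB || apply: measurable_funD); exact: mk.
Qed.

Lemma qmeasurable_sum (I : Type) (r : seq I) (P : pred I) (F : I -> T -> quat R) :
  (forall i, P i -> qmeasurable (F i)) ->
  qmeasurable (fun t => \sum_(i <- r | P i) F i t).
Proof.
move=> mF; elim: r => [|i r ih].
  rewrite [X in qmeasurable X](_ : _ = fun=> 0); first exact: qmeasurable_cst.
  by apply/funext => t; rewrite big_nil.
have [Pi|nPi] := boolP (P i).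
  rewrite [X in qmeasurable X](_ : _ =
    fun t => F i t + \sum_(i <- r | P i) F i t).
    by apply: qmeasurableD => //; exact: mF.
  by apply/funext => t; rewrite big_cons Pi.
rewrite [X in qmeasurable X](_ : _ = fun t => \sum_(i <- r | P i) F i t)//.
by apply/funext => t; rewrite big_cons (negbTE nPi).
Qed.

Lemma qmeasurable_qnorm F : qmeasurable F -> measurable_fun setT (fun t => qnorm (F t)).
Proof.
move=> mF; rewrite (_ : (fun _ => _) = (@Num.sqrt R) \o (fun t => qnorm2 (F t)))//.
apply: measurableT_comp.
  by apply: continuous_measurable_fun; exact: sqrt_continuous.
under eq_fun do rewrite qnorm2_coord.
apply: measurable_sum => c; exact: measurable_funX.
Qed.

End QMeasurable.

Lemma qmeasurable_entry m n (k : 'I_m) (j : 'I_n) :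
  qmeasurable (fun t : (m * n * 4).-tuple rT => quat_mx_of_tuple t k j).
Proof.
by move=> c; under eq_fun do rewrite qcoord_mx; exact: measurable_tnth.
Qed.

Lemma qmeasurable_mulmx m n (q : 'rV[quat R]_m) (j : 'I_n) :
  qmeasurable (fun t : (m * n * 4).-tuple rT => (q *m quat_mx_of_tuple t) 0 j).
Proof.
rewrite [X in qmeasurable X](_ : _ = (fun t : (m * n * 4).-tuple rT =>
   \sum_k q 0 k * quat_mx_of_tuple t k j)).
  by apply: qmeasurable_sum => k _; apply: qmeasurableM; exact: qmeasurable_entry.
by apply/funext => t; rewrite mxE.
Qed.

Definition solution m n (A : 'M[quat R]_(m, n)) (eps : 'I_n -> R) (X : 'I_m -> R)
    (q : 'rV[quat R]_m) :=
  [/\ q != 0, forall k, Hurwitz (q 0 k),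
      forall j, Hurwitz_dist ((q *m A) 0 j) < eps j &
      forall k, qnorm (q 0 k) <= X k].

Definition solvable m n eps X : set ((m * n * 4).-tuple rT) :=
  [set t | exists q, solution (@quat_mx_of_tuple R m n t) eps X q].

Definition near_lattice m n (q : 'rV[quat R]_m) eps : set ((m * n * 4).-tuple rT) :=
  [set t | forall j, Hurwitz_dist ((q *m @quat_mx_of_tuple R m n t) 0 j) < eps j].

Lemma measurable_near_lattice m n q eps : measurable (@near_lattice m n q eps).
Proof.
rewrite [X in measurable X](_ : _ = \bigcap_(j in [set: 'I_n])
  \bigcup_(w : int * int * int * int) [set t | Hurwitz (half_quat R w) /\
    qnorm ((q *m @quat_mx_of_tuple R m n t) 0 j - half_quat R w) < eps j]).
  apply: fin_bigcap_measurable => // j _; apply: countable_bigcupT_measurable.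
    exact: countableP.
  move=> w; have [hw|nhw] := pselect (Hurwitz (half_quat R w)); last first.
    by rewrite [X in measurable X](_ : _ = set0)// -subset0 => t [].
  rewrite [X in measurable X](_ : _ = [set t |
    qnorm ((q *m @quat_mx_of_tuple R m n t) 0 j - half_quat R w) < eps j]).
    apply: measurable_set_lt => //; apply: qmeasurable_qnorm; apply: qmeasurableB.
      exact: qmeasurable_mulmx.
    exact: qmeasurable_cst.
  by apply/seteqP; split => t /= [].
apply/seteqP; split => t /= h j.
  move=> _; have /Hurwitz_dist_lt[z hz lt] := h j.
  by have [w zw] := Hurwitz_half hz; exists w => //; rewrite -zw.
have [w _ [hw lt]] := h j I; apply/Hurwitz_dist_lt; exists (half_quat R w) => //.
Qed.

Definition half_vec m (v : {ffun 'I_m -> int * int * int * int}) : 'rV[quat R]_m :=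
  \row_k half_quat R (v k).

Lemma Hurwitz_half_vec m (q : 'rV[quat R]_m) : (forall k, Hurwitz (q 0 k)) ->
  exists v, q = half_vec v.
Proof.
move=> hq; have /choice[v vq] : forall k, exists v, q 0 k = half_quat R v.
  by move=> k; exact: Hurwitz_half.
by exists [ffun k => v k]; apply/rowP => k; rewrite mxE ffunE.
Qed.

Lemma measurable_solvable m n eps X : measurable (@solvable m n eps X).
Proof.
pose Q (v : {ffun 'I_m -> int * int * int * int}) :=
  [/\ half_vec v != 0, forall k, Hurwitz (half_vec v 0 k) &
      forall k, qnorm (half_vec v 0 k) <= X k].
rewrite [X in measurable X](_ : _ =
  \bigcup_v [set t | Q v /\ near_lattice (half_vec v) eps t]).
  apply: countable_bigcupT_measurable; first exact: countableP.
  move=> v; have [Qv|nQv] := pselect (Q v); last first.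
    by rewrite [X in measurable X](_ : _ = set0)// -subset0 => t [].
  rewrite [X in measurable X](_ : _ = @near_lattice m n (half_vec v) eps).
    exact: measurable_near_lattice.
  by apply/seteqP; split => t; [case|split].
apply/seteqP; split => t.
  move=> [q [q0 qH qe qX]]; have [v qv] := Hurwitz_half_vec qH.
  exists v; first by [].
  split; last by rewrite -qv; exact: qe.
  by rewrite /Q -qv; split; [exact: q0|exact: qH|exact: qX].
by move=> [v _ [Qv qe]]; case: Qv => ? ? ?; exists (half_vec v); split.
Qed.

End Coordinates.

(** * Dirichlet's theorem *)

Section Dirichlet.
Variable R : realType.
Local Notation rT := (measurableTypeR R).

Lemma prod_pair4 (T : finType) (g : T -> nat) :
  (\prod_(p : T * 'I_4) g p.1 = (\prod_k g k) ^ 4)%N.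
Proof.
rewrite -(pair_bigA _ (fun k (c : 'I_4) => g k))/=.
under eq_bigr do rewrite prod_nat_const card_ord.
by rewrite (big_morph (expn^~ 4) (fun x y => expnMn x y 4) (exp1n 4)).
Qed.

Definition frac (x : R) : R := x - (Num.floor x)%:~R.

Lemma frac_itv x : 0 <= frac x < 1.
Proof.
have /andP[h1 h2] := floor_itv x; rewrite intrD in h2.
by rewrite /frac; apply/andP; split; lra.
Qed.

Lemma frac_trunc_lt (N : nat) x : (Num.trunc (N.+1%:R * frac x) < N.+1)%N.
Proof.
have Np : 0 < N.+1%:R :> R by rewrite ltr0n.
have /andP[f0 f1] := frac_itv x.
have /trunc_itv/andP[h _] : 0 <= N.+1%:R * frac x by rewrite mulr_ge0.
rewrite -(@ltr_nat R); apply: (le_lt_trans h).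
by rewrite -[ltRHS]mulr1 ltr_pM2l.
Qed.

Lemma frac_close (N : nat) x x' :
  Num.trunc (N.+1%:R * frac x) = Num.trunc (N.+1%:R * frac x') ->
  `|frac x - frac x'| < N.+1%:R^-1.
Proof.
have Np : 0 < N.+1%:R :> R by rewrite ltr0n.
have fr y : 0 <= N.+1%:R * frac y by rewrite mulr_ge0//; case/andP: (frac_itv y).
move=> e; have /andP[h1 h2] := trunc_itv (fr x).
have /andP[h3 h4] := trunc_itv (fr x').
rewrite -e in h3 h4; rewrite -[(Num.trunc _).+1%:R]natr1 in h2 h4.
rewrite -(ltr_pM2l Np) mulfV ?gt_eqF// -[X in X * _]gtr0_norm// -normrM mulrBr.
by rewrite ltr_norml; apply/andP; split; lra.
Qed.

Definition digit (N : nat) x : 'I_N.+1 := inord (Num.trunc (N.+1%:R * frac x)).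

Lemma digit_close (N : nat) x x' :
  digit N x = digit N x' -> `|frac x - frac x'| < N.+1%:R^-1.
Proof.
move=> /(congr1 (@nat_of_ord _)); rewrite /digit !inordK; first exact: frac_close.
- exact: frac_trunc_lt.
- exact: frac_trunc_lt.
Qed.

(** Pigeonhole: two of the vectors with coordinates in [{0, .., floor (X k / 2)}]
    have images in the same small cell of the unit torus. *)
Lemma dirichlet m n (A : 'M[quat R]_(m, n)) (delta : 'I_n -> R) (X : 'I_m -> R) :
  (0 < m)%N -> (forall k, 0 < X k) -> (forall j, 0 < delta j <= 1) ->
  3 ^+ n * 2 ^+ m <= (\prod_j delta j) * (\prod_k X k) ->
  exists q, solution A delta X q.
Proof.
move=> m0 X0 d01 hP.
have [hh hh1] : exists hh : 'I_m -> nat, forall k, (hh k)%:R <= X k / 2 < (hh k).+1%:R.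
  exists (fun k => Num.trunc (X k / 2)) => k.
  by apply: trunc_itv; rewrite divr_ge0// ltW.
have [H H1] : exists H : 'I_n -> nat, forall j, (H j)%:R <= 2 / delta j < (H j).+1%:R.
  exists (fun j => Num.trunc (2 / delta j)) => j.
  by apply: trunc_itv; rewrite divr_ge0//; case/andP: (d01 j) => /ltW.
pose QT := {dffun forall p : 'I_m * 'I_4, 'I_(hh p.1).+1}.
pose BT := {dffun forall p : 'I_n * 'I_4, 'I_(H p.1).+1}.
have card : (#|{: BT}| < #|{: QT}|)%N.
  rewrite !card_dffun_ord !(prod_pair4 (fun j => (H j).+1)) (prod_pair4 (fun k => (hh k).+1)).
  rewrite ltn_exp2r// -(@ltr_nat R) !natr_prod.
  apply: (@le_lt_trans _ _ (\prod_j (3 / delta j))).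
    apply: ler_prod => j _; rewrite ler0n/=; have /andP[d0 d1] := d01 j.
    have /andP[+ _] := H1 j; rewrite -natr1.
    have : 1 <= 1 / delta j by rewrite ler_pdivlMr// mul1r.
    have -> : 3 / delta j = 2 / delta j + 1 / delta j by field; rewrite gt_eqF.
    lra.
  apply: (@le_lt_trans _ _ (\prod_k (X k / 2))).
    have dp : 0 < \prod_j delta j by apply: prodr_gt0 => j _; case/andP: (d01 j).
    rewrite !big_split/= !prodr_const !card_ord prodfV exprVn.
    by rewrite ler_pdivrMr// mulrAC ler_pdivlMr ?exprn_gt0// [X in _ <= X]mulrC.
  apply: ltr_prod; last by move=> k _; rewrite divr_ge0 ?ltW//=; case/andP: (hh1 k).
  by apply/hasP; exists (Ordinal m0); rewrite ?mem_index_enum.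
pose vec (q : QT) : 'rV[quat R]_m :=
  \row_k quat_of_coord (fun c => (q (k, c) : nat)%:Z%:~R).
pose y (q : QT) j c := qcoord ((vec q *m A) 0 j) c.
pose b (q : QT) : BT := [ffun p : 'I_n * 'I_4 =>
  digit (H p.1) (y q p.1 p.2)].
have : ~~ injectiveb b.
  by apply/injectiveP => /leq_card; rewrite leqNgt card.
move=> /injectivePn[q [q' qq' bqq']].
exists (vec q - vec q').
have ent k : (vec q - vec q') 0 k =
    quat_of_coord (fun c => ((q (k, c) : nat)%:Z - (q' (k, c) : nat)%:Z)%:~R).
  by rewrite !mxE; apply: qcoord_inj => c; rewrite qcoordB !quat_of_coordK intrB.
split.
- apply: contra_neq qq' => e; apply/ffunP => -[k c]; apply/val_inj => /=.
  have := congr1 (fun M : 'rV[quat R]_m => qcoord (M 0 k) c) e.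
  by rewrite /= ent quat_of_coordK mxE qcoord0 => /eqP; rewrite intr_eq0 subr_eq0 => /eqP[->].
- by move=> k; rewrite ent; exact: Hurwitz_int.
- move=> j; apply/Hurwitz_dist_lt.
  exists (quat_of_coord (fun c => (Num.floor (y q j c) - Num.floor (y q' j c))%:~R)).
    exact: Hurwitz_int.
  have Hp : 0 < (H j).+1%:R :> R by rewrite ltr0n.
  apply: (@lt_trans _ _ (2 * (H j).+1%:R^-1)); last first.
    have /andP[dj _] := d01 j.
    have /andP[_] := H1 j; rewrite (ltr_pdivrMr _ _ dj) => lt2.
    by rewrite (ltr_pdivrMr _ _ Hp) mulrC.
  have -> : ((vec q - vec q') *m A) 0 j = (vec q *m A) 0 j - (vec q' *m A) 0 j.
    by rewrite mulmxBl [LHS]mxE; congr (_ + _); rewrite [LHS]mxE.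
  apply: qnorm_lt => c; rewrite !qcoordB quat_of_coordK intrB.
  have := congr1 (fun g : BT => g (j, c)) bqq'; rewrite [LHS]ffunE [RHS]ffunE.
  move=> /digit_close; rewrite -/(y q j c) -/(y q' j c) /frac /=.
  move: (y q j c) (y q' j c) => u u'.
  by congr (is_true (`|_| < _)); ring.
- move=> k; rewrite ent; have := hh1 k => /andP[h1 _].
  apply: (@le_trans _ _ (2 * (hh k)%:R)); last by move: h1; lra.
  apply: qnorm_le; first exact: ler0n.
  move=> c; rewrite quat_of_coordK -intr_norm [leRHS]pmulrn ler_int.
  have := ltn_ord (q (k, c)); have := ltn_ord (q' (k, c)); rewrite /=; lia.
Qed.

End Dirichlet.

(** * The union bound *)

Section UnionBound.
Variable R : realType.
Local Notation rT := (measurableTypeR R).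

Definition row_index m n (k : 'I_m) (a : 'I_(n * 4)) : 'I_(m * n * 4) :=
  qindex k (mxvec_unindex a).1 (mxvec_unindex a).2.

Lemma qindex_inj m n (k k' : 'I_m) (j j' : 'I_n) c c' :
  qindex k j c = qindex k' j' c' -> [/\ k = k', j = j' & c = c'].
Proof.
rewrite /qindex => e.
have e1 := congr1 (@mxvec_unindex _ _) e; rewrite !mxvec_indexK in e1.
have e2 := congr1 fst e1; have e3 := congr1 snd e1; rewrite /= in e2 e3.
have e4 := congr1 (@mxvec_unindex _ _) e2; rewrite !mxvec_indexK in e4.
by split => //; [exact: (congr1 fst e4)|exact: (congr1 snd e4)].
Qed.

Lemma row_index_inj m n (k : 'I_m) : injective (@row_index m n k).
Proof.
move=> a b /qindex_inj[_ e1 e2].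
by rewrite -(mxvec_unindexK a) -(mxvec_unindexK b) e1 e2.
Qed.

(** Constant along the fibres over the rows other than [k0]. *)
Definition other_rows m n (k0 : 'I_m) (q : 'rV[quat R]_m) (A : 'M[quat R]_(m, n)) j :=
  \sum_(k | k != k0) q 0 k * A k j.

Lemma mulmx_other_rows m n (k0 : 'I_m) q (A : 'M[quat R]_(m, n)) j :
  (q *m A) 0 j = q 0 k0 * A k0 j + other_rows k0 q A j.
Proof. by rewrite mxE (bigD1 k0). Qed.

Section RowSplit.
Variables (m n d2 : nat) (k0 : 'I_m).
Variables (h : 'I_(n * 4) + 'I_d2 -> 'I_(m * n * 4)).
Variable h' : 'I_(m * n * 4) -> 'I_(n * 4) + 'I_d2.
Hypotheses (hK : cancel h h') (h'K : cancel h' h).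
Hypothesis hrow : forall a, h (inl a) = row_index k0 a.

Lemma other_rows_base q y x x' j :
  other_rows k0 q (@quat_mx_of_tuple R m n (unsplit_tuple h' (y, x))) j =
  other_rows k0 q (@quat_mx_of_tuple R m n (unsplit_tuple h' (y, x'))) j.
Proof.
apply: eq_bigr => k kk0; congr (_ * _); apply: qcoord_inj => c.
rewrite !qcoord_mx; set i := qindex k j c.
have [b ib] : exists b, i = h (inr b).
  rewrite -(h'K i); case e : (h' i) => [a|b]; last by exists b.
  exfalso; move/eqP: kk0; apply; have := h'K i; rewrite e hrow.
  by move=> /qindex_inj[].
by rewrite ib !tnth_unsplit_tuple_base.
Qed.

Lemma row_fibre y x j c :
  qcoord (@quat_mx_of_tuple R m n (unsplit_tuple h' (y, x)) k0 j) c =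
  tnth x (mxvec_index j c).
Proof.
rewrite qcoord_mx -(tnth_unsplit_tuple_fibre hK (y, x)) hrow.
by rewrite /row_index mxvec_indexK.
Qed.

End RowSplit.

Lemma trunc_approx (x : R) : 0 <= x ->
  exists2 N : nat, N%:R <= x & x < N%:R + 1.
Proof.
by move=> /trunc_itv/andP[h1 h2]; exists (Num.trunc x); rewrite ?natr1.
Qed.

(** On a fibre over the rows other than [k0], the set is a union of at most
    [(20 |q_k0|)^(4 n)] boxes with sides [2 eps_j / |q_k0|]. *)
Lemma near_lattice_measure m n (q : 'rV[quat R]_m) (eps : 'I_n -> R) :
  q != 0 -> (forall k, Hurwitz (q 0 k)) -> (forall j, 0 < eps j <= 1) ->
  (lebesgue_tuple R (m * n * 4) (ucube _ `&` near_lattice q eps) <=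
    (\prod_j (40 * eps j) ^+ 4)%:E)%E.
Proof.
move=> q0 qH eps01.
have [k0 qk0] : exists k0, q 0 k0 != 0.
  by apply/existsP; apply: contra_neqT q0 => /existsPn h; apply/rowP => k;
    rewrite mxE; apply/eqP/negPn/h.
have [d2 [h [h' [hK h'K hrow]]]] := split_coordinates (@row_index_inj m n k0).
have aH := qH k0; set a := q 0 k0 in qk0 aH *.
have a12 : 1 / 2 <= qnorm a by exact: Hurwitz_qnorm_ge aH qk0.
have a0 : 0 < qnorm a by apply: lt_le_trans a12; rewrite divr_gt0.
have e0 j : 0 < eps j by case/andP: (eps01 j).
apply: (@lebesgue_fibre_le R _ _ _ h h' hK h'K).
- by apply: prodr_ge0 => j _; rewrite exprn_ge0// mulr_ge0// ltW.
- by apply: measurableI; [exact: measurable_ucube|exact: measurable_near_lattice].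
- by move=> t [].
move=> y; pose x0 : (n * 4).-tuple rT := [tuple 0 | _ < n * 4].
pose be j := other_rows k0 q (@quat_mx_of_tuple R m n (unsplit_tuple h' (y, x0))) j.
have [N N1 N2] : exists2 N : nat, 16 * qnorm a + 1 < N%:R & N%:R <= 20 * qnorm a.
  have [T h1 h2] : exists2 T : nat, T%:R <= 16 * qnorm a & 16 * qnorm a < T%:R + 1.
    by apply: trunc_approx; rewrite mulr_ge0// ltW.
  by exists T.+2; rewrite -addn2 natrD; lra.
have [bs bsP] : exists bs : 'I_n -> 'I_4 -> int, forall j c,
    (bs j c)%:~R <= 2 * qcoord (be j) c - 8 * qnorm a < (bs j c)%:~R + 1.
  exists (fun j c => Num.floor (2 * qcoord (be j) c - 8 * qnorm a)) => j c.
  by have := floor_itv (2 * qcoord (be j) c - 8 * qnorm a); rewrite intrD.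
pose V := {ffun 'I_(n * 4) -> 'I_N}.
pose z (v : V) j := quat_of_coord (fun c => (bs j c + (v (mxvec_index j c) : nat)%:Z)%:~R / 2 : R).
pose ctr v j := qinv a * (z v j - be j).
pose B (v : V) := box (fun i : 'I_(n * 4) => let j := (mxvec_unindex i).1 in
  let p := qcoord (ctr v j) (mxvec_unindex i).2 in
  `]p - eps j / qnorm a, p + eps j / qnorm a[%classic).
pose b := \prod_(i < n * 4) (2 * (eps (mxvec_unindex i).1 / qnorm a)).
apply: (@le_trans _ _ (#|[set: V]%SET|%:R * b)%:E); last first.
  rewrite cardsT card_ffun !card_ord natrX -(prod_mxvec (fun j => 40 * eps j)) lee_fin.
  have -> : N%:R ^+ (n * 4) = \prod_(i < n * 4) N%:R :> R by rewrite prodr_const card_ord.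
  rewrite -big_split/=; apply: ler_prod => i _.
  set e := eps _; have ei0 : 0 < e by exact: e0.
  have e'0 : 0 <= 2 * (e / qnorm a) by rewrite mulr_ge0 ?divr_ge0 ?ltW.
  apply/andP; split; first by rewrite mulr_ge0 ?ler0n.
  have -> : 40 * e = 20 * qnorm a * (2 * (e / qnorm a)) by field; rewrite gt_eqF.
  exact: ler_wpM2r.
apply: (@finite_union_le _ _ R (lebesgue_tuple R (n * 4)) _ [set: V]%SET B).
- by move=> v; apply: measurable_box => i /=.
- apply: measurable_fibre; apply: measurableI; first exact: measurable_ucube.
  exact: measurable_near_lattice.
- move=> x [xu xl]; pose A := @quat_mx_of_tuple R m n (unsplit_tuple h' (y, x)).
  have beE j : other_rows k0 q A j = be j by exact: (other_rows_base hK h'K hrow).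
  have /choice[zz zzP] : forall j, exists w, Hurwitz w /\
      qnorm (a * A k0 j + be j - w) < eps j.
    move=> j; have /Hurwitz_dist_lt[w wH wlt] := xl j; exists w; split => //.
    by move: wlt; rewrite (mulmx_other_rows k0) beE.
  have /choice[ee eeP] : forall i : 'I_(n * 4), exists e : int,
      qcoord (zz (mxvec_unindex i).1) (mxvec_unindex i).2 = e%:~R / 2.
    by move=> i; apply: Hurwitz_coord; exact: (zzP _).1.
  have bnd j c : `|qcoord (zz j) c - qcoord (be j) c| <= 4 * qnorm a.
    have -> : qcoord (zz j) c - qcoord (be j) c = qcoord (a * A k0 j) c -
        qcoord (a * A k0 j + be j - zz j) c by rewrite qcoordB qcoordD; ring.
    apply: (le_trans (ler_normB _ _)).
    have h1 : `|qcoord (a * A k0 j) c| <= qnorm a * 2.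
      apply: (le_trans (qcoord_le_qnorm _ _)); rewrite qnormM.
      apply: ler_wpM2l; first exact: ltW.
      rewrite -[leRHS]mulr1; apply: qnorm_le => [|c']; first exact: ler01.
      rewrite (row_fibre hK hrow).
      have := xu (h (inl (mxvec_index j c'))); rewrite (tnth_unsplit_tuple_fibre hK).
      by rewrite /= in_itv/= => /andP[? ?]; rewrite ger0_norm// ltW.
    have h2 : `|qcoord (a * A k0 j + be j - zz j) c| <= 1.
      apply: (le_trans (qcoord_le_qnorm _ _)); apply: (le_trans (ltW (zzP j).2)).
      by case/andP: (eps01 j).
    by move: (lerD h1 h2) a12; lra.
  have rng i : 0 <= ee i - bs (mxvec_unindex i).1 (mxvec_unindex i).2 < N%:Z.
    have := eeP i; move: (mxvec_unindex i).1 (mxvec_unindex i).2 => j c ej.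
    have := bnd j c; rewrite ej ler_norml => /andP[u1 u2].
    have /andP[f1 f2] := bsP j c.
    apply/andP; split; first by rewrite subr_ge0 -(ltzD1) -(ltr_int R) intrD; move: u1 f1; lra.
    by rewrite -(ltr_int R) intrB -pmulrn; move: u2 f2 N1; lra.
  have lt i : (`|ee i - bs (mxvec_unindex i).1 (mxvec_unindex i).2| < N)%N.
    by have /andP[] := rng i; lia.
  pose v : V := [ffun i => Ordinal (lt i)].
  have zv j : z v j = zz j.
    apply: qcoord_inj => c; rewrite quat_of_coordK ffunE/=.
    have := eeP (mxvec_index j c); have := rng (mxvec_index j c).
    rewrite mxvec_indexK/= => /andP[r1 _] ->; rewrite gez0_abs//.
    by congr (_%:~R / _); lia.
  exists v; first by rewrite /= finset.in_setT.
  move=> i /=.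
  have -> : tnth x i = qcoord (A k0 (mxvec_unindex i).1) (mxvec_unindex i).2.
    by rewrite (row_fibre hK hrow) mxvec_unindexK.
  move: (mxvec_unindex i).1 (mxvec_unindex i).2 => j c.
  have : qnorm (A k0 j - ctr v j) < eps j / qnorm a.
    rewrite ltr_pdivlMr// mulrC -qnormM mulrBr /ctr mulrA mulq_inv// mul1r zv.
    by rewrite opprB addrA; exact: (zzP j).2.
  move=> /(le_lt_trans (qcoord_le_qnorm _ c)); rewrite qcoordB ltr_norml in_itv/=.
  by move=> /andP[? ?]; apply/andP; split; lra.
move=> v _; apply: box_measure_le => i /=; first by [].
rewrite lebesgue_measure_itv/= lte_fin.
have : 0 < eps (mxvec_unindex i).1 / qnorm a by rewrite divr_gt0.
by case: ifP => _; rewrite -?EFinB lee_fin; lra.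
Qed.

Lemma solvable_measure m n (eps : 'I_n -> R) (X : 'I_m -> R) :
  (forall k, 1 <= X k) -> (forall j, 0 < eps j <= 1) ->
  (lebesgue_tuple R (m * n * 4) (ucube _ `&` solvable eps X) <=
    ((\prod_k (5 * X k) ^+ 4) * \prod_j (40 * eps j) ^+ 4)%:E)%E.
Proof.
move=> X1 eps01.
have X0 k : 0 <= X k by apply: le_trans (X1 k).
have [T TP] : exists T : 'I_m -> nat, forall k, (T k)%:R <= 2 * X k < (T k)%:R + 1.
  have /choice[T TP] : forall k, exists N : nat, N%:R <= 2 * X k < N%:R + 1.
    move=> k; have [|N h1 h2] := @trunc_approx (2 * X k); first by rewrite mulr_ge0.
    by exists N; rewrite h1.
  by exists T.
pose V := {dffun forall p : 'I_m * 'I_4, 'I_(2 * T p.1).+1}.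
pose Q (v : V) : 'rV[quat R]_m := \row_k quat_of_coord
  (fun c => ((v (k, c) : nat)%:Z - (T k)%:Z)%:~R / 2 : R).
pose F (v : V) : set ((m * n * 4).-tuple rT) :=
  if `[< Q v != 0 /\ forall k, Hurwitz (Q v 0 k) >]
  then ucube _ `&` near_lattice (Q v) eps else set0.
have mF v : measurable (F v).
  rewrite /F; case: ifP => // _; apply: measurableI; first exact: measurable_ucube.
  exact: measurable_near_lattice.
have b0 : 0 <= \prod_j (40 * eps j) ^+ 4.
  by apply: prodr_ge0 => j _; rewrite exprn_ge0// mulr_ge0// ltW//; case/andP: (eps01 j).
apply: (@le_trans _ _ (#|[set: V]%SET|%:R * \prod_j (40 * eps j) ^+ 4)%:E); last first.
  rewrite lee_fin; apply: ler_wpM2r => //.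
  rewrite cardsT card_dffun_ord (prod_pair4 (fun k => (2 * T k).+1)).
  rewrite natrX natr_prod -prodrXl; apply: ler_prod => k _.
  apply/andP; split; first by rewrite exprn_ge0// ler0n.
  have /andP[h1 _] := TP k.
  apply: lerXn2r; rewrite ?nnegrE ?ler0n ?mulr_ge0//.
  by rewrite -natr1 natrM; move: h1 (X1 k); lra.
apply: (@finite_union_le _ _ R (lebesgue_tuple R _) _ [set: V]%SET F) => //.
- by apply: measurableI; [exact: measurable_ucube|exact: measurable_solvable].
- move=> t [tu [q [q0 qH qe qX]]].
  have /choice[e eP] : forall p : 'I_m * 'I_4, exists e : int, qcoord (q 0 p.1) p.2 = e%:~R / 2.
    by move=> p; exact: Hurwitz_coord.
  have rng p : (absz (e p + (T p.1)%:Z)%R < (2 * T p.1).+1)%N /\ 0 <= e p + (T p.1)%:Z.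
    have := le_trans (qcoord_le_qnorm (q 0 p.1) p.2) (qX p.1).
    rewrite eP ler_norml => /andP[u1 u2].
    have /andP[_ t2] := TP p.1.
    have h1 : (e p)%:~R < ((T p.1)%:Z + 1)%:~R :> R.
      by rewrite intrD -pmulrn; move: t2 u2; lra.
    have h2 : (- ((T p.1)%:Z + 1))%:~R < (e p)%:~R :> R.
      by rewrite mulrNz intrD -pmulrn; move: t2 u1; lra.
    by move: h1 h2; rewrite !ltr_int; lia.
  pose v : V := [ffun p => Ordinal (rng p).1].
  have Qv : Q v = q.
    apply/rowP => k; rewrite mxE; apply: qcoord_inj => c; rewrite quat_of_coordK ffunE/=.
    by rewrite (eP (k, c)); congr (_%:~R / _); have [_ /=] := rng (k, c); lia.
  exists v; first by rewrite /= finset.in_setT.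
  rewrite /F; case: asboolP => [_|[]]; last by rewrite Qv.
  by split; [exact: tu|rewrite Qv; exact: qe].
move=> v _; rewrite /F; case: asboolP => [[q0 qH]|_]; last first.
  by rewrite measure0 lee_fin.
exact: near_lattice_measure.
Qed.

End UnionBound.

(** * Reduction to the unit cube *)

Section InfinitelySolvable.
Variable R : realType.
Local Notation rT := (measurableTypeR R).

Lemma infinite_nat_unbounded (A : set nat) :
  infinite_set A <-> forall N, exists2 u, (N <= u)%N & A u.
Proof.
split=> [Ainf N|h /finite_seqP[s As]].
  apply: contrapT => h; apply: Ainf; apply: sub_finite_set (finite_II N) => u Au.
  by rewrite /= ltnNge; apply/negP => Nu; apply: h; exists u.
have [u su Au] := h (\max_(i <- s) i).+1.
have us : u \in s by move: Au; rewrite As.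
by move: su; rewrite ltnNge leq_bigmax_seq.
Qed.

Variables m n : nat.
Local Notation d := (m * n * 4)%N.
Implicit Types (phi : 'I_n -> nat -> R) (Phi : 'I_m -> nat -> R).

Definition infinitely_solvable phi Phi : set (d.-tuple rT) :=
  [set t | infinite_set [set u : nat | (1 <= u)%N /\
     exists q, solution (@quat_mx_of_tuple R m n t) (phi ^~ u) (Phi ^~ u) q]].

Lemma infinitely_solvable_lim_sup phi Phi :
  infinitely_solvable phi Phi =
  lim_sup_set (fun u => if (1 <= u)%N then solvable (phi ^~ u) (Phi ^~ u) else set0).
Proof.
apply/seteqP; split => t.
  move=> /infinite_nat_unbounded h N _; have [u Nu [u1 ut]] := h N.
  by exists u => //=; rewrite u1.
move=> h; apply/infinite_nat_unbounded => N; have [u /= Nu] := h N I.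
by case: ifPn => // u1 ut; exists u.
Qed.

Lemma measurable_infinitely_solvable phi Phi :
  measurable (infinitely_solvable phi Phi).
Proof.
rewrite infinitely_solvable_lim_sup; apply: bigcap_measurable => // N _.
apply: bigcup_measurable => u _; case: ifP => // _; exact: measurable_solvable.
Qed.

(** If [A' = (B + A) / N] with [B] integral, the vector [N q] does for [A'] what
    [q] does for [A]. *)
Lemma solution_affine N (a : 'I_d -> int) (t : d.-tuple rT)
    (eps : 'I_n -> R) (X : 'I_m -> R) q : (0 < N)%N ->
  solution (@quat_mx_of_tuple R m n t) eps (fun k => X k / N%:R) q ->
  solution (@quat_mx_of_tuple R m n (affine_tuple N (fun i => (a i)%:~R) t)) eps X (q *+ N).
Proof.
move=> N0 [q0 qH qe qX]; have Np : 0 < N%:R :> R by rewrite ltr0n.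
set A := quat_mx_of_tuple t; set A' := quat_mx_of_tuple _.
pose B k j := quat_of_coord (fun c => (a (qindex k j c))%:~R : R).
have A'E k j : A' k j *+ N = B k j + A k j.
  apply: qcoord_inj => c; rewrite qcoordMn qcoordD quat_of_coordK !qcoord_mx tnth_mktuple.
  by rewrite -[LHS]mulr_natr divfK// gt_eqF.
have qN k : (q *+ N) 0 k = q 0 k *+ N by rewrite mulmxnE.
have nat_mul (x : quat R) : qnorm (x *+ N) = qnorm x * N%:R.
  rewrite /qnorm -/(qnorm2 _) -/(qnorm2 x) !qnorm2_coord.
  have -> : \sum_c qcoord (x *+ N) c ^+ 2 = (\sum_c qcoord x c ^+ 2) * N%:R ^+ 2.
    by rewrite mulr_suml; apply: eq_bigr => c _; rewrite qcoordMn -[qcoord x c *+ N]mulr_natr exprMn.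
  rewrite sqrtrM ?sqrtr_sqr ?ger0_norm//.
  by apply: sumr_ge0 => c _; exact: sqr_ge0.
split.
- apply: contra_neq q0 => e; apply/rowP => k.
  have := congr1 (fun M : 'rV[quat R]_m => M 0 k) e; rewrite /= qN !mxE => e'.
  apply: qcoord_inj => c; have := congr1 (fun x : quat R => qcoord x c) e'.
  by rewrite /= qcoordMn qcoord0 => /eqP; rewrite mulrn_eq0 eqn0Ngt N0 => /eqP.
- by move=> k; rewrite qN; apply: HurwitzMn.
- move=> j; have /Hurwitz_dist_lt[z zH zlt] := qe j; apply/Hurwitz_dist_lt.
  exists (\sum_k q 0 k * B k j + z); first by apply: HurwitzD => //;
    apply: Hurwitz_sum => k _; exact: HurwitzM_int.
  rewrite (_ : _ - _ = (q *m A) 0 j - z)//.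
  have -> : ((q *+ N) *m A') 0 j = \sum_k q 0 k * B k j + (q *m A) 0 j.
    rewrite !mxE -big_split/=; apply: eq_bigr => k _.
    by rewrite qN mulrnAl -mulrnAr A'E mulrDr.
  by rewrite opprD addrACA subrr add0r.
- by move=> k; rewrite qN nat_mul -ler_pdivlMr.
Qed.

Lemma infinitely_solvable_affine phi Phi N (a : 'I_d -> int) t : (0 < N)%N ->
  infinitely_solvable phi (fun k u => Phi k u / N%:R) t ->
  infinitely_solvable phi Phi (affine_tuple N (fun i => (a i)%:~R) t).
Proof.
move=> N0 /infinite_nat_unbounded h; apply/infinite_nat_unbounded => M.
have [u Mu [u1 [q qs]]] := h M; exists u => //; split => //.
by exists (q *+ N); exact: solution_affine.
Qed.

Lemma affine_grid_cube N (a : 'I_d -> int) : (0 < N)%N ->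
  @affine_tuple R d N (fun i => (a i)%:~R) @^-1` grid_cube N a = ucube d.
Proof.
move=> N0; have Np : 0 < N%:R :> R by rewrite ltr0n.
have E (t : d.-tuple rT) i :
    (Num.floor (N%:R * (((a i)%:~R + tnth t i) / N%:R)) == a i) = (0 <= tnth t i < 1).
  rewrite mulrC divfK ?lt0r_neq0// floor_eq intrD.
  by rewrite lerDl ltrD2l.
apply/seteqP; split => t.
  move=> ta i /=; rewrite in_itv/= -E; apply/eqP.
  have := congr1 (fun f => f i) ta; rewrite /grid_index /=.
  by rewrite tnth_mktuple.
move=> tu; apply/funext => i; rewrite /grid_index tnth_mktuple; apply/eqP.
by rewrite E; have := tu i; rewrite /= in_itv.
Qed.

Lemma infinitely_solvable_shift phi Phi (a : 'I_d -> int) t :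
  infinitely_solvable phi Phi t ->
  infinitely_solvable phi Phi (affine_tuple 1 (fun i => (a i)%:~R) t).
Proof.
move=> h; apply: infinitely_solvable_affine => //.
by rewrite (_ : (fun k u => _) = Phi)//; apply/funext => k; apply/funext => u; rewrite divr1.
Qed.

(** The map [t |-> (a + t) / N] carries the set for [Phi / N] in the unit cube into
    the set for [Phi] in a cube of side [1 / N]; so the latter set fills every
    such cube to proportion [c]. *)
Lemma infinitely_solvable_full phi Phi (c : R) : 0 < c ->
  (forall N, (0 < N)%N -> (c%:E <= lebesgue_tuple R d
     (ucube d `&` infinitely_solvable phi (fun k u => (Phi k u / N%:R)%R)))%E) ->
  lebesgue_tuple R d (ucube d `\` infinitely_solvable phi Phi) = 0%E.
Proof.
move=> c0 hc; have mW := measurable_infinitely_solvable.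
apply: (@grid_density R d _ c c0 (mW phi Phi)) => N a N0.
set C := grid_cube N _.
have mC : measurable C by exact: measurable_grid_cube.
have Nd : 0 < N%:R ^+ d :> R by rewrite exprn_gt0// ltr0n.
have mN : (0 < (N%:R ^+ d : R)%:E)%E by rewrite lte_fin.
rewrite -(@lee_pmul2l _ (N%:R ^+ d)%:E)// muleCA.
rewrite -!(lebesgue_affine_tuple (fun i => (a i)%:Z%:~R) N0)//; last exact: measurableI.
rewrite preimage_setI affine_grid_cube// lebesgue_ucube mule1.
apply: (le_trans (hc N N0)); apply: le_measure; rewrite ?inE.
- by apply: measurableI => //; exact: measurable_ucube.
- apply: measurableI; last exact: measurable_ucube.
  by rewrite -[X in measurable X]setTI; apply: measurable_affine_tuple.
- by move=> t [tu tW]; split => //=; exact: infinitely_solvable_affine.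
Qed.

(** The translates of the unit cube by the vectors with entries [0] and [-1] cover
    [[-1, 1)^d]. *)
Lemma shift_invariant_null (E C : set (d.-tuple rT)) : measurable E -> measurable C ->
  (forall (a : 'I_d -> int) t, E t -> E (affine_tuple 1 (fun i => (a i)%:~R) t)) ->
  C `<=` [set t | forall i, -1 <= tnth t i < 1] ->
  lebesgue_tuple R d (ucube d `&` E) = 0%E ->
  lebesgue_tuple R d (C `&` E) = 0%E.
Proof.
move=> mE mC shE Cb E0; apply/eqP; rewrite eq_le measure_ge0 andbT.
pose V := {ffun 'I_d -> bool}.
pose a (v : V) i := - (v i : nat)%:Z.
have mcube v : measurable (grid_cube 1 (a v) : set (d.-tuple rT)).
  exact: measurable_grid_cube.
rewrite (_ : 0%E = (#|[set: V]%SET|%:R * 0 : R)%:E); last by rewrite mulr0.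
apply: (@finite_union_le _ _ R (lebesgue_tuple R d) _ [set: V]%SET
  (fun v => grid_cube 1 (a v) `&` E)).
- by move=> v; exact: measurableI.
- exact: measurableI.
- move=> t [tC tE]; exists [ffun i => tnth t i < 0]; first by rewrite /= finset.in_setT.
  split => //; apply/funext => i; rewrite /grid_index /a ffunE mul1r.
  have /andP[h1 h2] := Cb _ tC i.
  by apply: floor_def; case: (ltP (tnth t i) 0) => h3 /=; rewrite ?mulrNz ?oppr0 ?add0r ?addNr;
    apply/andP; split.
move=> v _ /=; have := @lebesgue_affine_tuple R d 1 (fun i => (a v i)%:~R)
  (grid_cube 1 (a v) `&` E) isT (measurableI _ _ (mcube v) mE).
rewrite expr1n mul1e => <-; rewrite preimage_setI affine_grid_cube//.
apply: (@le_trans _ _ (lebesgue_tuple R d (ucube d `&` E))); last by rewrite E0.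
apply: le_measure; rewrite ?inE.
- apply: measurableI; first exact: measurable_ucube.
  by rewrite -[X in measurable X]setTI; apply: measurable_affine_tuple.
- by apply: measurableI => //; exact: measurable_ucube.
move=> t [tu /= tE]; split => //.
rewrite (_ : t = affine_tuple 1 (fun i => (- a v i)%:~R)
   (affine_tuple 1 (fun i => (a v i)%:~R) t)); first exact: shE.
by apply: eq_from_tnth => i; rewrite !tnth_mktuple !divr1 mulrNz addrA addNr add0r.
Qed.

Definition cell_tuples : set (d.-tuple rT) :=
  @quat_mx_of_tuple R m n @^-1` @Hurwitz_cell_mx R m n.

Lemma measurable_cell_tuples : measurable cell_tuples.
Proof.
rewrite [X in measurable X](_ : _ = \bigcap_(p in [set: 'I_m * 'I_n])
  \bigcap_(w : int * int * int * int) [set t | Hurwitz (half_quat R w) ->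
    qnorm (@quat_mx_of_tuple R m n t p.1 p.2) <=
    qnorm (@quat_mx_of_tuple R m n t p.1 p.2 - half_quat R w)]).
  apply: fin_bigcap_measurable; first exact: finite_finset.
  move=> p _; rewrite -[X in measurable X]setCK; apply: measurableC.
  rewrite setC_bigcap; apply: countable_bigcupT_measurable; first exact: countableP.
  move=> w; apply: measurableC.
  have [hw|nhw] := pselect (Hurwitz (half_quat R w)); last first.
    by rewrite [X in measurable X](_ : _ = setT)//; apply/seteqP; split => // t _ /= /nhw.
  rewrite [X in measurable X](_ : _ = [set t |
    qnorm (@quat_mx_of_tuple R m n t p.1 p.2) <=
    qnorm (@quat_mx_of_tuple R m n t p.1 p.2 - half_quat R w)]).
    apply: measurable_set_le; apply: qmeasurable_qnorm; first exact: qmeasurable_entry.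
    by apply: qmeasurableB; [exact: qmeasurable_entry|exact: qmeasurable_cst].
  by apply/seteqP; split => t /=; [apply|move=> + _].
apply/seteqP; split => t /= h; first by move=> p _ w _ /= /(h p.1 p.2).
move=> k j z /[dup] hz /Hurwitz_half[w zw]; rewrite zw in hz *.
exact: (h (k, j) I w I).
Qed.

(** Compare with the eight Hurwitz integers [1, -1, i, -i, ...]. *)
Lemma Hurwitz_cell_coord (x : quat R) c : Hurwitz_cell x -> `|qcoord x c| <= 1 / 2.
Proof.
move=> xcell; have h (s : int) : s ^+ 2 = 1 -> 2 * s%:~R * qcoord x c <= 1.
  move=> s1; pose e := quat_of_coord (fun c' => (if c' == c then s else 0)%:~R : R).
  have := xcell e (Hurwitz_int _ _).
  rewrite /qnorm -/(qnorm2 _) -/(qnorm2 (x - e)) ler_sqrt ?qnorm2_ge0//.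
  rewrite !qnorm2_coord (bigD1 c)//= [leRHS](bigD1 c)//=.
  have -> : \sum_(i < 4 | i != c) qcoord (x - e) i ^+ 2 = \sum_(i < 4 | i != c) qcoord x i ^+ 2.
    by apply: eq_bigr => i ic; rewrite qcoordB quat_of_coordK (negbTE ic) subr0.
  rewrite lerD2r qcoordB quat_of_coordK eqxx sqrrB -rmorphXn/= s1.
  by rewrite -subr_ge0; move: (qcoord x c) (s%:~R : R) => u v; lra.
have h1 := h 1 erefl; have h2 := h (-1) erefl.
by rewrite ler_norml; move: h1 h2; rewrite mulrNz; move: (qcoord x c) => u; lra.
Qed.

Lemma cell_tuples_bounded : cell_tuples `<=` [set t | forall i, -1 <= tnth t i < 1].
Proof.
move=> t tc i; case/mxvec_indexP: i => i c; case/mxvec_indexP: i => k j.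
have := Hurwitz_cell_coord c (tc k j); rewrite qcoord_mx ler_norml => /andP[h1 h2].
by apply/andP; split; move: h1 h2; rewrite /qindex; lra.
Qed.

Lemma quat_mx_measure_approximable phi Phi :
  quat_mx_measure (approximable_mx phi Phi) =
  lebesgue_tuple R d (cell_tuples `&` infinitely_solvable phi Phi).
Proof. by []. Qed.

Lemma approximable_null phi Phi :
  lebesgue_tuple R d (ucube d `&` infinitely_solvable phi Phi) = 0%E ->
  quat_mx_measure (approximable_mx phi Phi) = 0%E.
Proof.
move=> h; rewrite quat_mx_measure_approximable; apply: shift_invariant_null h.
- exact: measurable_infinitely_solvable.
- exact: measurable_cell_tuples.
- by move=> a t; exact: infinitely_solvable_shift.
- exact: cell_tuples_bounded.
Qed.

Lemma approximable_full phi Phi :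
  lebesgue_tuple R d (ucube d `\` infinitely_solvable phi Phi) = 0%E ->
  quat_mx_measure (approximable_mx phi Phi) = quat_mx_measure (@Hurwitz_cell_mx R m n).
Proof.
move=> h; rewrite quat_mx_measure_approximable /quat_mx_measure -/cell_tuples.
have mW := measurable_infinitely_solvable phi Phi.
rewrite [RHS](measureDI (lebesgue_tuple R d) measurable_cell_tuples mW)/=.
rewrite [X in (X + _)%E](_ : _ = 0%E) ?add0e//.
apply: shift_invariant_null h.
- exact: measurableC.
- exact: measurable_cell_tuples.
- move=> a t tE ta; apply: tE.
  have := @infinitely_solvable_shift phi Phi (fun i => - a i) _ ta.
  rewrite (_ : affine_tuple _ _ _ = t)//.
  by apply: eq_from_tnth => i; rewrite !tnth_mktuple !divr1 mulrNz addrA addNr add0r.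
- exact: cell_tuples_bounded.
Qed.

End InfinitelySolvable.

(** * Condensation and convergence *)

Section Condensation.
Variable R : realType.

Lemma nneseries_le (f : nat -> \bar R) (N : nat) (B : R) : (forall i, 0 <= f i)%E ->
  (forall T, \sum_(N <= i < T) f i <= B%:E)%E -> (\sum_(N <= i <oo) f i <= B%:E)%E.
Proof.
move=> f0 h; apply: lime_le; first by apply: is_cvg_nneseries => i _ _; exact: f0.
by apply: nearW => T; exact: h.
Qed.

Lemma eventually_ord (p : nat) (P : 'I_p -> nat -> Prop) :
  (forall j, exists U, forall u, (U <= u)%N -> P j u) ->
  exists U, forall j u, (U <= u)%N -> P j u.
Proof.
move=> /choice[U hU]; exists (\max_j U j) => j u ju; apply: hU.
by apply: leq_trans ju; exact: leq_bigmax.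
Qed.

Variables (m n : nat) (phi : 'I_n -> nat -> R) (Phi : 'I_m -> nat -> R).
Hypothesis phi_gt0 : forall j u, (1 <= u)%N -> 0 < phi j u.
Hypothesis phi_noninc :
  forall j u v, (1 <= u)%N -> (u <= v)%N -> phi j v <= phi j u.
Hypothesis phi_lim : forall j, phi j u @[u --> \oo] --> (0 : R).
Hypothesis Phi_gt0 : forall k u, (1 <= u)%N -> 0 < Phi k u.
Hypothesis Phi_nondec :
  forall k u v, (1 <= u)%N -> (u <= v)%N -> Phi k u <= Phi k v.
Hypothesis Phi_lim : forall k, Phi k u @[u --> \oo] --> +oo.
Variables (N0 M : nat) (c2 : R).
Hypotheses (hM : (2 <= M)%N) (hc2 : 1 < c2).
Hypothesis Phi_growth : forall j : nat, (N0 <= j)%N -> forall k,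
  Phi k (M ^ j.+1)%N <= c2 * Phi k (M ^ j)%N.

(** Up to a constant, the bound of [solvable_measure] at [u]; the exponent is
    the real dimension of the quaternions. *)
Definition volume u : R := ((\prod_j phi j u) * (\prod_k Phi k u)) ^+ 4.

Lemma Mexp_gt0 i : (1 <= M ^ i)%N.
Proof. by rewrite expn_gt0 (leq_trans _ hM). Qed.

Lemma MexpS i : (M ^ i <= M ^ i.+1)%N.
Proof. by rewrite leq_exp2l. Qed.

Lemma prod_phi_gt0 u : (1 <= u)%N -> 0 < \prod_j phi j u.
Proof. by move=> u1; apply: prodr_gt0 => j _; exact: phi_gt0. Qed.

Lemma prod_Phi_gt0 u : (1 <= u)%N -> 0 < \prod_k Phi k u.
Proof. by move=> u1; apply: prodr_gt0 => k _; exact: Phi_gt0. Qed.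

Lemma volume_ge0 u : 0 <= volume u.
Proof. by rewrite /volume; exact: exprn_even_ge0. Qed.

Lemma prod_Phi_growth i : (N0 <= i)%N ->
  \prod_k Phi k (M ^ i.+1)%N <= c2 ^+ m * \prod_k Phi k (M ^ i)%N.
Proof.
move=> iN; rewrite -[m in c2 ^+ m]card_ord -prodr_const -big_split/=.
apply: ler_prod => k _; rewrite Phi_growth// andbT ltW// Phi_gt0//.
exact: Mexp_gt0.
Qed.

Lemma volume_block_ge i u : (N0 <= i)%N -> (M ^ i <= u <= M ^ i.+1)%N ->
  (c2 ^+ m) ^- 4 * volume (M ^ i.+1) <= volume u.
Proof.
move=> iN /andP[u1 u2]; have u0 : (1 <= u)%N by apply: leq_trans u1; exact: Mexp_gt0.
have cm : 0 < c2 ^+ m by rewrite exprn_gt0// (lt_trans _ hc2).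
rewrite /volume -exprVn -exprMn.
have p1 := prod_phi_gt0 (Mexp_gt0 i.+1); have p2 := prod_Phi_gt0 (Mexp_gt0 i.+1).
have p3 := prod_phi_gt0 u0; have p4 := prod_Phi_gt0 u0.
apply: lerXn2r; rewrite ?nnegrE ?mulr_ge0 ?invr_ge0 ?(ltW cm) ?(ltW p1) ?(ltW p2) ?(ltW p3) ?(ltW p4)//.
rewrite mulrCA; apply: ler_pM.
- exact: ltW.
- by rewrite mulr_ge0 ?invr_ge0 ?ltW.
- by apply: ler_prod => j _; rewrite phi_noninc// andbT ltW// phi_gt0//; exact: Mexp_gt0.
rewrite ler_pdivrMl//; apply: (le_trans (prod_Phi_growth iN)).
apply: ler_wpM2l; first exact: ltW.
apply: ler_prod => k _; rewrite Phi_nondec ?Mexp_gt0// andbT ltW// Phi_gt0//.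
exact: Mexp_gt0.
Qed.

Lemma volume_block_le i u : (N0 <= i)%N -> (M ^ i <= u <= M ^ i.+1)%N ->
  volume u <= (c2 ^+ m) ^+ 4 * volume (M ^ i).
Proof.
move=> iN /andP[u1 u2]; have u0 : (1 <= u)%N by apply: leq_trans u1; exact: Mexp_gt0.
have cm : 0 < c2 ^+ m by rewrite exprn_gt0// (lt_trans _ hc2).
rewrite /volume -exprMn.
have p1 := prod_phi_gt0 (Mexp_gt0 i); have p2 := prod_Phi_gt0 (Mexp_gt0 i).
have p3 := prod_phi_gt0 u0; have p4 := prod_Phi_gt0 u0.
apply: lerXn2r; rewrite ?nnegrE ?mulr_ge0 ?(ltW cm) ?(ltW p1) ?(ltW p2) ?(ltW p3) ?(ltW p4)//.
rewrite mulrCA; apply: ler_pM; rewrite ?(ltW p3) ?(ltW p4)//.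
  by apply: ler_prod => j _; rewrite phi_noninc ?Mexp_gt0// andbT ltW// phi_gt0.
apply: le_trans (prod_Phi_growth iN).
by apply: ler_prod => k _; rewrite Phi_nondec// andbT ltW// Phi_gt0.
Qed.

Definition khintchine_term u : R := u%:R^-1 * volume u.

Lemma khintchine_term_ge0 u : 0 <= khintchine_term u.
Proof. by rewrite mulr_ge0 ?invr_ge0 ?volume_ge0. Qed.

Lemma block_ge i : (N0 <= i)%N ->
  (c2 ^+ m) ^- 4 / 2 * volume (M ^ i.+1) <=
  \sum_(M ^ i <= u < M ^ i.+1) khintchine_term u.
Proof.
move=> iN; have cm : 0 <= (c2 ^+ m) ^- 4.
  by rewrite invr_ge0 !exprn_ge0// ltW// (lt_trans _ hc2).
have Mp : 0 < (M ^ i.+1)%:R :> R by rewrite ltr0n Mexp_gt0.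
apply: (@le_trans _ _ (\sum_(M ^ i <= u < M ^ i.+1)
    ((M ^ i.+1)%:R^-1 * ((c2 ^+ m) ^- 4 * volume (M ^ i.+1))))).
  have -> : \sum_(M ^ i <= u < M ^ i.+1)
      ((M ^ i.+1)%:R^-1 * ((c2 ^+ m) ^- 4 * volume (M ^ i.+1))) =
      ((M ^ i.+1)%:R - (M ^ i)%:R) / (M ^ i.+1)%:R * ((c2 ^+ m) ^- 4 * volume (M ^ i.+1)).
    by rewrite sumr_const_nat -[LHS]mulr_natl natrB ?MexpS// mulrA.
  rewrite mulrAC [leLHS]mulrC; apply: ler_wpM2r.
    by rewrite mulr_ge0 ?volume_ge0.
  rewrite ler_pdivlMr// expnS natrM.
  have : 2 * (M ^ i)%:R <= M%:R * (M ^ i)%:R :> R by rewrite ler_wpM2r// ler_nat.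
  lra.
rewrite [leLHS]big_nat_cond [leRHS]big_nat_cond; apply: ler_sum => u /andP[/andP[u1 u2] _].
have u0 : (1 <= u)%N by apply: leq_trans u1; exact: Mexp_gt0.
apply: ler_pM; [by rewrite invr_ge0|by rewrite mulr_ge0 ?volume_ge0| |].
  by rewrite lef_pV2 ?posrE ?ltr0n ?Mexp_gt0// ler_nat ltnW.
by apply: volume_block_ge => //; rewrite u1 ltnW.
Qed.

Lemma block_le i : (N0 <= i)%N ->
  \sum_(M ^ i <= u < M ^ i.+1) khintchine_term u <=
  M%:R * (c2 ^+ m) ^+ 4 * volume (M ^ i).
Proof.
move=> iN; have cm : 0 <= (c2 ^+ m) ^+ 4.
  by rewrite !exprn_ge0// ltW// (lt_trans _ hc2).
have Mp : 0 < (M ^ i)%:R :> R by rewrite ltr0n Mexp_gt0.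
apply: (@le_trans _ _ (\sum_(M ^ i <= u < M ^ i.+1)
    ((M ^ i)%:R^-1 * ((c2 ^+ m) ^+ 4 * volume (M ^ i))))).
  rewrite [leLHS]big_nat_cond [leRHS]big_nat_cond; apply: ler_sum => u /andP[/andP[u1 u2] _].
  have u0 : (1 <= u)%N by apply: leq_trans u1; exact: Mexp_gt0.
  apply: ler_pM; [by rewrite invr_ge0|exact: volume_ge0| |].
    by rewrite lef_pV2 ?posrE ?ltr0n ?Mexp_gt0// ler_nat.
  by apply: volume_block_le => //; rewrite u1 ltnW.
have -> : \sum_(M ^ i <= u < M ^ i.+1)
    ((M ^ i)%:R^-1 * ((c2 ^+ m) ^+ 4 * volume (M ^ i))) =
    ((M ^ i.+1)%:R - (M ^ i)%:R) / (M ^ i)%:R * ((c2 ^+ m) ^+ 4 * volume (M ^ i)).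
  by rewrite sumr_const_nat -[LHS]mulr_natl natrB ?MexpS// mulrA.
rewrite -[leRHS]mulrA; apply: ler_wpM2r; first by rewrite mulr_ge0 ?volume_ge0.
by rewrite ler_pdivrMr// expnS natrM lerBlDr lerDl ltW.
Qed.

Lemma sum_blocks (f : nat -> R) K T :
  \sum_(0 <= i < T) \sum_(M ^ (K + i) <= u < M ^ (K + i).+1) f u =
  \sum_(M ^ K <= u < M ^ (K + T)) f u.
Proof.
elim: T => [|T ih]; first by rewrite big_geq// addn0 big_geq.
rewrite big_nat_recr//= ih addnS -big_cat_nat//=; last exact: MexpS.
by rewrite leq_exp2l// leq_addr.
Qed.

Lemma sum_shift (f : nat -> R) K T :
  \sum_(0 <= i < T) f (K + i)%N = \sum_(K <= i < K + T) f i.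
Proof.
transitivity (\sum_(0 + K <= i < K + T) f i); last by rewrite add0n.
rewrite big_addn addKn.
by apply: eq_bigr => i _; rewrite addnC.
Qed.

Let S : \bar R := (\sum_(1 <= q <oo) (khintchine_term q)%:E)%E.

Lemma volume_bounded : (S < +oo)%E ->
  exists B, forall T, \sum_(0 <= i < T) volume (M ^ (N0 + i).+1) <= B.
Proof.
move=> Soo; set c := (c2 ^+ m) ^- 4 / 2.
have c0 : 0 < c by rewrite divr_gt0// invr_gt0 !exprn_gt0// (lt_trans _ hc2).
have S0 : (0 <= S)%E by apply: nneseries_ge0 => i _ _; rewrite lee_fin khintchine_term_ge0.
exists (fine S / c) => T; rewrite ler_pdivlMr// mulrC mulr_sumr.
apply: (@le_trans _ _ (\sum_(0 <= i < T)
    \sum_(M ^ (N0 + i) <= u < M ^ (N0 + i).+1) khintchine_term u)).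
  by apply: ler_sum => i _; apply: block_ge; exact: leq_addr.
rewrite sum_blocks -lee_fin fineK ?ge0_fin_numE// -sumEFin.
apply: (@le_trans _ _ (\sum_(1 <= u < M ^ (N0 + T)) (khintchine_term u)%:E)%E).
  rewrite [leRHS](big_cat_nat (n := (M ^ N0)%N)) ?Mexp_gt0//=; last first.
    by rewrite leq_exp2l// leq_addr.
  by rewrite leeDr// sume_ge0// => i _; rewrite lee_fin khintchine_term_ge0.
by apply: nneseries_lim_ge => i _ _; rewrite lee_fin khintchine_term_ge0.
Qed.

Lemma volume_unbounded : S = +oo%E ->
  forall N B, exists T, B <= \sum_(0 <= i < T) volume (M ^ (N + i)).
Proof.
move=> Soo N B; apply: contrapT => h.
have {}h T : \sum_(0 <= i < T) volume (M ^ (N + i)) < B.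
  by rewrite ltNge; apply/negP => hT; apply: h; exists T.
pose K := maxn N N0; pose C := M%:R * (c2 ^+ m) ^+ 4.
have C0 : 0 <= C by rewrite mulr_ge0// !exprn_ge0// ltW// (lt_trans _ hc2).
suff : (S <= (\sum_(1 <= u < M ^ K) khintchine_term u + C * B)%:E)%E by rewrite Soo.
apply: nneseries_le => [i|T]; first by rewrite lee_fin khintchine_term_ge0.
rewrite sumEFin lee_fin.
apply: (@le_trans _ _ (\sum_(1 <= u < M ^ (K + T)) khintchine_term u)).
  have TM : (T <= M ^ (K + T))%N.
    by apply: (leq_trans (leq_addl K T)); apply: ltnW; rewrite ltn_expl.
  have [T0|T1] := leqP T 0.
    by rewrite big_geq ?(leq_trans T0)// sumr_ge0// => i _; exact: khintchine_term_ge0.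
  rewrite [leRHS](big_cat_nat (n := T))//= lerDl.
  by apply: sumr_ge0 => i _; exact: khintchine_term_ge0.
rewrite (big_cat_nat (n := (M ^ K)%N)) ?Mexp_gt0//=; last by rewrite leq_exp2l// leq_addr.
rewrite lerD2l -sum_blocks.
apply: (@le_trans _ _ (\sum_(0 <= i < T) C * volume (M ^ (K + i)))).
  apply: ler_sum => i _; apply: block_le.
  by rewrite (leq_trans (leq_maxr N N0))// leq_addr.
rewrite -mulr_sumr; apply: ler_wpM2l => //.
apply: (le_trans _ (ltW (h (K - N + T)%N))).
rewrite (sum_shift (fun i => volume (M ^ i))) (sum_shift (fun i => volume (M ^ i))).
have NK : (N <= K)%N by exact: leq_maxl.
rewrite addnA subnKC// [leRHS](big_cat_nat (n := K)) ?leq_addr//= lerDr.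
by apply: sumr_ge0 => i _; exact: volume_ge0.
Qed.

Lemma phi_eventually_le (e : R) : 0 < e ->
  exists U, forall j u, (U <= u)%N -> phi j u <= e.
Proof.
move=> e0; apply: eventually_ord => j.
have /cvgrPdist_le /(_ e e0)[U _ hU] := phi_lim j; exists U => u /hU.
by rewrite /= sub0r normrN => /(le_trans (ler_norm _)).
Qed.

Lemma Phi_eventually_ge (B : R) :
  exists U, forall k u, (U <= u)%N -> B <= Phi k u.
Proof.
apply: eventually_ord => k.
by have /cvgryPge /(_ B)[U _ hU] := Phi_lim k; exists U => u /hU.
Qed.

Lemma leq_Mexp i : (i <= M ^ i)%N.
Proof. by apply: ltnW; rewrite ltn_expl. Qed.

Local Notation d := (m * n * 4)%N.

(** Borel-Cantelli along the blocks [[M^i, M^(i+1))], on each of which the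
    systems are all implied by a single one of comparable volume. *)
Lemma infinitely_solvable_null : (S < +oo)%E ->
  lebesgue_tuple R d (ucube d `&` infinitely_solvable phi Phi) = 0%E.
Proof.
move=> /volume_bounded[B hB].
have [U0 hU0] := phi_eventually_le ltr01.
have [U1 hU1] := Phi_eventually_ge 1.
pose i0 := (maxn N0.+1 (maxn U0 U1)).
have i0N : (N0 < i0)%N by exact: leq_maxl.
have i0U0 : (U0 <= i0)%N by rewrite /i0 !leq_max leqnn ?orbT.
have i0U1 : (U1 <= i0)%N by rewrite /i0 !leq_max leqnn ?orbT.
pose F i := ucube d `&` solvable (phi ^~ (M ^ (i0 + i))%N) (Phi ^~ (M ^ (i0 + i).+1)%N).
have mF i : measurable (F i).
  by apply: measurableI; [exact: measurable_ucube|exact: measurable_solvable].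
pose C : R := 5 ^+ (4 * m) * 40 ^+ (4 * n) * (c2 ^+ m) ^+ 4.
have C0 : 0 <= C by rewrite !mulr_ge0 ?exprn_ge0// ltW// (lt_trans _ hc2).
have Fle i : (lebesgue_tuple R d (F i) <= (C * volume (M ^ (i0 + i)))%:E)%E.
  have iU0 : (U0 <= M ^ (i0 + i))%N.
    by rewrite (leq_trans i0U0)// (leq_trans _ (leq_Mexp _))// leq_addr.
  have iU1 : (U1 <= M ^ (i0 + i).+1)%N.
    by rewrite (leq_trans i0U1)// (leq_trans _ (leq_Mexp _))// leqW// leq_addr.
  apply: (le_trans (solvable_measure _ _)).
  - by move=> k; exact: hU1.
  - by move=> j; rewrite phi_gt0 ?Mexp_gt0//= hU0.
  rewrite lee_fin !prodrXl !big_split/= !prodr_const !card_ord -exprMn.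
  have iN : (N0 <= i0 + i)%N by rewrite (leq_trans (ltnW i0N))// leq_addr.
  have -> : C * volume (M ^ (i0 + i)) = (5 ^+ m * 40 ^+ n * (c2 ^+ m) *
      ((\prod_j phi j (M ^ (i0 + i))%N) * \prod_k Phi k (M ^ (i0 + i))%N)) ^+ 4.
    by rewrite /C /volume !(mulnC 4) !exprM !exprMn.
  have p1 := prod_phi_gt0 (Mexp_gt0 (i0 + i)).
  have p2 := prod_Phi_gt0 (Mexp_gt0 (i0 + i)).
  have p3 := prod_Phi_gt0 (Mexp_gt0 (i0 + i).+1).
  have e5 : 0 <= 5 ^+ m :> R by rewrite exprn_ge0.
  have e40 : 0 <= 40 ^+ n :> R by rewrite exprn_ge0.
  have ec : 0 <= c2 ^+ m by rewrite exprn_ge0// ltW// (lt_trans _ hc2).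
  apply: lerXn2r; rewrite ?nnegrE ?mulr_ge0 ?(ltW p1) ?(ltW p2) ?(ltW p3)//.
  have := prod_Phi_growth iN; move: p1 p2 p3.
  set a := \prod_j _; set b := \prod_k Phi k (M ^ (i0 + i).+1)%N.
  set b' := \prod_k _ => p1 p2 p3 hb.
  rewrite (_ : 5 ^+ m * b * (40 ^+ n * a) = (5 ^+ m * 40 ^+ n * a) * b); last by ring.
  rewrite (_ : _ * (a * b') = (5 ^+ m * 40 ^+ n * a) * (c2 ^+ m * b')); last by ring.
  by apply: ler_wpM2l => //; rewrite !mulr_ge0// ltW.
have F0 : lebesgue_tuple R d (lim_sup_set F) = 0%E.
  apply: lim_sup_set_cvg0 => //.
  apply: (@le_lt_trans _ _ (C * B)%:E); last exact: ltry.
  apply: nneseries_le => // T.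
  apply: (@le_trans _ _ (\sum_(0 <= i < T) (C * volume (M ^ (i0 + i)))%:E)%E).
    by apply: lee_sum => i _; exact: Fle.
  rewrite sumEFin lee_fin -mulr_sumr; apply: ler_wpM2l => //.
  apply: le_trans (hB (i0 - N0.+1 + T)%N).
  have -> : \sum_(0 <= i < i0 - N0.+1 + T) volume (M ^ (N0 + i).+1) =
     \sum_(0 <= i < i0 - N0.+1 + T) volume (M ^ (N0.+1 + i)) by [].
  rewrite (sum_shift (fun i => volume (M ^ i))) (sum_shift (fun i => volume (M ^ i))).
  rewrite addnA subnKC// [leRHS](big_cat_nat (n := i0)) ?leq_addr//= lerDr.
  by apply: sumr_ge0 => i _; exact: volume_ge0.
apply/eqP; rewrite eq_le measure_ge0 andbT -F0; apply: le_measure; rewrite ?inE.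
- apply: measurableI; first exact: measurable_ucube.
  exact: measurable_infinitely_solvable.
- by apply: bigcap_measurable => // N _; apply: bigcup_measurable => i _; exact: mF.
move=> t [tu /infinite_nat_unbounded h] N _.
have [u Nu [u1 [q [q0 qH qe qX]]]] := h (M ^ (i0 + N))%N.
have M1 : (1 < M)%N by [].
have /andP[lu1 lu2] := trunc_log_bounds M1 u1.
have iN : (i0 + N <= trunc_log M u)%N by rewrite trunc_log_max.
exists (trunc_log M u - i0)%N; first by rewrite /= leq_subRL// (leq_trans _ iN)// leq_addr.
have e : (i0 + (trunc_log M u - i0))%N = trunc_log M u.
  by rewrite subnKC// (leq_trans _ iN)// leq_addr.
split => //; rewrite e; exists q; split => // [j|k].
  by apply: (lt_le_trans (qe j)); rewrite phi_noninc ?Mexp_gt0.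
by apply: (le_trans (qX k)); rewrite Phi_nondec// ltnW.
Qed.

End Condensation.

(** * Non-increasing majorants with given products *)

Section ProductInterpolation.
Variable R : realType.

(** Geometric interpolation [a^(1-s) b^s] takes every intermediate product. *)
Lemma exists_between_prod n (a b : 'I_n -> R) (p : R) :
  (forall j, 0 < a j) -> (forall j, a j <= b j) ->
  \prod_j a j <= p <= \prod_j b j ->
  exists x : 'I_n -> R, (forall j, a j <= x j <= b j) /\ \prod_j x j = p.
Proof.
move=> a0 ab /andP[ap pb].
have b0 j : 0 < b j by apply: lt_le_trans (ab j).
have Pa : 0 < \prod_j a j by apply: prodr_gt0.
have p0 : 0 < p by apply: lt_le_trans ap.
pose u j := ln (a j); pose v j := ln (b j).
have uv j : u j <= v j by rewrite /u /v ler_ln ?posrE.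
have expu j : expR (u j) = a j by rewrite lnK ?posrE.
have expv j : expR (v j) = b j by rewrite lnK ?posrE.
set U := \sum_j u j; set V := \sum_j v j.
have UL : U <= ln p by rewrite -ler_expR lnK ?posrE// expR_sum (eq_bigr a).
have LV : ln p <= V by rewrite -ler_expR lnK ?posrE// expR_sum (eq_bigr b).
have [s /andP[s0 s1] sE] : exists2 s, 0 <= s <= 1 & U + s * (V - U) = ln p.
  have [VU|VU] := eqVneq V U.
    by exists 0; rewrite ?lexx ?ler01// mul0r addr0; apply/eqP; rewrite eq_le UL -VU LV.
  have d0 : 0 < V - U by rewrite subr_gt0 lt_neqAle eq_sym VU (le_trans UL).
  exists ((ln p - U) / (V - U)).
    apply/andP; split; last by rewrite ler_pdivrMr// mul1r lerD2r.
    by apply: divr_ge0; [rewrite subr_ge0|exact: ltW].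
  by rewrite divfK ?gt_eqF// addrC subrK.
exists (fun j => expR (u j + s * (v j - u j))); split => [j|].
  rewrite -{1}(expu j) -(expv j) !ler_expR; have vu := uv j.
  have : 0 <= s * (v j - u j) by rewrite mulr_ge0// subr_ge0.
  have : s * (v j - u j) <= 1 * (v j - u j) by rewrite ler_wpM2r// subr_ge0.
  by rewrite mul1r => h1 h2; apply/andP; split; lra.
by rewrite -expR_sum big_split/= -mulr_sumr big_split/= sumrN sE lnK ?posrE.
Qed.

(** Recursively, [delta t.+1] is chosen between [phi t.+1] and [delta t], whose
    products bracket [P t.+1]. *)
Lemma exists_noninc_majorant n (phi : nat -> 'I_n -> R) (P : nat -> R) :
  (forall t j, 0 < phi t j) -> (forall t j, phi t j <= 1) ->
  (forall t j, phi t.+1 j <= phi t j) ->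
  (forall t, P t.+1 <= P t) -> P 0%N <= 1 ->
  (forall t, \prod_j phi t j <= P t) ->
  exists delta : nat -> 'I_n -> R, forall t,
    [/\ forall j, phi t j <= delta t j <= 1, \prod_j delta t j = P t &
        forall j, delta t.+1 j <= delta t j].
Proof.
move=> phi0 phi1 phiS PS P0 phiP.
pose ok t (x : 'I_n -> R) := (forall j, phi t j <= x j <= 1) /\ \prod_j x j = P t.
have ex0 : exists x, ok 0%N x.
  have [|x [x1 x2]] := @exists_between_prod n (phi 0%N) (fun=> 1) (P 0%N) (phi0 0%N) (phi1 0%N).
    by rewrite phiP big1.
  by exists x.
have step t x : ok t x -> exists y, ok t.+1 y /\ forall j, y j <= x j.
  move=> [x1 x2].
  have phix j : phi t.+1 j <= x j.
    by apply: (le_trans (phiS t j)); case/andP: (x1 j).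
  have [|y [y1 y2]] := @exists_between_prod n (phi t.+1) x (P t.+1) (phi0 t.+1) phix.
    by rewrite phiP x2 PS.
  exists y; split; last by move=> j; case/andP: (y1 j).
  split => // j; have /andP[-> yx] := y1 j; apply: (le_trans yx).
  by case/andP: (x1 j).
have [x0 x0P] := ex0.
pose next (s : nat * ('I_n -> R)) (s' : nat * ('I_n -> R)) := s'.1 = s.1.+1 /\
  (ok s.1 s.2 -> ok s'.1 s'.2 /\ forall j, s'.2 j <= s.2 j).
have nextE s : {s' | next s s'}.
  apply: cid; have [oks|noks] := pselect (ok s.1 s.2); last by exists (s.1.+1, s.2).
  by have [y yP] := step _ _ oks; exists (s.1.+1, y).
have [f [f0 fS]] := dependent_choice nextE (0%N, x0).
have f1 t : (f t).1 = t.
  by elim: t => [|t ih]; [rewrite f0|have [-> _] := fS t; rewrite ih].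
have fok t : ok t (f t).2.
  elim: t => [|t ih]; first by rewrite f0.
  by have [_] := fS t; rewrite !f1 => /(_ ih)[].
exists (fun t => (f t).2) => t; have [h1 h2] := fok t; split => //.
by have [_] := fS t; rewrite !f1 => /(_ (fok t))[].
Qed.

End ProductInterpolation.

(** * Matrices with a large Dirichlet vector *)

Section GoodSet.
Variables (R : realType) (m n : nat) (k0 : 'I_m).
Local Notation rT := (measurableTypeR R).
Local Notation d := (m * n * 4)%N.

(** The value of [prod delta prod X] required by [dirichlet]. *)
Definition dirichlet_const : R := 3 ^+ n * 2 ^+ m.

(** Chosen so that [solvable_measure] bounds the matrices removed in [good_set] by
    [((1 / 2) ^ n / 2) ^ 4], at most half the measure of [middle]. *)
Definition kappa : R := (5 ^+ m * 40 ^+ n * (2 ^+ n * 2) * dirichlet_const)^-1.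

Lemma dirichlet_const_gt0 : 0 < dirichlet_const.
Proof. by rewrite mulr_gt0// exprn_gt0. Qed.

Lemma kappa_gt0 : 0 < kappa.
Proof. by rewrite invr_gt0 !mulr_gt0 ?exprn_gt0. Qed.

Definition shrink (X : 'I_m -> R) k : R := if k == k0 then kappa * X k else X k.

(** Away from the boundary in row [k0], so that nearby resonant points still belong
    to the unit cube. *)
Definition middle : set (d.-tuple rT) :=
  [set t | ucube d t /\ forall a, 1 / 4 <= tnth t (row_index k0 a) < 3 / 4].

(** On this set the vector given by [dirichlet] cannot have a small entry at [k0]. *)
Definition good_set (delta : 'I_n -> R) (X : 'I_m -> R) : set (d.-tuple rT) :=
  middle `\` solvable delta (shrink X).

Lemma middle_box : exists A : 'I_d -> set R, [/\ forall i, measurable (A i : set rT),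
  middle = box A & (lebesgue_tuple R d (box A) = ((1 / 2) ^+ (n * 4))%:E)%E].
Proof.
have [d2 [h [h' [hK h'K hrow]]]] := split_coordinates (@row_index_inj m n k0).
pose A i : set R := match h' i with inl _ => `[1 / 4, 3 / 4[%classic | inr _ => `[0, 1[%classic end.
have mA i : measurable (A i : set rT) by rewrite /A; case: (h' i).
exists A; split => //.
  apply/seteqP; split => t.
    move=> [tu tm] i; rewrite /A; case e : (h' i) => [a|b]; last exact: (tu i).
    by have := tm a; rewrite -hrow -e h'K /= in_itv.
  move=> tA; split => [i|a]; last first.
    by have := tA (h (inl a)); rewrite /A hK /= in_itv/= hrow.
  have := tA i; rewrite /A; case: (h' i) => _ //=; rewrite !in_itv/= => /andP[h1 h2].
  by apply/andP; split; lra.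
rewrite lebesgue_box// (reindex h) ?big_sumType /=; last by exists h'.
under eq_bigr do rewrite /A hK lebesgue_measure_itv/= lte_fin.
under [X in (_ * X)%E]eq_bigr do rewrite /A hK lebesgue_measure_itv/= lte_fin ltr01.
rewrite [X in (_ * X)%E]big1 ?mule1; last by move=> i _; rewrite -EFinB subr0.
have -> : (1 / 4 < 3 / 4 :> R) by lra.
rewrite prodEFin prodr_const card_ord; congr (_ ^+ _)%:E; lra.
Qed.

Lemma measurable_middle : measurable middle.
Proof. by have [A [mA -> _]] := middle_box; exact: measurable_box. Qed.

Lemma lebesgue_middle : lebesgue_tuple R d middle = ((1 / 2) ^+ (n * 4))%:E.
Proof. by have [A [_ -> ->]] := middle_box. Qed.

Lemma measurable_good_set delta X : measurable (good_set delta X).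
Proof. by apply: measurableD; [exact: measurable_middle|exact: measurable_solvable]. Qed.

Lemma good_set_sub delta X : good_set delta X `<=` ucube d.
Proof. by move=> t [[]]. Qed.

Lemma shrink_prod (X : 'I_m -> R) : \prod_k shrink X k = kappa * \prod_k X k.
Proof.
rewrite (bigD1 k0)//= [in RHS](bigD1 k0)//= mulrA /shrink eqxx; congr (_ * _).
by apply: eq_bigr => k /negbTE ->.
Qed.

Lemma good_set_measure (delta : 'I_n -> R) (X : 'I_m -> R) :
  (forall j, 0 < delta j <= 1) -> (forall k, 1 <= X k) -> 1 <= kappa * X k0 ->
  (\prod_j delta j) * (\prod_k X k) = dirichlet_const ->
  (((1 / 2) ^+ (n * 4) / 2)%:E <= lebesgue_tuple R d (good_set delta X))%E.
Proof.
move=> d01 X1 kX dX.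
have shr1 k : 1 <= shrink X k by rewrite /shrink; case: eqVneq => [->|].
have mS := @measurable_solvable R m n delta (shrink X).
have bad : (lebesgue_tuple R d (middle `&` solvable delta (shrink X)) <=
    ((1 / 2) ^+ (n * 4) / 2)%:E)%E.
  apply: (@le_trans _ _ (lebesgue_tuple R d (ucube d `&` solvable delta (shrink X)))).
    apply: le_measure; rewrite ?inE.
    - by apply: measurableI => //; exact: measurable_middle.
    - by apply: measurableI => //; exact: measurable_ucube.
    - by move=> t [[]].
  apply: (le_trans (solvable_measure shr1 d01)); rewrite lee_fin.
  rewrite !prodrXl !big_split/= !prodr_const !card_ord shrink_prod -exprMn.
  have B0 := dirichlet_const_gt0.
  have -> : 5 ^+ m * (kappa * \prod_k X k) * (40 ^+ n * \prod_j delta j) = (1 / 2) ^+ n / 2.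
    rewrite (_ : _ * _ = 5 ^+ m * 40 ^+ n * kappa * ((\prod_j delta j) * \prod_k X k)); last by ring.
    rewrite dX /kappa div1r exprVn; field.
    by rewrite !expf_neq0//= gt_eqF// !andbT/=.
  rewrite exprMn -exprM ler_wpM2l ?exprn_ge0 ?divr_ge0//.
  by rewrite !exprVn lef_pV2 ?posrE ?exprn_gt0//; lra.
have fin : lebesgue_tuple R d middle \is a fin_num by rewrite lebesgue_middle.
have := measureDI (lebesgue_tuple R d) measurable_middle mS.
rewrite /= lebesgue_middle => e.
rewrite -(@leeD2rE _ (lebesgue_tuple R d (middle `&` solvable delta (shrink X)))).
  rewrite -e; apply: (le_trans (leeD2l _ bad)).
  by rewrite -EFinD lee_fin -splitr.
rewrite ge0_fin_numE//; apply: le_lt_trans bad _; exact: ltry.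
Qed.

Lemma good_set_point (delta : 'I_n -> R) (X : 'I_m -> R) t :
  (0 < m)%N -> (forall j, 0 < delta j <= 1) -> (forall k, 0 < X k) ->
  (\prod_j delta j) * (\prod_k X k) = dirichlet_const -> good_set delta X t ->
  exists q, solution (@quat_mx_of_tuple R m n t) delta X q /\
    kappa * X k0 < qnorm (q 0 k0).
Proof.
move=> m0 d01 X0 dX [_ tS].
have [q qs] := @dirichlet R m n (quat_mx_of_tuple t) delta X m0 X0 d01 (eq_ind_r (fun x => _ <= x) (lexx _) dX).
exists q; split => //; rewrite ltNge; apply/negP => qk; apply: tS; exists q.
have [q0 qH qe qX] := qs; split => // k; rewrite /shrink; case: eqVneq => [->//|_].
exact: qX.
Qed.

End GoodSet.

(** * Divergence *)

Section Divergence.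
Variables (R : realType) (m n : nat).
Hypotheses (hm : (0 < m)%N) (hn : (0 < n)%N).
Variables (phi : 'I_n -> nat -> R) (Phi : 'I_m -> nat -> R).
Hypothesis phi_gt0 : forall j u, (1 <= u)%N -> 0 < phi j u.
Hypothesis phi_noninc :
  forall j u v, (1 <= u)%N -> (u <= v)%N -> phi j v <= phi j u.
Hypothesis phi_lim : forall j, phi j u @[u --> \oo] --> (0 : R).
Hypothesis Phi_gt0 : forall k u, (1 <= u)%N -> 0 < Phi k u.
Hypothesis Phi_nondec :
  forall k u v, (1 <= u)%N -> (u <= v)%N -> Phi k u <= Phi k v.
Hypothesis Phi_lim : forall k, Phi k u @[u --> \oo] --> +oo.
Variables (N0 M : nat) (c1 : R).
Hypotheses (hM : (2 <= M)%N) (hc1 : 1 < c1).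
Hypothesis Phi_growth : forall j : nat, (N0 <= j)%N -> forall k,
  c1 * Phi k (M ^ j)%N <= Phi k (M ^ j.+1)%N.
Hypothesis volume_div :
  forall N B, exists T, B <= \sum_(0 <= i < T) volume phi Phi (M ^ (N + i)).

Local Notation rT := (measurableTypeR R).
Local Notation d := (m * n * 4)%N.
Local Notation B0 := (dirichlet_const R m n).
Local Notation kap := (kappa R m n).

(** Independent of [phi] and [Phi], as the passage to small cubes requires. *)
Definition lower_const : R := Num.min 1
  (((1 / 2) ^+ (n * 4) / 2 / (2 * (kap^-1 + 1)) ^+ (n * 4)) ^+ 2 /
     (4 * (4 ^+ (n * 4) * (1 + 2 * 2) ^+ (n * 4)))).

Lemma lower_const_gt0 : 0 < lower_const.
Proof.
have k0 := kappa_gt0 R m n; have k1 : 0 < kap^-1 + 1 by rewrite addr_gt0// invr_gt0.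
rewrite lt_min ltr01/= divr_gt0//.
  by rewrite exprn_gt0// divr_gt0// ?divr_gt0 ?exprn_gt0 ?mulr_gt0// divr_gt0.
Qed.

(** By [dirichlet] with [delta = phi]. *)
Lemma everywhere_solvable :
  (forall N, exists2 t, (N <= t)%N &
    B0 <= (\prod_j phi j (M ^ t)%N) * \prod_k Phi k (M ^ t)%N) ->
  infinitely_solvable phi Phi = setT.
Proof.
move=> h; rewrite -subTset => t _; apply/infinite_nat_unbounded => N.
have [U hU] := phi_eventually_le phi_lim (ltr01 : 0 < 1 :> R).
have [s Ns hs] := h (maxn N U).
have sM := leq_Mexp hM s; have s1 := Mexp_gt0 hM s.
exists (M ^ s)%N; first by rewrite (leq_trans _ sM)// (leq_trans (leq_maxl _ _) Ns).
split => //; apply: dirichlet => //.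
- by move=> k; exact: Phi_gt0.
- move=> j; rewrite phi_gt0//= hU//.
  by rewrite (leq_trans _ sM)// (leq_trans (leq_maxr _ _) Ns).
Qed.

Let k0 : 'I_m := Ordinal hm.

Section SmallVolumes.
Variables (t0 : nat) (delta : nat -> 'I_n -> R).
Let fi t j := phi j (M ^ (t0 + t))%N.
Let Fi t k := Phi k (M ^ (t0 + t))%N.
Hypothesis t0N : (N0 <= t0)%N.
Hypothesis delta_prod : forall t, (\prod_j delta t j) * (\prod_k Fi t k) = B0.
Hypothesis delta_fi : forall t j, fi t j <= delta t j <= 1.
Hypothesis delta_noninc : forall t j, delta t.+1 j <= delta t j.
Hypothesis Fi_ge1 : forall t k, 1 <= Fi t k.
Hypothesis Fi_kappa : forall t, 4 <= kap * Fi t k0.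

Let fi_gt0 t j : 0 < fi t j. Proof. by apply: phi_gt0; exact: Mexp_gt0. Qed.
Let Fi_gt0 t k : 0 < Fi t k. Proof. by apply: Phi_gt0; exact: Mexp_gt0. Qed.
Let delta_gt0 t j : 0 < delta t j.
Proof. by apply: lt_le_trans (fi_gt0 t j) _; case/andP: (delta_fi t j). Qed.
Let delta01 t j : 0 < delta t j <= 1.
Proof. by rewrite delta_gt0; case/andP: (delta_fi t j). Qed.

Lemma exists_grid_sizes : exists K : nat -> 'I_n -> nat, forall t j,
  [/\ (0 < K t j)%N, (K t j)%:R <= Fi t k0 / delta t j &
      Fi t k0 / delta t j <= 2 * (K t j)%:R].
Proof.
have /choice[K KP] : forall p : nat * 'I_n, exists N : nat, [/\ (0 < N)%N,
    N%:R <= Fi p.1 k0 / delta p.1 p.2 & Fi p.1 k0 / delta p.1 p.2 <= 2 * N%:R].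
  move=> [t j] /=; have x1 : 1 <= Fi t k0 / delta t j.
    rewrite ler_pdivlMr// mul1r; apply: le_trans (Fi_ge1 t k0).
    by case/andP: (delta01 t j).
  have [|N h1 h2] := @trunc_approx R (Fi t k0 / delta t j); first by apply: le_trans x1.
  have N1 : (0 < N)%N.
    by rewrite lt0n; apply/eqP => N0'; move: h2; rewrite N0' add0r ltNge x1.
  exists N; split => //; apply: (le_trans (ltW h2)).
  by rewrite mulr_natl mulr2n lerD2l// ler1n.
by exists (fun t j => K (t, j)) => t j; exact: (KP (t, j)).
Qed.

Local Notation ivec p := {ffun 'I_p -> int * int * int * int}.

(** A code stands for the vector [q = half_vec c.1] and the lattice points
    [z_j = half_quat (c.2 j)]. The lower bound on [|q_k0|] keeps the set where
    [|q A_j - z_j| < delta_j] within [O(delta_j / Phi_k0)] of its resonant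
    point. *)
Definition admissible t (c : ivec m * ivec n) := let q := @half_vec R m c.1 in
  [/\ forall k, Hurwitz (q 0 k), forall k, qnorm (q 0 k) <= Fi t k,
      kap * Fi t k0 < qnorm (q 0 k0) & forall j, Hurwitz (half_quat R (c.2 j))].

(** The value of row [k0] that makes [q A_j = z_j], given the other rows. The value
    [2] lies outside the unit cube, so numbers that code no admissible pair are
    never selected. *)
Definition resonant t N (A : d.-tuple rT) (a : 'I_(n * 4)) : R :=
  if unpickle N is Some c then
    if `[< admissible t c >] then
      qcoord (qinv (@half_vec R m c.1 0 k0) * (half_quat R (c.2 (mxvec_unindex a).1) -
        other_rows k0 (half_vec R c.1) (@quat_mx_of_tuple R m n A) (mxvec_unindex a).1))
        (mxvec_unindex a).2
    else 2
  else 2.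

Lemma measurable_resonant t N a : measurable_fun setT (fun A => resonant t N A a).
Proof.
rewrite /resonant; case: unpickle => [c|]; last exact: measurable_cst.
case: asboolP => _; last exact: measurable_cst.
apply: (@qmeasurableM R _ _ _ (fun A => half_quat R (c.2 (mxvec_unindex a).1) -
  other_rows k0 (half_vec R c.1) (@quat_mx_of_tuple R m n A) (mxvec_unindex a).1)).
apply: qmeasurableB; first exact: qmeasurable_cst.
rewrite /other_rows; apply: qmeasurable_sum => k _; apply: qmeasurableM.
exact: qmeasurable_entry.
Qed.

Lemma qnorm_resonant t c (A : d.-tuple rT) j : admissible t c ->
  qnorm ((half_vec R c.1 *m @quat_mx_of_tuple R m n A) 0 j - half_quat R (c.2 j)) =
  qnorm (half_vec R c.1 0 k0) * qnorm (@quat_mx_of_tuple R m n A k0 j -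
    qinv (half_vec R c.1 0 k0) * (half_quat R (c.2 j) -
      other_rows k0 (half_vec R c.1) (@quat_mx_of_tuple R m n A) j)).
Proof.
move=> [_ _ qk _]; set q := half_vec R c.1 in qk *.
have q0 : q 0 k0 != 0.
  apply/eqP => e; move: qk; rewrite e ltNge => /negP; apply.
  apply: (@le_trans _ _ 0); last first.
    by rewrite mulr_ge0// ltW// ?Fi_gt0// kappa_gt0.
  by rewrite /qnorm /= !expr0n /= !addr0 sqrtr0.
rewrite -qnormM mulrBr mulrA mulq_inv// mul1r (mulmx_other_rows k0) opprB.
by rewrite addrA.
Qed.

(** [ubiquity] with row [k0] as fibre, grid sides [1 / K t j] of order
    [delta_j / Phi_k0], and boxes of radius [phi_j / (2 Phi_k0)]. *)
Lemma infinitely_solvable_lower_small :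
  (lower_const%:E <= lebesgue_tuple R d (ucube d `&` infinitely_solvable phi Phi))%E.
Proof.
have [K KP] := exists_grid_sizes.
have kap0 := kappa_gt0 R m n.
have [d2 [h [h' [hK h'K hrow]]]] := split_coordinates (@row_index_inj m n k0).
pose KK t (a : 'I_(n * 4)) := K t (mxvec_unindex a).1.
(* The factor 2 compares the norm with the largest coordinate. *)
pose rr t (a : 'I_(n * 4)) := fi t (mxvec_unindex a).1 / (2 * Fi t k0).
have Kgt0 t j : (0 < K t j)%N by have [] := KP t j.
have Kp t j : 0 < (K t j)%:R :> R by rewrite ltr0n.
have mE := measurable_fibre_target h KK rr (measurable_resonant).
apply: (@le_trans _ _ (lebesgue_tuple R d (lim_sup_set (fibre_target h KK rr resonant)))); last first.
  apply: le_measure; rewrite ?inE.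
  - apply: bigcap_measurable => // N _; apply: bigcup_measurable => t _; exact: mE.
  - by apply: measurableI; [exact: measurable_ucube|exact: measurable_infinitely_solvable].
  move=> A hA; split; first by have [t _ []] := hA 0%N I.
  apply/infinite_nat_unbounded => N; have [t /= Nt [_ [N' _ [[Nu _] hs]]]] := hA N I.
  exists (M ^ (t0 + t))%N.
    by rewrite (leq_trans _ (leq_Mexp hM _))// (leq_trans Nt)// leq_addl.
  split; first exact: Mexp_gt0.
  have a0 : 'I_(n * 4) by apply: (@Ordinal _ 0); rewrite muln_gt0 hn.
  have := Nu a0; have {}hs a := (hs a).2; move: hs; rewrite /resonant.
  case: unpickle => [c|]; last by move=> _ /andP[_]; lra.
  case: asboolP => [adm|_]; last by move=> _ /andP[_]; lra.
  move=> hs _; exists (half_vec R c.1); have [qH qX qk zH] := adm.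
  have Fp := Fi_gt0 t k0.
  have qpos : 0 < qnorm (half_vec R c.1 0 k0).
    by apply: lt_trans qk; rewrite mulr_gt0.
  split => //.
    by apply: contraTneq qpos => ->; rewrite mxE /qnorm /= !expr0n /= !addr0 sqrtr0 ltxx.
  move=> j; apply/Hurwitz_dist_lt; exists (half_quat R (c.2 j)) => //.
  rewrite (qnorm_resonant _ _ adm).
  have hlt : qnorm (@quat_mx_of_tuple R m n A k0 j -
      qinv (half_vec R c.1 0 k0) * (half_quat R (c.2 j) -
      other_rows k0 (half_vec R c.1) (@quat_mx_of_tuple R m n A) j)) < fi t j / Fi t k0.
    have -> : fi t j / Fi t k0 = 2 * (fi t j / (2 * Fi t k0)) by field; rewrite gt_eqF.
    apply: qnorm_lt => e; have := hs (mxvec_index j e).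
    by rewrite /rr hrow /row_index mxvec_indexK/= qcoordB qcoord_mx.
  apply: (@lt_le_trans _ _ (qnorm (half_vec R c.1 0 k0) * (fi t j / Fi t k0))).
    by rewrite ltr_pM2l.
  rewrite mulrCA -[leRHS]mulr1; apply: ler_wpM2l; first exact: ltW (fi_gt0 t j).
  by rewrite ler_pdivrMr// mul1r.
apply: (@le_trans _ _ ((((1 / 2) ^+ (n * 4) / 2 / (2 * (kap^-1 + 1)) ^+ (n * 4)) ^+ 2 /
     (4 * (4 ^+ (n * 4) * (1 + 2 * 2) ^+ (n * 4))))%:E)).
  by rewrite lee_fin ge_min lexx orbT.
have c10 : 0 < c1 by apply: lt_trans hc1.
have th0 : 0 <= c1^-1 by rewrite invr_ge0 ltW.
have Fgrow s k : c1 ^+ k * Fi s k0 <= Fi (s + k) k0.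
  elim: k => [|k ih]; first by rewrite expr0 mul1r addn0.
  rewrite exprS -mulrA addnS; apply: (@le_trans _ _ (c1 * Fi (s + k) k0)).
    by apply: ler_wpM2l => //; exact: ltW.
  by rewrite /Fi addnS; apply: Phi_growth; rewrite (leq_trans t0N)// leq_addr.
have dmono s k j : delta (s + k) j <= delta s j.
  elim: k => [|k ih]; first by rewrite addn0.
  by rewrite addnS; apply: le_trans ih.
apply: (@ubiquity R d (n * 4) d2 h h' hK h'K KK rr resonant measurable_resonant _
  (fun t => good_set k0 (delta t) (Fi t)) kap^-1 2 _ c1^-1) => //.
- move=> t N y x x'; apply/funext => a; rewrite /resonant.
  case: unpickle => [c|//]; case: asboolP => // _.
  by rewrite (other_rows_base hK h'K hrow _ y x x').
- by rewrite invr_ge0 ltW.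
- by rewrite th0 invf_lt1.
- by move=> t a; exact: Kgt0.
- by move=> t a; rewrite divr_gt0// mulr_gt0.
- move=> t a; have [_ K1 _] := KP t (mxvec_unindex a).1.
  rewrite /rr /KK; set j := (mxvec_unindex a).1 in K1 *.
  have Fp := Fi_gt0 t k0; have dp := delta_gt0 t j.
  apply: (@le_trans _ _ (fi t j / (2 * Fi t k0) * (Fi t k0 / delta t j))).
    by apply: ler_wpM2l => //; rewrite divr_ge0 ?mulr_ge0 ?(ltW Fp) ?ltW.
  have -> : fi t j / (2 * Fi t k0) * (Fi t k0 / delta t j) = (fi t j / delta t j) * (1 / 2).
    by field; rewrite !gt_eqF.
  by rewrite ler_piMl// ler_pdivrMr// mul1r; case/andP: (delta_fi t j).
- move=> s t a st; rewrite /KK; set j := (mxvec_unindex a).1.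
  have [_ K1 _] := KP s j; have [_ _ K2] := KP t j.
  have Fp := Fi_gt0 t k0; have dp := delta_gt0 t j; have dps := delta_gt0 s j.
  have ck : 0 < c1 ^+ (t - s) by rewrite exprn_gt0.
  rewrite (_ : 2 * _ * _ = c1 ^- (t - s) * (2 * (K t j)%:R)); last by rewrite exprVn; ring.
  apply: (le_trans K1).
  apply: (@le_trans _ _ (c1 ^- (t - s) * (Fi t k0 / delta t j))); last first.
    by rewrite ler_pM2l ?invr_gt0.
  rewrite mulrA; apply: ler_pM.
  - exact: ltW (Fi_gt0 s k0).
  - by rewrite invr_ge0 ltW.
  - by rewrite ler_pdivlMl//; have := Fgrow s (t - s)%N; rewrite subnKC.
  - by rewrite lef_pV2 ?posrE//; have := dmono s (t - s)%N j; rewrite subnKC.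
- by move=> t; exact: measurable_good_set.
- by move=> t; exact: good_set_sub.
- move=> t; apply: good_set_measure => //.
  by apply: le_trans (Fi_kappa t); rewrite ler1n.
- move=> t A AG.
  have [q [[q0 qH qe qX] qk]] := good_set_point hm (delta01 t) (Fi_gt0 t) (delta_prod t) AG.
  have [v qv] := Hurwitz_half_vec qH.
  have /choice[w wP] : forall j, exists w, Hurwitz (half_quat R w) /\
      qnorm ((q *m @quat_mx_of_tuple R m n A) 0 j - half_quat R w) < delta t j.
    move=> j; have /Hurwitz_dist_lt[z zH zlt] := qe j.
    by have [w zw] := Hurwitz_half zH; exists w; rewrite -zw.
  pose c : ivec m * ivec n := (v, [ffun j => w j]).
  have adm : admissible t c.
    rewrite /admissible /= -qv; split => // j; rewrite ffunE; exact: (wP j).1.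
  exists (pickle c).
  have qpos : 0 < qnorm (q 0 k0) by apply: lt_trans qk; rewrite mulr_gt0.
  have close a : `|tnth A (h (inl a)) - resonant t (pickle c) A a| <
      delta t (mxvec_unindex a).1 / (kap * Fi t k0).
    rewrite /resonant pickleK; case: asboolP => // _.
    have -> : tnth A (h (inl a)) =
        qcoord (@quat_mx_of_tuple R m n A k0 (mxvec_unindex a).1) (mxvec_unindex a).2.
      by rewrite qcoord_mx hrow.
    rewrite -qcoordB; apply: (le_lt_trans (qcoord_le_qnorm _ _)).
    set j := (mxvec_unindex a).1.
    rewrite ltr_pdivlMr ?mulr_gt0// mulrC.
    have := qnorm_resonant A j adm; rewrite /= -qv ffunE => e.
    apply: (le_lt_trans _ (wP j).2); rewrite e.
    by apply: ler_wpM2r; [exact: qnorm_ge0|exact: ltW].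
  split => [a|a]; last first.
    apply: (le_trans (ltW (close a))).
    have [_ K1 _] := KP t (mxvec_unindex a).1.
    rewrite /KK; move: (mxvec_unindex a).1 K1 => j K1.
    have Fp := Fi_gt0 t k0; have dp := delta_gt0 t j.
    have -> : delta t j / (kap * Fi t k0) = kap^-1 * (Fi t k0 / delta t j)^-1.
      by field; rewrite !gt_eqF.
    apply: ler_wpM2l; first by rewrite invr_ge0 ltW.
    by rewrite lef_pV2 ?posrE ?divr_gt0.
  have close4 : delta t (mxvec_unindex a).1 / (kap * Fi t k0) <= 1 / 4.
    rewrite ler_pdivrMr ?mulr_gt0//; have := Fi_kappa t.
    by have /andP[_] := delta01 t (mxvec_unindex a).1; lra.
  have [[_ mid] _] := AG.
  have /andP[m1 m2] : 1 / 4 <= tnth A (h (inl a)) < 3 / 4 by rewrite hrow; exact: mid.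
  have := lt_le_trans (close a) close4; rewrite ltr_norml => /andP[l1 l2].
  by apply/andP; split; lra.
move=> B.
pose b : R := (4 ^+ n * B0) ^+ 4.
have b0 : 0 < b by rewrite exprn_gt0// mulr_gt0 ?dirichlet_const_gt0// exprn_gt0.
have [T hT] := volume_div t0 (b * B).
exists T; rewrite -(ler_pM2l b0); apply: (le_trans hT).
rewrite mulr_sumr; apply: ler_sum => t _.
have pd : 0 < \prod_j delta t j by apply: prodr_gt0.
have pf : 0 < \prod_j fi t j by apply: prodr_gt0.
apply: (@le_trans _ _ (b * \prod_j (fi t j / (4 * delta t j)) ^+ 4)); last first.
  rewrite ler_pM2l// -prod_mxvec; apply: ler_prod => a _.
  rewrite /rr /KK; move: (mxvec_unindex a).1 => j.
  have [_ _ K2] := KP t j; have Fp := Fi_gt0 t k0; have dp := delta_gt0 t j.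
  apply/andP; split; first by rewrite divr_ge0 ?mulr_ge0 ?ltW.
  have -> : fi t j / (4 * delta t j) = fi t j / (2 * Fi t k0) * ((Fi t k0 / delta t j) / 2).
    by field; rewrite !gt_eqF.
  apply: ler_wpM2l; first by rewrite divr_ge0 ?mulr_ge0 ?ltW.
  by rewrite ler_pdivrMr// [leRHS]mulrC.
rewrite prodrXl /b -exprMn /volume -/(fi t) -/(Fi t).
have -> : \prod_j (fi t j / (4 * delta t j)) = (\prod_j fi t j) / (4 ^+ n * \prod_j delta t j).
  by rewrite big_split/= prodfV big_split/= prodr_const card_ord.
rewrite -(delta_prod t) le_eqVlt; apply/orP; left; apply/eqP; congr (_ ^+ 4).
rewrite /fi /Fi; field; rewrite expf_neq0//=.
by rewrite gt_eqF.
Qed.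

End SmallVolumes.

(** Either the volumes reach the Dirichlet constant infinitely often, or they stay
    below it and leave room for non-increasing [delta >= phi] with
    [prod delta prod Phi = B0]. *)
Lemma infinitely_solvable_lower :
  (lower_const%:E <= lebesgue_tuple R d (ucube d `&` infinitely_solvable phi Phi))%E.
Proof.
have B00 := dirichlet_const_gt0 R m n; have kap0 := kappa_gt0 R m n.
have [big|small] := pselect (forall N, exists2 t, (N <= t)%N &
    B0 <= (\prod_j phi j (M ^ t)%N) * \prod_k Phi k (M ^ t)%N).
  rewrite everywhere_solvable// setIT.
  apply: (@le_trans _ _ 1%E); first by rewrite lee_fin ge_min lexx.
  by rewrite -(lebesgue_ucube R d).
have [N {}small] : exists N, forall t, (N <= t)%N ->
    (\prod_j phi j (M ^ t)%N) * \prod_k Phi k (M ^ t)%N < B0.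
  apply: contrapT => h; apply: small => N; apply: contrapT => h'; apply: h.
  by exists N => t Nt; rewrite ltNge; apply/negP => le; apply: h'; exists t.
have [U hU] := phi_eventually_le phi_lim (ltr01 : 0 < 1 :> R).
(* A common bound that gives [Phi >= 1], [kap * Phi >= 4] and [prod Phi >= B0]. *)
have [V hV] := Phi_eventually_ge Phi_lim (1 + 4 / kap + B0).
pose t0 := maxn (maxn N N0) (maxn U V).
have [tN tN0 tU tV] : [/\ (N <= t0)%N, (N0 <= t0)%N, (U <= t0)%N & (V <= t0)%N].
  by rewrite /t0 !leq_max !leqnn ?orbT.
have ge_t0 W t : (W <= t0)%N -> (W <= M ^ (t0 + t))%N.
  by move=> Wt; rewrite (leq_trans Wt)// (leq_trans _ (leq_Mexp hM _))// leq_addr.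
have k40 : 0 < 4 / kap by rewrite divr_gt0.
have Fge t k : 1 + 4 / kap + B0 <= Phi k (M ^ (t0 + t))%N by rewrite hV// ge_t0.
have F1 t k : 1 <= Phi k (M ^ (t0 + t))%N by have := Fge t k; lra.
have FP t : 0 < \prod_k Phi k (M ^ (t0 + t))%N.
  by apply: prodr_gt0 => k _; apply: lt_le_trans (F1 t k).
have [|||||| delta hd] := @exists_noninc_majorant R n
  (fun t j => phi j (M ^ (t0 + t))%N) (fun t => B0 / \prod_k Phi k (M ^ (t0 + t))%N).
- by move=> t j; apply: phi_gt0; exact: Mexp_gt0.
- by move=> t j; rewrite hU// ge_t0.
- by move=> t j; rewrite addnS phi_noninc ?Mexp_gt0 ?MexpS.
- move=> t; apply: ler_wpM2l; first exact: ltW.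
  rewrite lef_pV2 ?posrE//; apply: ler_prod => k _.
  rewrite addnS Phi_nondec ?Mexp_gt0 ?MexpS// andbT ltW//.
  by apply: lt_le_trans (F1 t k).
- rewrite ler_pdivrMr// mul1r (bigD1 k0)//= -[leLHS]mulr1; apply: ler_pM => //.
  + exact: ltW.
  + by have := Fge 0%N k0; lra.
  + elim/big_rec: _ => // k x _ x1; rewrite -[leLHS]mulr1.
    by apply: ler_pM => //; exact: F1.
- move=> t; rewrite ler_pdivlMr//; apply: ltW; apply: small.
  by rewrite (leq_trans tN)// leq_addr.
apply: (@infinitely_solvable_lower_small t0 delta) => //.
- by move=> t; have [_ -> _] := hd t; rewrite divfK// gt_eqF.
- by move=> t; have [] := hd t.
- by move=> t j; have [_ _] := hd t.
- move=> t; rewrite -ler_pdivrMl// mulrC.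
  by have := Fge t k0; lra.
Qed.

End Divergence.

Theorem theorem11 (R : realType) (m n : nat) (hm : (0 < m)%N) (hn : (0 < n)%N)
    (phi : 'I_n -> nat -> R) (Phi : 'I_m -> nat -> R)
    (phi_gt0 : forall j u, (1 <= u)%N -> 0 < phi j u)
    (phi_noninc : forall j u v, (1 <= u)%N -> (u <= v)%N -> phi j v <= phi j u)
    (phi_lim : forall j, phi j u @[u --> \oo] --> (0 : R))
    (Phi_gt0 : forall k u, (1 <= u)%N -> 0 < Phi k u)
    (Phi_nondec : forall k u v, (1 <= u)%N -> (u <= v)%N -> Phi k u <= Phi k v)
    (Phi_lim : forall k, Phi k u @[u --> \oo] --> +oo)
    (N0 M : nat) (c1 c2 : R)
    (hN0 : (1 <= N0)%N) (hM : (2 <= M)%N) (hc1 : 1 < c1) (hc2 : 1 < c2)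
    (Phi_growth : forall j : nat, (N0 <= j)%N -> forall k,
       c1 * Phi k (M ^ j)%N <= Phi k (M ^ j.+1)%N /\
       Phi k (M ^ j.+1)%N <= c2 * Phi k (M ^ j)%N) :
  let S : \bar R :=
    (\sum_(1 <= q <oo)
       (q%:R^-1 * ((\prod_j phi j q) * (\prod_k Phi k q)) ^+ 4)%R%:E)%E in
  ((S < +oo)%E -> quat_mx_measure (approximable_mx phi Phi) = 0%E) /\
  (S = +oo%E ->
     quat_mx_measure (approximable_mx phi Phi) =
     quat_mx_measure (@Hurwitz_cell_mx R m n)).

Proof.
move=> S.
have growth2 j : (N0 <= j)%N -> forall k, Phi k (M ^ j.+1)%N <= c2 * Phi k (M ^ j)%N.
  by move=> jN k; have [] := Phi_growth j jN k.
have M0 : (0 < M)%N by apply: leq_trans hM.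
split => [Soo|Soo].
  apply: approximable_null.
  exact: (infinitely_solvable_null phi_gt0 phi_noninc phi_lim Phi_gt0 Phi_nondec Phi_lim hM hc2 growth2).
have div := volume_unbounded phi_gt0 phi_noninc Phi_gt0 Phi_nondec hM hc2 growth2 Soo.
apply: approximable_full; apply: (infinitely_solvable_full (lower_const_gt0 R m n)) => N N1.
have Np : 0 < N%:R :> R by rewrite ltr0n.
(* [Phi / N] satisfies the hypotheses on [Phi], with a divergent series. *)
apply: (@infinitely_solvable_lower R m n hm hn phi (fun k u => Phi k u / N%:R)
  phi_gt0 phi_noninc phi_lim _ _ _ N0 M c1) => //.
- by move=> k u u1; rewrite divr_gt0// Phi_gt0.
- by move=> k u v u1 uv; rewrite ler_pM2r ?invr_gt0// Phi_nondec.
- move=> k; apply/cvgryPge => B.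
  have /cvgryPge /(_ (B * N%:R)) := Phi_lim k; apply: filterS => u.
  by rewrite ler_pdivlMr.
- move=> j jN k; rewrite mulrA ler_pM2r ?invr_gt0//.
  by have [] := Phi_growth j jN k.
move=> K B; have [T hT] := div K (B * (N%:R ^+ m) ^+ 4).
have Nm : 0 < (N%:R ^+ m) ^+ 4 :> R by rewrite !exprn_gt0.
exists T; rewrite -(ler_pM2r Nm); apply: (le_trans hT).
rewrite mulr_suml le_eqVlt; apply/orP; left; apply/eqP; apply: eq_bigr => i _.
rewrite /volume -exprMn; congr (_ ^+ 4); rewrite big_split/= prodr_const card_ord.
by rewrite exprVn -!mulrA mulVf ?mulr1// expf_neq0// gt_eqF.
Qed.
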